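(* Let $K$ be a finite subset of the closed unit disc in $\mathbb{C}$ and let $x\in K^{\mathbb{N}}$. Then $x$ is weakly correlated to some strictly ergodic point of $K^{\mathbb{N}}$ if and only if $x$ is weakly correlated to some point of $K^{\mathbb{N}}$ generic for an ergodic measure. Likewise, $x$ is strongly correlated to some strictly ergodic point of $K^{\mathbb{N}}$ if and only if $x$ is strongly correlated to some point of $K^{\mathbb{N}}$ generic for an ergodic measure.
   Context: $\mathbb{N}=\{1,2,\dots\}$; $K^{\mathbb{N}}$ carries the left shift, and ''ergodic measure'' means an ergodic shift-invariant Borel probability measure on $K^{\mathbb{N}}$. A point $y\in K^{\mathbb{N}}$ is strictly ergodic if its shift orbit-closure, with the shift, is a strictly ergodic (i.e. minimal and uniquely ergodic) topological dynamical system. A point $y\in K^{\mathbb{N}}$ is generic for a shift-invariant probability measure $\nu$ if for every $m\ge1$ and every block $B\in K^m$, $\lim_n\frac1n\#\{i\in\{1,\dots,n\}:[y_i,\dots,y_{i+m-1}]=B\}=\nu(B)$, where $\nu(B)$ is the measure of the cylinder determined by $B$ at coordinates $1,\dots,m$. For blocks $A=[a_1,\dots,a_n]$, $B=[b_1,\dots,b_n]$ of complex numbers put $\mathsf{corr}(A,B)=\frac1n\sum_{i=1}^n a_i\overline{b_i}-\bigl(\frac1n\sum_{i=1}^n a_i\bigr)\bigl(\frac1n\sum_{i=1}^n\overline{b_i}\bigr)$. Let $x_{[1,n]}=[x_1,\dots,x_n]$. Two bounded sequences $x,y$ are weakly correlated if $\limsup_n|\mathsf{corr}(x_{[1,n]},y_{[1,n]})|>0$,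 and strongly correlated if $\liminf_n|\mathsf{corr}(x_{[1,n]},y_{[1,n]})|>0$. *)

(* Defs.v *)
From HB Require Import structures.
From mathcomp Require Import all_boot all_order all_algebra finmap.
From mathcomp Require Import all_classical all_reals all_analysis.
From mathcomp Require Import complex.
Set Implicit Arguments.
Unset Strict Implicit.
Unset Printing Implicit Defensive.
Import Order.TTheory GRing.Theory Num.Theory.
Local Open Scope classical_set_scope.
Local Open Scope ring_scope.

(* Measurable types of the library must be pointed. [based p] is the space [X]
   with [p] as its base point; the base point plays no other role. *)
Definition based (X : Type) (p : X) : Type := X.

HB.instance Definition _ (X : topologicalType) (p : X) :=
  Topological.copy (based p) X.
HB.instance Definition _ (X : topologicalType) (p : X) :=
  isPointed.Build (based p) p.

Definition borel (X : topologicalType) (p : X) :=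
  g_sigma_algebraType (@open (based p)).

Section Dynamics.
Variables (R : realType) (X : topologicalType) (T : X -> X).

Definition invariant_measure (p : X) (mu : probability (borel p) R) : Prop :=
  forall A : set (borel p), measurable A -> mu (T @^-1` A) = mu A.

Definition ergodic_measure (p : X) (mu : probability (borel p) R) : Prop :=
  invariant_measure mu /\
  forall A : set (borel p), measurable A -> T @^-1` A = A ->
    mu A = 0%E \/ mu A = 1%E.

(* [T] is not assumed invertible: minimality is about forward-invariant sets. *)
Definition minimal_system : Prop :=
  forall A : set X, closed A -> A !=set0 -> T @` A `<=` A -> A = setT.

Definition uniquely_ergodic (p : X) : Prop :=
  exists mu : probability (borel p) R, invariant_measure mu /\
    forall nu : probability (borel p) R, invariant_measure nu ->
      forall A : set (borel p), measurable A -> nu A = mu A.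

Definition strictly_ergodic_system : Prop :=
  minimal_system /\ exists p : X, uniquely_ergodic p.

End Dynamics.

(* Sequences indexed from 0, with the product of the discrete topologies. *)
Notation seq_space K := {ptws nat -> discrete_topology K}.

Section Shift.
Variable K : finType.

Definition seq_shift (z : seq_space K) : seq_space K := fun n => z n.+1.

Definition orbit_closure (y : seq_space K) : set (seq_space K) :=
  closure (range (fun n => iter n seq_shift y)).

Lemma seq_shift_continuous : continuous seq_shift.
Proof.
move=> z.
have F : Filter (seq_shift @ z) := @fmap_filter _ _ seq_shift _ (nbhs_filter z).
apply/(@cvg_sup _ _ _ (seq_shift @ z)) => i; move: z {F}.
apply/(@continuousP _ (initial_topology (@^~ i))) => A [B oB <-].
pose dK : topologicalType := discrete_topology K.
have := @open_comp (prod_topology (fun=> dK)) dK (@proj nat (fun=> dK) i.+1) B.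
by apply=> // z _; exact: (@proj_continuous nat (fun=> dK)).
Qed.

Lemma orbit_closure_shift (y z : seq_space K) :
  z \in orbit_closure y -> seq_shift z \in orbit_closure y.
Proof.
rewrite !inE => cz U /seq_shift_continuous /cz[_ [[n _ <-] Un]].
by exists (seq_shift (iter n seq_shift y)); split=> //; exists n.+1.
Qed.

Definition orbit_closure_map (y : seq_space K) (z : orbit_closure y) :
    orbit_closure y :=
  exist _ (seq_shift (\val z)) (orbit_closure_shift (valP z)).

Definition strictly_ergodic_point (R : realType) (y : seq_space K) : Prop :=
  strictly_ergodic_system R (@orbit_closure_map y).

Definition cylinder (m : nat) (B : m.-tuple K) : set (seq_space K) :=
  [set z | forall j : 'I_m, z j = tnth B j].

Definition occurrences (y : seq_space K) (m : nat) (B : m.-tuple K) (n : nat) :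
    nat :=
  #|[pred i : 'I_n | [forall j : 'I_m, (y (i + j)%N : K) == tnth B j]]|.

Definition generic (R : realType) (p y : seq_space K)
    (nu : probability (borel p) R) : Prop :=
  forall (m : nat) (B : m.-tuple K), (0 < m)%N ->
    ((occurrences y B n)%:R / n%:R : R)%:E @[n --> \oo] --> nu (cylinder B).

Definition generic_for_ergodic (R : realType) (y : seq_space K) : Prop :=
  exists nu : probability (borel y) R,
    ergodic_measure seq_shift nu /\ generic y nu.

End Shift.

Section Correlation.
Variable R : realType.

Definition corr (n : nat) (A B : n.-tuple R[i]) : R[i] :=
  n%:R^-1 * (\sum_(i < n) tnth A i * (tnth B i)^* )
  - (n%:R^-1 * \sum_(i < n) tnth A i) * (n%:R^-1 * \sum_(i < n) (tnth B i)^* ).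

Definition initial_block (u : nat -> R[i]) (n : nat) : n.-tuple R[i] :=
  [tuple u i | i < n].

Definition abs_corr (u v : nat -> R[i]) (n : nat) : \bar R :=
  (Normc.normc (corr (initial_block u n) (initial_block v n)))%:E.

Definition weakly_correlated (u v : nat -> R[i]) : Prop :=
  (0 < limn_esup (abs_corr u v))%E.

Definition strongly_correlated (u v : nat -> R[i]) : Prop :=
  (0 < limn_einf (abs_corr u v))%E.

End Correlation.

(* Main.v *)
(* A strictly ergodic point is generic for the unique invariant measure of its
   orbit closure, which gives one direction. Conversely, a point y generic for
   an ergodic measure differs, on a set of arbitrarily small density (counted
   over every initial segment), from some strictly ergodic y', and such a change
   moves the correlations with x by an arbitrarily small amount.

   To build y', ergodicity is used only as a statement about y itself: for every
   pattern, most windows of a suitable length see it with nearly the same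
   frequency. One finds cutting positions with arbitrarily large, bounded gaps
   that are coded (up to small density) by y, or by y together with an odometer
   when y is asymptotically periodic. Most words between cuts have good
   frequencies; each bad word is replaced by a concatenation, of the same length,
   of words of the previous stage that is almost entirely made of repetitions of
   a long prefix of y, and a copy of that prefix is put at the head of each good
   word. The words of stage k+1 are concatenations of words of stage k, all of
   them have nearly the same frequencies and contain a long prefix of y, so the
   limit has uniform frequencies and is uniformly recurrent. *)

Require Import Defs.
From HB Require Import structures.
From mathcomp Require Import all_boot all_order all_algebra finmap.
From mathcomp Require Import all_classical all_reals all_analysis.
From mathcomp Require Import measurable_realfun complex.
From mathcomp Require Import zify ring lra.
Set Implicit Arguments.
Unset Strict Implicit.
Unset Printing Implicit Defensive.
Import Order.TTheory GRing.Theory Num.Theory.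
Import numFieldNormedType.Exports.
Local Open Scope classical_set_scope.
Local Open Scope ring_scope.

(** * Words and counting *)

(** Two demands shape each stage. The change must be small on every initial segment, because the
    errors of infinitely many stages are added at a fixed [n]; hence a prefix, long enough to
    outweigh the rare changes that follow, is left untouched and becomes one more word. And
    positions must be preserved, so replacements keep lengths; a length need not be a multiple of
    that of the repeated prefix, so a few old words are kept to supply the remainder. The modified
    sequences are not known to be generic for any measure. All of them, and all cuts, are therefore
    coded from one fixed sequence [z], and the averaging property of [z] passes to codes and to
    their limits in density. An odometer cannot be adjoined to an arbitrary [y], since common
    eigenvalues may destroy ergodicity. Next to an asymptotic period [p] a prime above [p] is safe;
    in the remaining case [y] has words of arbitrarily small nonzero density, and these produce the
    cuts. For the easy direction, limits of frequencies along ultrafilters supply the invariant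
    measures, so that uniqueness forces the frequencies to converge. *)

Definition blk (T : Type) (s : nat -> T) (i n : nat) : seq T :=
  [seq s k | k <- iota i n].

Lemma size_blk T (s : nat -> T) i n : size (blk s i n) = n.
Proof. by rewrite size_map size_iota. Qed.

Lemma nth_blk T (s : nat -> T) x0 i n k :
  (k < n)%N -> nth x0 (blk s i n) k = s (i + k)%N.
Proof. by move=> kn; rewrite (nth_map 0%N) ?size_iota ?nth_iota. Qed.

Lemma blk_cat T (s : nat -> T) i m n :
  blk s i (m + n) = blk s i m ++ blk s (i + m) n.
Proof. by rewrite /blk iotaD map_cat. Qed.

Lemma eq_blk T (s t : nat -> T) i j n :
  (forall k, (k < n)%N -> s (i + k)%N = t (j + k)%N) -> blk s i n = blk t j n.
Proof.
elim: n i j => // n IHn i j st; rewrite /blk /=; congr (_ :: _).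
  by have := st 0%N isT; rewrite !addn0.
by apply: IHn => k kn; rewrite !addSnnS; exact: st.
Qed.

Lemma blk_inj T (s t : nat -> T) i j n k :
  blk s i n = blk t j n -> (k < n)%N -> s (i + k)%N = t (j + k)%N.
Proof.
move=> e kn; have x0 := s 0%N.
by rewrite -(nth_blk s x0 i kn) -(nth_blk t x0 j kn) e.
Qed.

Definition cnt (f : nat -> bool) (n : nat) : nat := (\sum_(i < n) f i)%N.

Lemma cntE f n : cnt f n = #|[pred i : 'I_n | f i]|.
Proof. by rewrite /cnt -sum1_card [RHS]big_mkcond; apply: eq_bigr => i _; rewrite inE; case: (f i). Qed.

Section Count.
Implicit Types f g : nat -> bool.

Lemma cnt0 f : cnt f 0 = 0%N. Proof. by rewrite /cnt big_ord0. Qed.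

Lemma cntS f n : cnt f n.+1 = (cnt f n + f n)%N.
Proof. by rewrite /cnt big_ord_recr. Qed.

Lemma cntSl f n : cnt f n.+1 = (f 0%N + cnt (fun i => f i.+1) n)%N.
Proof. by rewrite /cnt big_ord_recl. Qed.

Lemma cnt_le f n : (cnt f n <= n)%N.
Proof. by elim: n => [|n IHn]; rewrite ?cnt0 // cntS; case: (f n); lia. Qed.

Lemma eq_cnt f g n : (forall i, (i < n)%N -> f i = g i) -> cnt f n = cnt g n.
Proof. by move=> fg; apply: eq_bigr => i _; rewrite fg. Qed.

Lemma leq_cnt f g n : (forall i, (i < n)%N -> f i -> g i) -> (cnt f n <= cnt g n)%N.
Proof.
by move=> fg; apply: leq_sum => i _; have := fg i (ltn_ord i); case: (f i) => // /(_ isT) ->.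
Qed.

Lemma cnt_cat f m n : cnt f (m + n) = (cnt f m + cnt (fun i => f (m + i)%N) n)%N.
Proof.
by elim: n => [|n IHn]; rewrite ?addn0 ?cnt0 ?addn0 // addnS !cntS IHn addnA.
Qed.

Lemma cnt_negb f n : (cnt (fun i => ~~ f i) n + cnt f n)%N = n.
Proof. by elim: n => [|n IHn]; rewrite ?cnt0 // !cntS addnACA IHn; case: (f n) => /=; lia. Qed.

Lemma cnt_shift_le f n : (cnt (fun i => f i.+1) n <= cnt f n + 1)%N.
Proof. by have := cntSl f n; have := cntS f n; case: (f n); case: (f 0%N) => /=; lia. Qed.

Lemma cnt_shift_ge f n : (cnt f n <= cnt (fun i => f i.+1) n + 1)%N.
Proof. by have := cntSl f n; have := cntS f n; case: (f n); case: (f 0%N) => /=; lia. Qed.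

End Count.

Section Occ.
Variable K : finType.
Definition occurs (y : nat -> K) (w : seq K) (i : nat) : bool := blk y i (size w) == w.

Lemma occurs_cat y w v i : occurs y (w ++ v) i = occurs y w i && occurs y v (i + size w).
Proof.
rewrite /occurs size_cat blk_cat; apply/eqP/andP => [e|[/eqP -> /eqP ->//]].
have e1 := congr1 (take (size w)) e; have e2 := congr1 (drop (size w)) e.
by move: e1 e2; rewrite !take_size_cat ?drop_size_cat ?size_blk // => -> ->; rewrite !eqxx.
Qed.

Lemma occurs1 y a i : occurs y [:: a] i = (y i == a).
Proof. by rewrite /occurs /= eqseq_cons andbT. Qed.

(** An occurrence of [w] is followed by exactly one letter, and a non-initial one is preceded by
    exactly one. For limit frequencies the first fact becomes additivity on cylinders, the second
    ([occurs_cons]) shift invariance. *)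
Lemma occurs_rcons y w i : (occurs y w i : nat) = (\sum_(a : K) occurs y (rcons w a) i)%N.
Proof.
under eq_bigr => a _ do rewrite -cats1 occurs_cat occurs1.
case: (occurs y w i) => /=; last by rewrite big1.
by rewrite (bigD1 (y (i + size w)%N)) //= eqxx big1 // => a /negbTE; rewrite eq_sym => ->.
Qed.

Lemma occurs_cons y w i : (occurs y w i.+1 : nat) = (\sum_(a : K) occurs y (a :: w) i)%N.
Proof.
under eq_bigr => a _ do rewrite -cat1s occurs_cat occurs1 addn1.
case: (occurs y w i.+1) => /=; last by rewrite big1 // => a _; rewrite andbF.
by rewrite (bigD1 (y i)) //= eqxx big1 // => a /negbTE; rewrite eq_sym => ->.
Qed.

Lemma cnt_sum (F : K -> nat -> bool) (f : nat -> bool) n :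
  (forall i, (f i : nat) = (\sum_(a : K) F a i)%N) -> cnt f n = (\sum_(a : K) cnt (F a) n)%N.
Proof. by move=> fF; rewrite /cnt exchange_big; apply: eq_bigr => i _. Qed.

Lemma occurrencesE (y : seq_space K) m (B : m.-tuple K) n :
  occurrences y B n = cnt (occurs y B) n.
Proof.
rewrite cntE /occurrences; apply: eq_card => i; rewrite !inE /occurs.
apply/forallP/eqP => [h|e j].
  apply: (@eq_from_nth _ (y 0%N)); rewrite size_blk // => j; rewrite size_tuple => jm.
  by rewrite nth_blk ?size_tuple // (eqP (h (Ordinal jm))) (tnth_nth (y 0%N)).
by apply/eqP; rewrite (tnth_nth (y 0%N)) -[in RHS]e nth_blk // size_tuple.
Qed.

End Occ.

(** * Measures on sequences and uniform frequencies *)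

Section Cyl.
Variable K : finType.
Implicit Types (w : seq K) (z : seq_space K).

Definition cyl w : set (seq_space K) := [set z | blk z 0 (size w) = w].

Lemma open_coord (i : nat) (a : K) : open [set z : seq_space K | z i = a].
Proof.
pose dK : topologicalType := discrete_topology K.
have := @open_comp (prod_topology (fun=> dK)) dK (@proj nat (fun=> dK) i) [set a].
apply; last exact: discrete_open.
by move=> z _; exact: (@proj_continuous nat (fun=> dK)).
Qed.

Lemma cyl_open w : open (cyl w).
Proof.
case: w => [|a0 w0]; first by rewrite (_ : cyl [::] = setT) ?predeqE //; exact: openT.
set w := a0 :: w0.
have -> : cyl w = \bigcap_(i in `I_(size w)) [set z : seq_space K | z i = nth a0 w i].
  rewrite predeqE => z; split => [e i /= il|h].
    by rewrite -e nth_blk ?size_blk.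
  apply: (@eq_from_nth _ a0); rewrite size_blk // => i il.
  by rewrite nth_blk //; exact: h.
elim: (size w) => [|n IHn].
  by rewrite II0 bigcap_set0; exact: openT.
rewrite IIS bigcap_setU bigcap_set1; apply: openI => //; exact: open_coord.
Qed.

(** The topology is a supremum of initial topologies, so convergence of the filter of prefix
    cylinders can be tested one coordinate at a time; a prefix of length [i + 1] fixes coordinate
    [i]. *)
Lemma cyl_nbhs z (U : set (seq_space K)) : open U -> U z ->
  exists n, cyl (blk z 0 n) `<=` U.
Proof.
move=> oU Uz.
have : nbhs z U by apply: open_nbhs_nbhs.
suff : (filter_from (@setT nat) (fun n => cyl (blk z 0 n))) --> z.
  by move=> /[apply] -[n _ h]; exists n.
have FF : Filter (filter_from (@setT nat) (fun n => cyl (blk z 0 n))).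
  apply: filter_from_filter; first by exists 0%N.
  move=> m n _ _; exists (maxn m n) => //.
  have h k : (k <= maxn m n)%N -> cyl (blk z 0 (maxn m n)) `<=` cyl (blk z 0 k).
    move=> km u; rewrite /cyl /= !size_blk => e.
    by apply: eq_blk => i ik; apply: (blk_inj e); lia.
  by move=> u hu; split; apply: h hu; rewrite ?leq_maxl ?leq_maxr.
apply/(@cvg_sup _ _ _ _) => i.
move=> A /= [B [[B' oB' <-] /= Bz] sBA]; apply: filterS sBA _.
exists i.+1 => // u; rewrite /cyl /= size_blk => e.
have := blk_inj (k := i) e (leqnn _) => /= eu.
by move: Bz; rewrite /= /preimage /= eu.
Qed.

Lemma open_cylE (U : set (seq_space K)) : open U ->
  U = \bigcup_(w in [set w | cyl w `<=` U]) cyl w.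
Proof.
move=> oU; rewrite predeqE => z; split=> [Uz|[w /= wU /wU //]].
have [n nU] := cyl_nbhs oU Uz.
by exists (blk z 0 n) => //; rewrite /cyl /= size_blk.
Qed.

Section Initial.
Variables (S : topologicalType) (h : S -> seq_space K).
Hypothesis hopen : forall A : set S, open A <-> exists2 B, open B & h @^-1` B = A.

Lemma cyl_measurable (p : S) w : measurable (h @^-1` cyl w : set (borel p)).
Proof. by apply: sub_sigma_algebra; apply/hopen; exists (cyl w) => //; exact: cyl_open. Qed.

(** Words are countable, so every open set is a countable union of cylinders. The map [h] is kept
    abstract to serve twice: as the identity of the full space and as the inclusion of an orbit
    closure. *)
Lemma borel_cylE (p : S) :
  (measurable : set (set (borel p))) = <<s [set h @^-1` cyl w | w in [set: seq K]] >>.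
Proof.
apply/seteqP; split; last first.
  apply: smallest_sub; first exact: sigma_algebra_measurable.
  by move=> _ [w _ <-]; exact: cyl_measurable.
apply: smallest_sub; first exact: smallest_sigma_algebra.
move=> A /hopen[B oB <-]; rewrite (open_cylE oB) preimage_bigcup.
pose G : set (set (based p)) := [set h @^-1` cyl w | w in [set: seq K]].
have : @measurable _ (g_sigma_algebraType G) (\bigcup_(w in [set w | cyl w `<=` B]) (h @^-1` cyl w)).
  rewrite bigcup_mkcond; apply: countable_bigcupT_measurable => // w.
  case: ifP => // _.
  by apply: sub_sigma_algebra; exists w.
by [].
Qed.

Lemma cyl_measurable_fun d (T : measurableType d) (D : set T) (p : S) (F : T -> borel p) :
  (forall w, measurable (D `&` F @^-1` (h @^-1` cyl w))) -> measurable_fun D F.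
Proof.
move=> mF; apply: (@measurability _ _ T (borel p) D F [set h @^-1` cyl w | w in [set: seq K]]).
  exact: borel_cylE.
by move=> _ /= [_ [w _ <-] <-]; exact: mF.
Qed.

(** Two cylinders are nested or disjoint, according to whether the shorter word is a prefix of the
    longer one; with the empty set they form a generating class stable under intersection. *)
Lemma cyl_measure_unique (R : realType) (p : S) (mu nu : probability (borel p) R) :
  (forall w, mu (h @^-1` cyl w) = nu (h @^-1` cyl w)) ->
  forall A : set (borel p), measurable A -> mu A = nu A.
Proof.
move=> e A mA.
pose G := [set A : set (borel p) | A = set0 \/ exists w, A = h @^-1` cyl w].
apply: (@measure_unique _ R (borel p) G (fun=> setT)) => //=.
- rewrite borel_cylE; apply/seteqP; split.
    apply: sub_sigma_algebra2 => _ [w _ <-]; right; by exists w.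
  apply: smallest_sub; first exact: smallest_sigma_algebra.
  move=> _ [->|[w ->]]; first by case: (@smallest_sigma_algebra S setT [set h @^-1` cyl w | w in [set: seq K]]).
  by apply: sub_sigma_algebra; exists w.
- move=> _ _ [->|[w1 ->]] [->|[w2 ->]]; rewrite ?set0I ?setI0; try by left.
  rewrite -preimage_setI.
  have H u v : (size u <= size v)%N -> G (h @^-1` (cyl u `&` cyl v)).
    move=> uv; case: (pselect (take (size u) v = u)) => [e'|ne].
      right; exists v; congr (_ @^-1` _); apply/seteqP; split => [z []//|z zv]; split => //.
      rewrite /cyl /= -e'.
      rewrite size_takel // -zv.
      by rewrite -[in RHS](subnKC uv) blk_cat take_size_cat ?size_blk.
    left; rewrite -subset0 => z [zu zv]; apply: ne.
    by rewrite -zv -(subnKC uv) blk_cat take_size_cat ?size_blk.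
  case: (leqP (size w1) (size w2)) => [|/ltnW] h12; first exact: H.
  by rewrite setIC; exact: H.
- by move=> _; right; exists [::]; rewrite predeqE.
- by rewrite bigcup_const.
- by move=> _ [->|[w ->]]; [rewrite !measure0|exact: e].
- by move=> _; rewrite probability_setT ltry.
Qed.

End Initial.
End Cyl.

Lemma pushforward_probability d1 d2 (T1 : measurableType d1) (T2 : measurableType d2)
    (R : realType) (P : probability T1 R) (f : T1 -> T2) (mf : measurable_fun setT f) :
  exists Q : probability T2 R, forall A, measurable A -> Q A = P (f @^-1` A).
Proof. by exists (distribution P (mfun_Sub (mem_set mf))). Qed.

(** * Existence of a measure with prescribed values on cylinders *)

Section CylMeasure.
Variables (K : finType) (R : realType) (y : seq_space K) (rho : seq K -> R).
Hypotheses (rho_ge0 : forall w, 0 <= rho w) (rho_nil : rho [::] = 1)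
  (rho_rcons : forall w, rho w = \sum_(a : K) rho (rcons w a)).

Definition offset w (a : K) : R :=
  \sum_(b : K | (enum_rank b < enum_rank a)%N) rho (rcons w b).

(** Words grow at their right end while lists recurse on the left, hence the reversed word. The
    one-letter extensions split the interval of a word from left to right in the order of the
    enumeration of [K]. *)
Fixpoint left_rev (v : seq K) : R :=
  if v is a :: v' then left_rev v' + offset (rev v') a else 0.

Definition left_end w := left_rev (rev w).

Lemma left_end_rcons w a : left_end (rcons w a) = left_end w + offset w a.
Proof. by rewrite /left_end rev_rcons /= revK. Qed.

Definition word_itv w (t : R) := left_end w <= t < left_end w + rho w.

Lemma offset_lt w a b : (enum_rank a < enum_rank b)%N ->
  offset w a + rho (rcons w a) <= offset w b.
Proof.
move=> ab; rewrite /offset (bigD1 (P := fun c => (enum_rank c < enum_rank b)%N) a) //=.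
rewrite [leLHS]addrC; apply: lerD => //.
rewrite [leRHS]big_mkcond [leLHS]big_mkcond /=.
apply: ler_sum => c _; case: ifP => ca; last by case: ifP => // _.
by rewrite (ltn_trans ca ab) /=; case: eqP => // ac; rewrite ac ltnn in ca.
Qed.

Lemma offset_ge0 w a : 0 <= offset w a.
Proof. by apply: sumr_ge0. Qed.

Lemma offset_le w a : offset w a + rho (rcons w a) <= rho w.
Proof.
rewrite [leRHS]rho_rcons (bigD1 (P := predT) a) //= [leLHS]addrC; apply: lerD => //.
rewrite [leRHS]big_mkcond [leLHS]big_mkcond /=.
apply: ler_sum => c _; case: ifP => ca; last by case: ifP.
by case: eqP => // ac; rewrite ac ltnn in ca.
Qed.

Lemma word_itv_rcons w a t : word_itv (rcons w a) t -> word_itv w t.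
Proof.
rewrite /word_itv left_end_rcons => /andP[h1 h2].
have := offset_ge0 w a; have := offset_le w a.
by move=> *; apply/andP; split; lra.
Qed.

Lemma word_itv_inj w a b t : word_itv (rcons w a) t -> word_itv (rcons w b) t -> a = b.
Proof.
rewrite /word_itv !left_end_rcons => /andP[a1 a2] /andP[b1 b2].
case: (ssrnat.ltngtP (enum_rank a) (enum_rank b)) => [/(offset_lt w)|/(offset_lt w)|/val_inj/enum_rank_inj//] ?; exfalso; lra.
Qed.

(** The intervals of the extensions tile that of [w]: the letter is the last one whose left end does
    not exceed [t]. Its right end is the left end of the next letter or, for the final letter, the
    end of the whole interval. *)
Lemma word_itv_next w t : word_itv w t -> exists a, word_itv (rcons w a) t.
Proof.
move=> /andP[h1 h2].
pose P a := offset w a <= t - left_end w.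
have [a0 Pa0] : exists a, P a.
  have [a0 _] : exists a : K, true by exists (y 0%N).
  pose a1 := enum_val (Ordinal (leq_ltn_trans (leq0n _) (ltn_ord (enum_rank a0)))).
  exists a1; rewrite /P /offset big_pred0 ?subr_ge0 // => b.
  by rewrite enum_valK ltn0.
case: (@arg_maxnP _ a0 P (fun a => enum_rank a : nat) Pa0) => a Pa amax.
exists a; rewrite /word_itv left_end_rcons; apply/andP; split; first by move: Pa; rewrite /P; lra.
case: (ltnP (enum_rank a).+1 #|K|) => ak.
  pose b := enum_val (Ordinal ak).
  have rb : enum_rank b = (enum_rank a).+1 :> nat by rewrite /b enum_valK.
  have : ~~ P b by apply/negP => /amax; rewrite rb; lia.
  rewrite /P -ltNge /offset (bigD1 a) /=; last by rewrite rb.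
  rewrite (eq_bigl (fun i => (enum_rank i < enum_rank a)%N)); first by lra.
  move=> c; rewrite rb ltnS leq_eqVlt; case: (eqVneq c a) => [->|ca]; first by rewrite eqxx ltnn.
  rewrite andbT (inj_eq val_inj) (inj_eq enum_rank_inj).
  by rewrite (negbTE ca).
apply: (lt_le_trans h2); rewrite -addrA lerD2l [leLHS]rho_rcons (bigD1 (P := predT) a) //= addrC lerD2r.
rewrite /offset [leRHS]big_mkcond [leLHS]big_mkcond /=.
apply: ler_sum => c _; case: ifP => ca; last by case: ifP.
rewrite ifT // ltn_neqAle (inj_eq val_inj) (inj_eq enum_rank_inj) ca /=.
by rewrite -ltnS (leq_trans (ltn_ord _)).
Qed.

Definition next_letter w t : K :=
  if pselect (exists a, word_itv (rcons w a) t) is left H then projT1 (cid H) else y 0%N.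

Fixpoint code_word (t : R) n : seq K :=
  if n is n'.+1 then rcons (code_word t n') (next_letter (code_word t n') t) else [::].

Definition code t : seq_space K :=
  if (0 <= t < 1) then (fun n => next_letter (code_word t n) t) else y.

Lemma code_word_itv t n : 0 <= t < 1 -> word_itv (code_word t n) t.
Proof.
move=> t01; elim: n => [|n IHn] /=; first by rewrite /word_itv /left_end /= rho_nil add0r.
rewrite /next_letter; case: pselect => [H|]; first by case: cid.
by move/word_itv_next : IHn.
Qed.

Lemma code_wordE t n : 0 <= t < 1 -> code_word t n = blk (code t) 0 n.
Proof.
move=> t01; elim: n => //= n IHn; rewrite -(addn1 n) blk_cat cats1 -IHn add0n.
by congr rcons; rewrite /code t01.
Qed.

Lemma word_itv_unique w1 w2 t : size w1 = size w2 -> word_itv w1 t -> word_itv w2 t -> w1 = w2.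
Proof.
elim/last_ind: w1 w2 => [|w1 a IH] w2; first by case: w2.
elim/last_ind: w2 => [|w2 b _]; first by rewrite size_rcons.
rewrite !size_rcons => -[sw] h1 h2.
have e : w1 = w2 by apply: IH => //; [exact: word_itv_rcons h1|exact: word_itv_rcons h2].
by rewrite e in h1 *; rewrite (word_itv_inj h1 h2).
Qed.

Lemma code_cyl w t : 0 <= t < 1 -> cyl w (code t) <-> word_itv w t.
Proof.
move=> t01; rewrite /cyl /= -code_wordE //; split=> [<-|h]; first exact: code_word_itv.
apply: word_itv_unique h; last exact: code_word_itv.
by rewrite code_wordE // size_blk.
Qed.

Lemma word_itv_01 w t : word_itv w t -> 0 <= t < 1.
Proof.
elim/last_ind: w => [|w a IH /word_itv_rcons//].
by rewrite /word_itv /left_end /= rho_nil add0r.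
Qed.

Lemma word_itvE w : [set t | word_itv w t] = [set` `[left_end w, (left_end w + rho w)[ ].
Proof. by apply/seteqP; split => t; rewrite /= in_itv /=. Qed.

Lemma code_measurable : measurable_fun setT (code : measurableTypeR R -> borel y).
Proof.
apply: (@cyl_measurable_fun _ _ id) => [A|w]; first by split=> [|[B oB <-]//]; exists A.
rewrite setTI preimage_id.
have mI : measurable ([set` `[0%R, 1%R[ ] : set (measurableTypeR R)) by exact: measurable_itv.
have -> : code @^-1` cyl w = [set t | word_itv w t] `|`
   (if pselect (cyl w y) then ~` [set` `[0%R, 1%R[ ] else set0).
  apply/seteqP; split=> t /=.
    case: (boolP (0 <= t < 1)) => t01; first by move=> /code_cyl h; left; apply: h.
    rewrite /code (negbTE t01) => cy; right; case: pselect => //= _.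
    by rewrite in_itv /=; exact/negP.
  case=> [h|]; first by apply/code_cyl => //; exact: word_itv_01 h.
  case: pselect => //= cy; rewrite in_itv /= => /negP t01.
  by rewrite /code (negbTE t01).
apply: measurableU; first by rewrite word_itvE; exact: measurable_itv.
by case: pselect => //= _; exact: measurableC.
Qed.

(* Lebesgue measure on [0, 1), carried over by the coding of reals by nested
   half-open intervals of lengths [rho w]. *)
Lemma cyl_measure_exists :
  exists mu : probability (borel y) R, forall w, mu (cyl w) = (rho w)%:E.
Proof.
have mI : measurable ([set` `[0%R, 1%R[ ] : set (measurableTypeR R)) by exact: measurable_itv.
pose m0 : {measure set (measurableTypeR R) -> \bar R} := mrestr (@lebesgue_measure R) mI.
pose P0 : probability (measurableTypeR R) R := mnormalize m0 (dirac (0%R : measurableTypeR R)).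
have m0T : m0 setT = 1%E.
  by rewrite /m0 /= /mrestr setTI lebesgue_measure_itv /= lte_fin ltr01 -EFinB subr0.
have [mu muE] := pushforward_probability P0 code_measurable.
exists mu => w; rewrite muE; last first.
  by apply: (@cyl_measurable _ _ id) => [A]; split=> [|[B oB <-]//]; exists A.
rewrite /P0 /= /mnormalize m0T /= (gt_eqF lte01) /= invr1 mule1 /m0 /= /mrestr.
have -> : code @^-1` cyl w `&` [set` `[0%R, 1%R[ ] = [set t | word_itv w t].
  apply/seteqP; split=> t /=; rewrite in_itv /=; first by case=> + t01; move/code_cyl; exact.
  by move=> h; have t01 := word_itv_01 h; split => //; apply/code_cyl.
rewrite word_itvE lebesgue_measure_itv /= lte_fin ltrDl lt_neqAle rho_ge0 andbT.
case: eqP => [<-//|_] /=.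
by rewrite -EFinB addrC addKr.
Qed.

End CylMeasure.

(** * Limit frequencies along an ultrafilter *)

Lemma ultra_fmap (S T : Type) (f : S -> T) (F : set_system S) :
  UltraFilter F -> UltraFilter (f @ F).
Proof.
move=> FU; split; first exact: fmap_proper_filter.
move=> G GG sG; apply/seteqP; split=> [A GA|]; last exact: sG.
have [//|nA] := in_ultra_setVsetC (f @^-1` A) FU.
have : G (~` A) by apply: sG.
by move=> /(filterI GA); rewrite setICr => /filter_ex[].
Qed.

Lemma ultra_cvg_itv (R : realType) (S : Type) (F : set_system S) (r : S -> R) (a b : R) :
  UltraFilter F -> (forall s, a <= r s <= b) -> cvg (r @ F).
Proof.
move=> FU rab; have FU' := ultra_fmap r FU.
have := @segment_compact R a b; rewrite compact_ultra => /(_ _ FU')[].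
  by rewrite /fmap /=; apply: filterS filterT => s _; rewrite /= in_itv /=.
by move=> l [_ Fl]; apply/cvg_ex; exists l.
Qed.

Lemma natinv_lt (R : realType) (e : R) : 0 < e ->
  exists N : nat, forall n, (N <= n)%N -> n%:R^-1 < e.
Proof.
move=> e0; exists (Num.bound e^-1) => n Nn.
have h : e^-1 < n%:R.
  by apply: (lt_le_trans (archi_boundP _)); rewrite ?ler_nat // invr_ge0 ltW.
by rewrite invf_plt ?posrE // (lt_trans _ h) // invr_gt0.
Qed.

Section Frequency.
Variables (K : finType) (R : realType) (y : nat -> K).

Definition freq (w : seq K) (n : nat) : R := (cnt (occurs y w) n)%:R / n%:R.

Lemma freq_01 w n : 0 <= freq w n <= 1.
Proof.
rewrite /freq divr_ge0 ?ler0n //=.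
case: n => [|n]; first by rewrite invr0 mulr0 ler01.
by rewrite ler_pdivrMr ?ltr0n // mul1r ler_nat cnt_le.
Qed.

Variable F : set_system nat.
Hypotheses (FU : UltraFilter F) (Foo : \oo `<=` F).

(* Along an ultrafilter all frequencies converge at once, without extracting
   subsequences. *)
Definition ufreq w : R := lim (freq w @ F).

Lemma cvg_freq w : freq w @ F --> ufreq w.
Proof. exact: (ultra_cvg_itv FU (freq_01 w)). Qed.

Lemma ufreqE w l : freq w @ F --> l -> ufreq w = l.
Proof. by move=> h; apply: cvg_lim => //. Qed.

Lemma ufreq_ge0 w : 0 <= ufreq w.
Proof.
apply: (cvgr_to_ge (cvg_freq (w := w))).
by apply: nearW => n; case/andP: (freq_01 w n).
Qed.

Lemma ufreq_nil : ufreq [::] = 1.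
Proof.
apply: ufreqE; apply: cvg_near_cst; apply: Foo; exists 1%N => // n /= n0.
rewrite /freq (@eq_cnt _ (fun=> true)) //.
have -> : cnt (fun=> true) n = n by elim: n {n0} => [|n IHn]; rewrite ?cnt0 // cntS IHn addn1.
by rewrite divff // pnatr_eq0; lia.
Qed.

Lemma ufreq_sum (G : K -> seq K) w :
  (freq w n - \sum_(a : K) freq (G a) n) @[n --> F] --> (0 : R) ->
  ufreq w = \sum_(a : K) ufreq (G a).
Proof.
move=> h; apply/eqP; rewrite -subr_eq0; apply/eqP.
apply: (cvg_unique _ _ h) => //.
apply: cvgB; first exact: cvg_freq.
apply: cvg_big => [|a _]; [exact: add_continuous|exact: cvg_freq].
Qed.

Lemma ufreq_rcons w : ufreq w = \sum_(a : K) ufreq (rcons w a).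
Proof.
apply: ufreq_sum; apply: cvg_near_cst; apply: nearW => n.
rewrite /freq -mulr_suml -natr_sum -(@cnt_sum _ (fun a => occurs y (rcons w a)) (occurs y w)) ?subrr //.
by move=> i; exact: occurs_rcons.
Qed.

(** Counting one step later changes a count by at most one, hence a frequency by at most [1 / n],
    which tends to 0 along [F] because [F] refines the filter at infinity. *)
Lemma ufreq_cons w : ufreq w = \sum_(a : K) ufreq (a :: w).
Proof.
apply: ufreq_sum.
have h n : `|freq w n - \sum_(a : K) freq (a :: w) n| <= n%:R^-1.
  rewrite /freq -mulr_suml -natr_sum.
  rewrite -(@cnt_sum _ (fun a => occurs y (a :: w)) (fun i => occurs y w i.+1)); last first.
    by move=> i; exact: occurs_cons.
  rewrite -mulrBl normrM (ger0_norm (_ : 0 <= n%:R^-1)) ?invr_ge0 //.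
  rewrite -[leRHS]mul1r ler_wpM2r ?invr_ge0 //.
  have := cnt_shift_le (occurs y w) n; have := cnt_shift_ge (occurs y w) n.
  rewrite -(ler_nat R) natrD -[(_ <= _ + 1)%N](ler_nat R) natrD => h1 h2.
  by rewrite ler_norml; apply/andP; split; lra.
apply: (@cvg_trans _ ((fun n => freq w n - \sum_(a : K) freq (a :: w) n) @ \oo)).
  by move=> A FA; exact: Foo.
apply/cvgr0Pnorm_lt => e e0.
have [N NP] := natinv_lt e0.
by exists N => // n /= /NP; exact: le_lt_trans.
Qed.

Lemma ufreq_absent w : (forall i, ~~ occurs y w i) -> ufreq w = 0.
Proof.
move=> nw; apply: ufreqE; apply: cvg_near_cst; apply: nearW => n.
have -> : freq w n = 0; last by [].
by rewrite /freq (@eq_cnt _ (fun=> false)) ?/cnt ?big1 ?mul0r // => i _; exact: negbTE.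
Qed.

End Frequency.

Lemma conull_measure d (T : measurableType d) (R : realType) (mu : probability T R)
    (X : set T) (mX : measurable X) (X0 : mu (~` X) = 0%E) (A B : set T) :
  measurable A -> measurable B -> X `&` A = X `&` B -> mu A = mu B.
Proof.
have D (C : set T) : measurable C -> mu C = mu (X `&` C).
  move=> mC; have mXc : measurable (~` X) by exact: measurableC.
  have {1}-> : C = (X `&` C) `|` (~` X `&` C) by rewrite -setIUl setUv setTI.
  have Z : mu (~` X `&` C) = 0%E.
    by apply: (subset_measure0 _ _ _ X0) => //; exact: measurableI.
  have h : mu ((X `&` C) `|` (~` X `&` C)) = (mu (X `&` C) + mu (~` X `&` C))%E.
    apply: measureU; [exact: measurableI|exact: measurableI|].
    by rewrite -setIIl setICr set0I.
  by rewrite h Z adde0.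
by move=> mA mB e; rewrite (D A) // (D B) // e.
Qed.

(** * Orbit closures and the transport of measures to them *)

Section OrbitClosure.
Variables (K : finType) (y : seq_space K).
Local Notation X := (orbit_closure y).

Lemma iter_shiftE (z : seq_space K) n i : iter n (@seq_shift K) z i = z (n + i)%N.
Proof. by elim: n i => [|n IHn] i //=; rewrite /seq_shift IHn addSnnS. Qed.

Lemma blk_iter_shift (z : seq_space K) n i m :
  blk (iter n (@seq_shift K) z) i m = blk z (n + i) m.
Proof. by apply: eq_blk => k _; rewrite iter_shiftE addnA. Qed.

Lemma orbit_closureP (z : seq_space K) :
  X z <-> forall n, exists i, blk z 0 n = blk y i n.
Proof.
split=> [Xz n|h U /=].
  have [|_ [[i _ <-]]] := Xz (cyl (blk z 0 n)).
    apply: open_nbhs_nbhs; split; first exact: cyl_open.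
    by rewrite /cyl /= size_blk.
  by rewrite /cyl /= size_blk blk_iter_shift addn0 => e; exists i.
rewrite nbhsE => -[V [oV Vz] VU].
have [n nV] := cyl_nbhs oV Vz; have [i zi] := h n.
exists (iter i (@seq_shift K) y); split; first by exists i.
by apply/VU/nV; rewrite /cyl /= size_blk blk_iter_shift addn0.
Qed.

Lemma orbit_closure_blk z i n : X z -> exists j, blk z i n = blk y j n.
Proof.
move=> /orbit_closureP /(_ (i + n)%N)[j zj]; exists (j + i)%N.
by apply: eq_blk => k kn; rewrite -addnA; apply: (blk_inj zj); rewrite ltn_add2l.
Qed.

Lemma orbit_closure_self : y \in X.
Proof. by rewrite inE; apply/orbit_closureP => n; exists 0%N. Qed.

Definition orbit_base : X := exist _ y orbit_closure_self.

Lemma initial_id (A : set (seq_space K)) : open A <-> exists2 B, open B & id @^-1` B = A.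
Proof. by split=> [|[B oB <-]//]; exists A. Qed.

Lemma initial_val (A : set X) : open A <-> exists2 B, open B & \val @^-1` B = A.
Proof. by []. Qed.

Lemma orbit_closure_measurable (p : seq_space K) : measurable (X : set (borel p)).
Proof.
rewrite -[X]setCK; apply: measurableC; apply: sub_sigma_algebra.
by rewrite openC; exact: closed_closure.
Qed.

Lemma seq_shift_measurable (p : seq_space K) :
  measurable_fun setT (@seq_shift K : borel p -> borel p).
Proof.
apply: (@cyl_measurable_fun _ _ id initial_id) => w.
rewrite setTI; apply: sub_sigma_algebra.
by apply: (open_comp (f := @seq_shift K)) => [z _|]; [exact: seq_shift_continuous|exact: cyl_open].
Qed.

Lemma val_measurable (p : X) (q : seq_space K) :
  measurable_fun setT (\val : borel p -> borel q).
Proof.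
apply: (@cyl_measurable_fun _ _ id initial_id) => w.
by rewrite setTI; exact: (@cyl_measurable K X \val initial_val).
Qed.

(** A measurable left inverse of the inclusion, used to push a measure of the full space forward to
    the orbit closure. The points sent to the base point form a null set for the measures
    concerned. *)
Definition retract (z : seq_space K) : X :=
  if pselect (X z) is left H then exist _ z (mem_set H) else orbit_base.

Lemma retractE z : X z -> \val (retract z) = z.
Proof. by rewrite /retract; case: pselect. Qed.

Lemma retract_measurable (p : X) (q : seq_space K) :
  measurable_fun setT (retract : borel q -> borel p).
Proof.
apply: (@cyl_measurable_fun K X \val initial_val _ (borel q) setT p retract) => w.
have mX := @orbit_closure_measurable q.
have mw := @cyl_measurable K _ id initial_id q w.
have -> : setT `&` retract @^-1` (\val @^-1` cyl w) =
    (X `&` cyl w) `|` (if pselect (cyl w y) then ~` X else set0).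
  rewrite setTI; apply/seteqP; split=> z /=.
    rewrite /retract; case: (pselect (X z)) => [Xz|nXz] /= h; first by left.
    by right; case: pselect.
  rewrite /retract; case: (pselect (X z)) => [Xz|nXz] /=; first by case=> [[]//|]; case: pselect.
  by case=> [[]//|]; case: pselect.
apply: measurableU; first exact: measurableI.
by case: pselect => //= _; exact: measurableC.
Qed.

Lemma orbit_map_measurable (p : X) :
  measurable_fun setT (@orbit_closure_map K y : borel p -> borel p).
Proof.
apply: (@cyl_measurable_fun K X \val initial_val _ (borel p) setT p) => w; rewrite setTI.
have -> : @orbit_closure_map K y @^-1` (\val @^-1` cyl w) =
  \val @^-1` (@seq_shift K @^-1` cyl w) by [].
apply: sub_sigma_algebra; exists (@seq_shift K @^-1` cyl w) => //.
by apply: open_comp => [z _|]; [exact: seq_shift_continuous|exact: cyl_open].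
Qed.

Lemma shift_cylE (w : seq K) : @seq_shift K @^-1` cyl w = \bigcup_(a in [set: K]) cyl (a :: w).
Proof.
have e (z : seq_space K) : blk (seq_shift z) 0 (size w) = blk z 1 (size w) by apply: eq_blk.
apply/seteqP; split=> z; rewrite /cyl /= e.
  by move=> zw; exists (z 0%N) => //=; rewrite -[in RHS]zw.
by case=> a _ /= [_ <-]; rewrite size_blk.
Qed.

End OrbitClosure.

Section KrylovBogoliubov.
Variables (K : finType) (R : realType) (y : seq_space K).
Local Notation X := (orbit_closure y).
Variable F : set_system nat.
Hypotheses (FU : UltraFilter F) (Foo : \oo `<=` F).

Lemma cyl_shift_measure (p : seq_space K) (mu : probability (borel p) R) w :
  mu (@seq_shift K @^-1` cyl w) = (\sum_(a : K) mu (cyl (a :: w)))%E.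
Proof.
rewrite shift_cylE measure_fin_bigcup //; first last.
- by move=> a _; exact: (@cyl_measurable K _ id (@initial_id K)).
- move=> a b _ _ [z]; rewrite /cyl /= => -[] [za _] [zb _].
  by rewrite -za -zb.
- exact: finite_finset.
rewrite (fsbigE (enum K)) ?enum_uniq //; last by move=> a _ /=; rewrite mem_enum.
by rewrite big_enum_cond; apply: eq_bigl => a; rewrite in_setT andbT.
Qed.

Lemma invariant_cyl (p : seq_space K) (mu : probability (borel p) R) :
  (forall w, mu (cyl w) = (\sum_(a : K) mu (cyl (a :: w)))%E) ->
  invariant_measure (@seq_shift K) mu.
Proof.
move=> h A mA.
have [Q QE] := pushforward_probability mu (@seq_shift_measurable K p).
rewrite -QE //; apply: (cyl_measure_unique (@initial_id K)) mA => w.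
rewrite QE; last exact: (@cyl_measurable K _ id (@initial_id K)).
by rewrite !preimage_id cyl_shift_measure -h.
Qed.

(** A point outside the orbit closure has a prefix that never occurs in [y], so the complement is
    covered by countably many null cylinders; [unpickle] enumerates them. *)
Lemma support_null (p : seq_space K) (mu : probability (borel p) R) :
  (forall w, (forall i, ~~ occurs y w i) -> mu (cyl w) = 0%E) -> mu (~` X) = 0%E.
Proof.
move=> h.
pose G n : set (seq_space K) := if (choice.unpickle n : option (seq K)) is Some w then
  (if pselect (forall i, ~~ occurs y w i) then cyl w else set0) else set0.
have mG n : measurable (G n : set (borel p)).
  rewrite /G; case: (choice.unpickle n) => [w|] //; case: pselect => /= _ //.
  exact: (@cyl_measurable K _ id (@initial_id K)).
have G0 n : mu (G n) = 0%E.
  rewrite /G; case: (choice.unpickle n) => [w|]; last exact: measure0.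
  by case: pselect => /= [/h//|_]; exact: measure0.
apply/eqP; rewrite eq_le measure_ge0 andbT.
apply: (le_trans (measure_sigma_subadditive mu mG _ _)); last by rewrite eseries0 // => n _ _; exact: G0.
- by apply: measurableC; exact: orbit_closure_measurable.
- move=> z /= nXz; have : ~ (forall n, exists i, blk z 0 n = blk y i n).
    by move=> /orbit_closureP.
  move=> /existsNP[n nz]; exists (choice.pickle (blk z 0 n)) => //.
  rewrite /G choice.pickleK; case: pselect => /= [_|/existsNP[i /negP]].
    by rewrite /cyl /= size_blk.
  by rewrite negbK /occurs size_blk => /eqP e; exfalso; apply: nz; exists i.
Qed.

Lemma restrict_invariant (p : seq_space K) (mu : probability (borel p) R) (q : X) :
  invariant_measure (@seq_shift K) mu -> mu (~` X) = 0%E ->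
  exists nu : probability (borel q) R, invariant_measure (@orbit_closure_map K y) nu /\
    forall w, nu (\val @^-1` cyl w) = mu (cyl w).
Proof.
move=> imu X0.
have mX := @orbit_closure_measurable K y p.
have mr := @retract_measurable K y q p.
have [nu nuE] := pushforward_probability mu mr.
have eqX := conull_measure mX X0.
exists nu; split => [A mA|w].
  have mTA : measurable (@orbit_closure_map K y @^-1` A : set (borel q)).
    by rewrite -[X in measurable X]setTI; apply: orbit_map_measurable.
  have mrA : measurable (@retract K y @^-1` A : set (borel p)).
    by rewrite -[X in measurable X]setTI; apply: mr.
  rewrite !nuE // -(imu (@retract K y @^-1` A)) //; apply: eqX.
  - by rewrite -[X in measurable X]setTI; apply: mr.
  - by rewrite -[X in measurable X]setTI; apply: seq_shift_measurable.
  - have e z : X z -> orbit_closure_map (retract y z) = retract y (seq_shift z).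
      move=> Xz; have Xsz : X (seq_shift z).
        by have := orbit_closure_shift (mem_set Xz); rewrite inE.
      by apply: val_inj; rewrite (retractE Xsz) /= (retractE Xz).
    by apply/seteqP; split => z [Xz] /=; rewrite e // => h; split => //; rewrite -?e.
have mw := @cyl_measurable K X \val (@initial_val K y) q w.
rewrite nuE //; apply: eqX.
- by rewrite -[X in measurable X]setTI; apply: mr.
- exact: (@cyl_measurable K _ id (@initial_id K)).
- by apply/seteqP; split => z [Xz] /=; rewrite retractE.
Qed.

(** The frequencies along [F] are consistent under extension on both sides, so they define an
    invariant measure, carried by the orbit closure since absent words have frequency 0. The values
    on cylinders belong to the conclusion because genericity is proved by comparing them with those
    of the unique invariant measure. *)
Lemma krylov_bogoliubov (q : X) :
  exists nu : probability (borel q) R, invariant_measure (@orbit_closure_map K y) nu /\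
    forall w, nu (\val @^-1` cyl w) = (ufreq R y F w)%:E.
Proof.
have [mu muE] : exists mu : probability (borel y) R,
    forall w, mu (cyl w) = (ufreq R y F w)%:E.
  apply: cyl_measure_exists => [w||w]; [exact: ufreq_ge0|exact: ufreq_nil|exact: ufreq_rcons].
have imu : invariant_measure (@seq_shift K) mu.
  apply: invariant_cyl => w; rewrite muE ufreq_cons // -sumEFin.
  by apply: eq_bigr => a _; rewrite muE.
have X0 : mu (~` X) = 0%E.
  by apply: support_null => w nw; rewrite muE ufreq_absent.
have [nu [inu nuE]] := restrict_invariant q imu X0.
by exists nu; split => // w; rewrite nuE muE.
Qed.

End KrylovBogoliubov.

Section Average.
Context d (T : measurableType d) (R : realType) (P : probability T R) (S : T -> T).
Hypotheses (mS : measurable_fun setT S)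
  (PS : forall A, measurable A -> P (S @^-1` A) = P A).

Lemma iter_preimage j (A : set T) : measurable A ->
  measurable ((fun z => iter j S z) @^-1` A) /\ P ((fun z => iter j S z) @^-1` A) = P A.
Proof.
elim: j A => [//|j IHj] A mA.
have mSA : measurable (S @^-1` A) by rewrite -[X in measurable X]setTI; exact: mS.
have -> : (fun z => iter j.+1 S z) @^-1` A = (fun z => iter j S z) @^-1` (S @^-1` A) by [].
by have [h ->] := IHj _ mSA; rewrite PS.
Qed.

(** By invariance the integral of the number of visits to [A] during [L] steps is [L] times the
    measure of [A]; the pointwise bounds then integrate. *)
Lemma invariant_average (A : set T) L (a b : R) : measurable A ->
  (forall z, a <= (cnt (fun j => iter j S z \in A) L)%:R <= b) ->
  a <= L%:R * fine (P A) <= b.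
Proof.
move=> mA ab; set p := fine (P A).
have pE : P A = p%:E by rewrite /p fineK // fin_num_measure.
pose f (j : 'I_L) z := (\1_((fun z => iter j S z) @^-1` A) z)%:E : \bar R.
pose c z := (cnt (fun j => iter j S z \in A) L)%:R%:E : \bar R.
have s z : (\sum_(j < L) f j z = c z)%E.
  rewrite /f /c sumEFin /cnt natr_sum; congr (_%:E); apply: eq_bigr => j _.
have mf j : measurable_fun setT (f j).
  apply/measurable_EFinP; apply: measurable_indic; exact: (iter_preimage j mA).1.
have e : (\int[P]_z c z = (L%:R * p)%:E)%E.
  rewrite (eq_integral (fun z => \sum_(j < L) f j z)%E) => [|z _]; last by rewrite s.
  rewrite ge0_integral_sum //; last by move=> j z _; rewrite lee_fin.
  rewrite (eq_bigr (fun=> p%:E)) => [|j _].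
    by rewrite sumEFin sumr_const card_ord mulr_natl.
  by rewrite integral_indic ?setIT -?pE; have [? ?] := iter_preimage j mA.
have mc : measurable_fun setT c.
  rewrite (_ : c = fun z => \sum_(j < L) f j z)%E; last by apply/funext => z; rewrite s.
  exact: emeasurable_sum.
have c0 z : (0 <= c z)%E by rewrite lee_fin.
have ic r : (\int[P]_z cst r%:E z = r%:E)%E.
  by rewrite integral_cst // [X in (_ * X)%E](probability_setT P) mule1.
apply/andP; split; rewrite -lee_fin -e.
  have [a0|a0] := leP a 0.
    by apply: (le_trans _ (integral_ge0 _ _)); rewrite ?lee_fin.
  rewrite -(ic a); apply: ge0_le_integral => // z _; first by rewrite lee_fin ltW.
  by rewrite lee_fin; case/andP: (ab z).
rewrite -(ic b); apply: ge0_le_integral => // z _.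
by rewrite lee_fin; case/andP: (ab z).
Qed.

End Average.

(** * Uniform frequencies and uniform recurrence give strict ergodicity *)

Section UniqueErgodicity.
Variables (K : finType) (R : realType) (y : seq_space K).
Local Notation X := (orbit_closure y).

Definition uniform_frequencies := forall w (e : R), 0 < e -> exists (r : R) L,
  (0 < L)%N /\ forall i, `|(cnt (fun j => occurs y w (i + j)) L)%:R - r * L%:R| <= e * L%:R.

Definition uniformly_recurrent := forall n, exists L, forall i, exists2 j,
  (j < L)%N & blk y (i + j) n = blk y 0 n.

Lemma iter_orbit_map j (z : X) :
  \val (iter j (@orbit_closure_map K y) z) = iter j (@seq_shift K) (\val z).
Proof. by elim: j => //= j ->. Qed.

(** Every window of every point of the orbit closure is a window of [y], so the bound holds at all
    points and can be integrated against any invariant measure. *)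
Lemma uniform_cyl_measure (q : X) (nu : probability (borel q) R) w r L (e : R) :
  invariant_measure (@orbit_closure_map K y) nu -> (0 < L)%N ->
  (forall i, `|(cnt (fun j => occurs y w (i + j)) L)%:R - r * L%:R| <= e * L%:R) ->
  `|fine (nu (\val @^-1` cyl w)) - r| <= e.
Proof.
move=> inu L0 h.
have mw := @cyl_measurable K X \val (@initial_val K y) q w.
have := @invariant_average _ (borel q) R nu _ (@orbit_map_measurable K y q) inu
  _ L (r * L%:R - e * L%:R) (r * L%:R + e * L%:R) mw.
have L0' : 0 < L%:R :> R by rewrite ltr0n.
have H (z : X) : exists i, cnt (fun j => iter j (@orbit_closure_map K y) z \in \val @^-1` cyl w) L
    = cnt (fun j => occurs y w (i + j)) L.
  have Xz : X (\val z) by have := valP z; rewrite inE.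
  have [i zi] := orbit_closure_blk 0 (L + size w) Xz.
  exists i; apply: eq_cnt => j jL; rewrite /occurs.
  have ezy : blk (\val z) j (size w) = blk y (i + j) (size w).
    by apply: eq_blk => k kw; rewrite -addnA -(blk_inj (k := (j + k)%N) zi) ?add0n //; lia.
  by apply/idP/eqP; rewrite inE /= iter_orbit_map /cyl /= blk_iter_shift addn0 ezy.
move=> /(_ _)/andP[z|h1 h2].
  by have [i ->] := H z; have := h i; rewrite ler_norml => /andP[] *; apply/andP; split; lra.
rewrite -(ler_pM2r L0') -[X in _ * X](ger0_norm (ltW L0')) -normrM ler_norml.
by apply/andP; split; lra.
Qed.

Lemma uniform_uniquely_ergodic : uniform_frequencies ->
  uniquely_ergodic R (@orbit_closure_map K y) (orbit_base y).
Proof.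
move=> uf.
have [F [FU Foo]] := @ultraFilterLemma nat \oo _.
have [mu [imu _]] := krylov_bogoliubov R FU Foo (orbit_base y).
exists mu; split => // nu inu.
apply: (cyl_measure_unique (@initial_val K y)) => w.
have mw := @cyl_measurable K X \val (@initial_val K y) (orbit_base y) w.
rewrite -[LHS]fineK ?fin_num_measure // -[RHS]fineK ?fin_num_measure //; congr (_%:E).
apply/eqP; rewrite -subr_eq0 -normr_le0; apply/ler_addgt0Pl => e e0; rewrite addr0.
have e2 : 0 < e / 2 by rewrite divr_gt0.
have [r [L [L0 h]]] := uf w _ e2.
have := uniform_cyl_measure inu L0 h; have := uniform_cyl_measure imu L0 h.
set a := fine _; set b := fine _; rewrite !ler_norml => /andP[? ?] /andP[? ?].
by apply/andP; split; lra.
Qed.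

(** By recurrence some iterate of a point of [A] begins with any given prefix of [y]. Closedness
    puts [y] into [A], and then the closure of its orbit. *)
Lemma recurrent_minimal : uniformly_recurrent -> minimal_system (@orbit_closure_map K y).
Proof.
move=> ur A cA [a Aa] TA.
have iterA j z : A z -> A (iter j (@orbit_closure_map K y) z).
  by move=> Az; elim: j => //= j IHj; apply: TA; exists (iter j (@orbit_closure_map K y) z).
have memA z : (forall n, exists2 u, A u & blk (\val u) 0 n = blk (\val z) 0 n) -> A z.
  move=> h; apply: cA => U; rewrite nbhsE => -[V [[W oW <-] /= Wz] VU].
  have [n nW] := cyl_nbhs oW Wz; have [u Au un] := h n.
  by exists u; split => //; apply/VU/nW; rewrite /cyl /= size_blk.
have Ay : A (orbit_base y).
  apply: memA => n; have [L hL] := ur n.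
  have Xa : X (\val a) by have := valP a; rewrite inE.
  have [i ai] := orbit_closure_blk 0 (L + n) Xa.
  have [j jL yj] := hL i.
  exists (iter j (@orbit_closure_map K y) a); first exact: iterA.
  rewrite iter_orbit_map blk_iter_shift addn0 /= -yj.
  by apply: eq_blk => k kn; rewrite -addnA -(blk_inj (k := (j + k)%N) ai) ?add0n //; lia.
apply/seteqP; split => // z _; apply: memA => n.
have Xz : X (\val z) by have := valP z; rewrite inE.
have [i zi] := orbit_closure_blk 0 n Xz.
exists (iter i (@orbit_closure_map K y) (orbit_base y)); first exact: iterA.
by rewrite iter_orbit_map blk_iter_shift addn0 zi.
Qed.

Lemma uniform_strictly_ergodic : uniform_frequencies -> uniformly_recurrent ->
  strictly_ergodic_point R y.
Proof.
by move=> /uniform_uniquely_ergodic uf /recurrent_minimal ur; split => //; exists (orbit_base y).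
Qed.

End UniqueErgodicity.

Lemma conditional_probability d (T : measurableType d) (R : realType)
    (P : probability T R) (B : set T) : measurable B -> P B <> 0%E ->
  exists Q : probability T R, forall A, measurable A -> Q A = (P (A `&` B) * (fine (P B))^-1%:E)%E.
Proof.
move=> mB B0.
pose m0 : {measure set T -> \bar R} := mrestr P mB.
exists (mnormalize m0 P) => A mA.
have e : m0 setT = P B by rewrite /m0 /= /mrestr setTI.
have Bfin : P B \is a fin_num by rewrite fin_num_measure.
rewrite /= /mnormalize e ifF //.
by apply/negbTE; rewrite negb_or; apply/andP; split; [exact/eqP|apply: contraTN Bfin => /eqP ->].
Qed.

(** * Strictly ergodic points are generic for an ergodic measure *)

Section StrictlyErgodic.
Variables (K : finType) (R : realType) (y : seq_space K).
Local Notation X := (orbit_closure y).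

Lemma cylinderE m (B : m.-tuple K) : cylinder B = cyl B.
Proof.
apply/seteqP; split=> z; rewrite /cylinder /cyl /= size_tuple => h.
  apply: (@eq_from_nth _ (z 0%N)); rewrite size_blk ?size_tuple // => j jm.
  by rewrite nth_blk // (h (Ordinal jm)) (tnth_nth (z 0%N)).
by move=> j; rewrite (tnth_nth (z 0%N)) -[in RHS]h nth_blk.
Qed.

Lemma frequently_ultra (A : set nat) : (forall N, exists2 n, (N <= n)%N & A n) ->
  exists F : set_system nat, [/\ UltraFilter F, \oo `<=` F & F A].
Proof.
move=> hA.
have pA : ProperFilter (within A \oo).
  apply: Build_ProperFilter_ex => B [N _ hB].
  by have [n Nn An] := hA N; exists n; exact: hB.
have [F [FU sF]] := ultraFilterLemma pA.
exists F; split => //.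
  by move=> B oB; apply: sF; apply: filterS oB => n Bn _.
by apply: sF; apply: nearW.
Qed.

Lemma strictly_ergodic_generic : strictly_ergodic_point R y -> generic_for_ergodic R y.
Proof.
move=> [_ [p [mu [imu umu]]]].
have [m mE] := pushforward_probability mu (@val_measurable K y p y).
exists m; split; first split => A mA.
- have mTA : measurable (@seq_shift K @^-1` A : set (borel y)).
    by rewrite -[X in measurable X]setTI; apply: seq_shift_measurable.
  have mvA : measurable (\val @^-1` A : set (borel p)).
    by rewrite -[X in measurable X]setTI; apply: (@val_measurable K y p y).
  by rewrite !mE // -(imu _ mvA).
- move=> TA; rewrite !mE //.
  set B := \val @^-1` A.
  have mB : measurable (B : set (borel p)).
    by rewrite -[X in measurable X]setTI; apply: (@val_measurable K y p y).
  have TB : @orbit_closure_map K y @^-1` B = B.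
    by rewrite -[in RHS](_ : \val @^-1` (@seq_shift K @^-1` A) = B) // TA.
  have [->|/eqP B0] := eqVneq (mu B) 0%E; [by left|right].
  (* Conditioning on an invariant set of positive measure yields an invariant measure. By uniqueness
     it agrees with [mu], and its value 1 on [B] is then that of [mu]. *)
  have [Q QE] := conditional_probability mB B0.
  have iQ : invariant_measure (@orbit_closure_map K y) Q.
    move=> C mC.
    have mTC : measurable (@orbit_closure_map K y @^-1` C : set (borel p)).
      by rewrite -[X in measurable X]setTI; apply: orbit_map_measurable.
    have mCB : measurable (C `&` B : set (borel p)) by exact: measurableI.
    by rewrite !QE // -(imu _ mCB) preimage_setI TB.
  rewrite -(umu Q iQ B mB) QE // setIid -{1}(@fineK _ (mu B)) ?fin_num_measure //.
  by rewrite -EFinM divff // fine_eq0 ?fin_num_measure //; exact/eqP.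
move=> l B l0; rewrite cylinderE mE; last exact: (@cyl_measurable K _ id (@initial_id K)).
have mw := @cyl_measurable K X \val (@initial_val K y) p B.
rewrite -[X in _ --> X]fineK ?fin_num_measure //; set r := fine _.
apply/fine_cvgP; split; first exact: nearW.
rewrite (_ : fine \o _ = freq R y B); last by apply/funext => n; rewrite /= occurrencesE.
apply/cvgrPdist_lt => e e0; apply: contrapT => nh.
(* If the frequency stays away from [r] at arbitrarily late times, an ultrafilter concentrated on
   these times yields an invariant measure with another value on the cylinder. *)
have [N|F [FU Foo FA]] := @frequently_ultra [set n | e <= `|r - freq R y B n| ].
  apply: contrapT => h; apply: nh; exists N => // n /= Nn; rewrite ltNge; apply/negP => en.
  by apply: h; exists n.
have [nu [inu nuE]] := krylov_bogoliubov R FU Foo p.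
have : (nu (\val @^-1` cyl B)) = mu (\val @^-1` cyl B) by rewrite (umu nu inu).
rewrite nuE -[RHS]fineK ?fin_num_measure // => -[er].
have := @cvg_freq K R y F FU B; rewrite er => /cvgrPdist_lt /(_ e e0) h.
have [n []] := filter_ex (filterI FA h).
by rewrite /= leNgt => /negP.
Qed.

End StrictlyErgodic.

(** * Density and codings *)

Section Density.
Variable R : realType.
Implicit Types (e d : R) (f g : nat -> bool).

Lemma archi_le e (c : R) : 0 < e -> exists N : nat, forall n, (N <= n)%N -> c <= e * n%:R.
Proof.
move=> e0; exists (Num.bound (c / e)) => n Nn.
have h : c / e < n%:R.
  have [c0|/ltW c0] := leP 0 (c / e).
    by apply: (lt_le_trans (archi_boundP c0)); rewrite ler_nat.
  case: n Nn => [|n] Nn; last by rewrite (le_lt_trans c0) ?ltr0n.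
  move: Nn; rewrite leqn0 => /eqP b0.
  have := archi_boundP (_ : 0 <= - (c / e)); rewrite oppr_ge0 => /(_ c0).
  by rewrite /Num.bound normrN -/(Num.bound (c / e)) b0 ltNge oppr_ge0 c0.
by rewrite mulrC -ler_pdivrMr // ltW.
Qed.

Definition rare e f := exists N, forall n, (N <= n)%N -> (cnt f n)%:R <= e * n%:R.

Lemma rare_sub e e' f g : e <= e' -> (forall i, f i -> g i) -> rare e g -> rare e' f.
Proof.
move=> ee fg [N h]; exists N => n /h hn.
apply: (le_trans (_ : _ <= (cnt g n)%:R)); first by rewrite ler_nat; apply: leq_cnt => i _; exact: fg.
by apply: (le_trans hn); rewrite ler_wpM2r.
Qed.

Lemma cnt_or f g n : (cnt (fun i => f i || g i) n <= cnt f n + cnt g n)%N.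
Proof.
by elim: n => [|n IHn]; rewrite ?cnt0 // !cntS; case: (f n); case: (g n) => /=; lia.
Qed.

Lemma rare_or e d f g : rare e f -> rare d g -> rare (e + d) (fun i => f i || g i).
Proof.
move=> [N hN] [M hM]; exists (maxn N M) => n; rewrite geq_max => /andP[/hN h1 /hM h2].
have := cnt_or f g n; rewrite -(ler_nat R) natrD mulrDl; lra.
Qed.

Lemma rare_shift e e' f k : e < e' -> rare e f -> rare e' (fun i => f (i + k)%N).
Proof.
move=> ee [N h].
have [M hM] := @archi_le (e' - e) (e * k%:R) (ltac:(lra)).
exists (maxn N M) => n; rewrite geq_max => /andP[Nn /hM Mn].
have le1 : (cnt (fun i => f (i + k)%N) n <= cnt f (n + k))%N.
  by rewrite addnC cnt_cat (@eq_cnt _ (fun i => f (k + i)%N)) ?leq_addl // => i _; rewrite addnC.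
rewrite -(ler_nat R) in le1; apply: (le_trans le1).
apply: (le_trans (h _ _)); first by rewrite (leq_trans Nn) ?leq_addr.
by rewrite natrD; lra.
Qed.

Lemma rare_has e (F : nat -> nat -> bool) m : (forall k, (k < m)%N -> rare e (F k)) ->
  rare (e *+ m) (fun i => has (fun k => F k i) (iota 0 m)).
Proof.
elim: m => [|m IHm] h; first by exists 0%N => n _; rewrite mulr0n mul0r /cnt big1.
rewrite mulrSr; apply: (@rare_sub _ _ _ (fun i => has (fun k => F k i) (iota 0 m) || F m i)) => //.
  by move=> i; rewrite -addn1 iotaD has_cat /= orbF.
by apply: rare_or; [apply: IHm => k km; apply: h; lia|apply: h].
Qed.

(** Divided by [n * L], this is the mean over starting positions of the distance between the window
    frequency and [r]: the L^1 distance to a constant of the mean ergodic theorem, read along a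
    single sequence. *)
Definition window_sum f L n (r : R) : R :=
  \sum_(i < n) `|(cnt (fun j => f (i + j)%N) L)%:R - r * L%:R|.

Definition erg_avg f := forall d, 0 < d -> exists (r : R) L N,
  [/\ 0 <= r <= 1, (0 < L)%N &
      forall n, (N <= n)%N -> window_sum f L n r <= d * L%:R * n%:R].

Lemma exchange_cnt f L n :
  (\sum_(i < n) cnt (fun j => f (i + j)%N) L = \sum_(j < L) cnt (fun i => f (j + i)%N) n)%N.
Proof.
rewrite /cnt exchange_big; apply: eq_bigr => j _; apply: eq_bigr => i _.
by rewrite addnC.
Qed.

Lemma cnt_diff_le f g n :
  `|(cnt f n)%:R - (cnt g n)%:R| <= (cnt (fun i => f i != g i) n)%:R :> R.
Proof.
elim: n => [|n IHn]; first by rewrite !cnt0 subrr normr0.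
rewrite !cntS; case: (f n); case: (g n) => /=; rewrite ?addn0 ?addn1 ?natr1 //;
  rewrite -?natr1; move: IHn; rewrite !ler_norml => /andP[? ?]; apply/andP; split; lra.
Qed.

(* Uniform approximation in density preserves [erg_avg]: this is the reason why
   [r] and [L] are allowed to depend on [d]. *)
Lemma erg_avg_limit f :
  (forall e, 0 < e -> exists2 g, erg_avg g & rare e (fun i => f i != g i)) -> erg_avg f.
Proof.
move=> h d d0.
have d4 : 0 < d / 4%:R by rewrite divr_gt0.
have [g eg [N1 fg]] := h _ d4.
have [r [L [N [r01 L0 hg]]]] := eg _ d4.
have L0' : 0 < L%:R :> R by rewrite ltr0n.
have [N2 hN2] := @archi_le (d / 4%:R) (L%:R * (d / 4%:R)) d4.
exists r, L, (maxn (maxn N N1) N2); split => // n.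
rewrite !geq_max => /andP[/andP[/hg gn N1n] /hN2 n2].
pose D i := cnt (fun j => f (i + j)%N != g (i + j)%N) L.
have h1 : window_sum f L n r <= (\sum_(i < n) D i)%N%:R + window_sum g L n r.
  rewrite natr_sum -big_split; apply: ler_sum => i _ /=.
  have /= := cnt_diff_le (fun j => f (i + j)%N) (fun j => g (i + j)%N) L.
  rewrite -/(D i); set a := (cnt _ _)%:R; set b := (cnt _ _)%:R => ab.
  rewrite (_ : a - r * L%:R = (a - b) + (b - r * L%:R)); last by ring.
  by apply: (le_trans (ler_normD _ _)); rewrite lerD2r.
have h2 : (\sum_(i < n) D i)%N%:R <= L%:R * (d / 4%:R * (n%:R + L%:R)).
  rewrite /D (exchange_cnt (fun i => f i != g i)) natr_sum.
  rewrite [leRHS]mulr_natl -[L in leRHS]card_ord -sumr_const; apply: ler_sum => j _.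
  apply: (@le_trans _ _ (cnt (fun i => f i != g i) (j + n))%:R).
    by rewrite ler_nat cnt_cat leq_addl.
  apply: (le_trans (fg _ _)); first by rewrite (leq_trans N1n) ?leq_addl.
  rewrite (ler_wpM2l (ltW d4)) // -natrD ler_nat addnC leq_add2l ltnW // (leq_trans (ltn_ord j)) ?card_ord //.
apply: (le_trans h1); apply: (le_trans (lerD h2 gn)).
set l := L%:R in L0' n2 *; set m := n%:R in n2 *.
have := ler_wpM2l (ltW L0') n2.
have : 0 <= l * (d / 4%:R * m) by rewrite !mulr_ge0 // ltW.
lra.
Qed.

Lemma erg_avg_shift f k : erg_avg (fun i => f (i + k)%N) -> erg_avg f.
Proof.
move=> h d d0.
have d2 : 0 < d / 2 by rewrite divr_gt0.
have [r [L [N [r01 L0 hf]]]] := h _ d2.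
have L0' : 0 < L%:R :> R by rewrite ltr0n.
have [N2 hN2] := @archi_le (d / 2) k%:R d2.
exists r, L, (N + N2 + k)%N; split => // n Nn.
have kn : (k <= n)%N by lia.
have b i : `|(cnt (fun j => f (i + j)%N) L)%:R - r * L%:R| <= L%:R :> R.
  have := cnt_le (fun j => f (i + j)%N) L; rewrite -(ler_nat R) => cL.
  have : 0 <= (cnt (fun j => f (i + j)%N) L)%:R :> R by [].
  case/andP: r01 => r0 r1.
  have : 0 <= r * L%:R by rewrite mulr_ge0.
  have : r * L%:R <= L%:R by rewrite ler_piMl.
  by rewrite ler_norml => *; apply/andP; split; lra.
have -> : window_sum f L n r = \sum_(i < k) `|(cnt (fun j => f (i + j)%N) L)%:R - r * L%:R|
   + window_sum (fun i => f (i + k)%N) L (n - k) r.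
  rewrite /window_sum -(big_mkord xpredT (fun i => `|(cnt (fun j => f (i + j)%N) L)%:R - r * L%:R|)).
  rewrite (@big_cat_nat _ _ _ k) //= big_mkord; congr (_ + _).
  rewrite -{1}(add0n k) big_addn big_mkord; apply: eq_bigr => i _.
  by congr (`|_%:R - _|); apply: eq_cnt => j _; rewrite addnAC.
have h1 : \sum_(i < k) `|(cnt (fun j => f (i + j)%N) L)%:R - r * L%:R| <= k%:R * L%:R.
  by rewrite mulr_natl -[k in leRHS]card_ord -sumr_const; apply: ler_sum => i _.
have h2 := hf (n - k)%N (ltac:(lia)).
have h3 := hN2 n (ltac:(lia)).
have h4 : d / 2 * L%:R * (n - k)%:R <= d / 2 * L%:R * n%:R.
  by apply: ler_wpM2l; [rewrite mulr_ge0 // ltW | rewrite ler_nat leq_subr].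
have := ler_wpM2r (ltW L0') h3.
lra.
Qed.

End Density.

Section Approximation.
Variable R : realType.

(* [t] is a limit in density of finite codes of [s]: [t (i + r)] is read off the
   window of radius [r] of [s] centred at [i + r]. *)
Definition coded (T : eqType) (S : Type) (t : nat -> T) (s : nat -> S) :=
  forall e : R, 0 < e -> exists r (phi : seq S -> T),
    rare e (fun i => t (i + r)%N != phi (blk s i r.*2.+1)).

(* The only form in which ergodicity is used: it refers to the point alone and
   is inherited by every coded sequence. *)
Definition erg_seq (S : Type) (s : nat -> S) :=
  forall r (phi : seq S -> bool), erg_avg R (fun i => phi (blk s i r)).

Lemma coded_erg S (s : nat -> S) f : erg_seq s -> coded f s -> erg_avg R f.
Proof.
move=> es fs; apply: erg_avg_limit => e e0.
have [r [phi h]] := fs e e0.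
(* The code needs [r] letters on the left; the first [r] values are copied from [f] and so cause no
   disagreement. *)
pose g i := if (i < r)%N then f i else phi (blk s (i - r) r.*2.+1).
exists g.
  apply: (@erg_avg_shift _ _ r).
  have -> : (fun i => g (i + r)%N) = (fun i => phi (blk s i r.*2.+1)).
    by apply/funext => i; rewrite /g ltnNge leq_addl /= addnK.
  exact: es.
have [N hN] := h; exists (N + r)%N => n Nn.
have rn : (r <= n)%N by lia.
rewrite -(subnKC rn) cnt_cat.
rewrite (@eq_cnt _ (fun=> false) r) => [|i ir]; last by rewrite /g ir eqxx.
rewrite {1}/cnt big1 // add0n (@eq_cnt _ (fun i => f (i + r)%N != phi (blk s i r.*2.+1))) => [|i _].
  apply: (le_trans (hN _ _)); first by lia.
  by rewrite (ler_wpM2l (ltW e0)) // ler_nat leq_addl.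
by rewrite /g addnC ltnNge leq_addl /= addnK.
Qed.

Lemma rare_false (e : R) : 0 < e -> rare e (fun=> false).
Proof. by move=> e0; exists 0%N => n _; rewrite /cnt big1 // mulr_ge0 // ltW. Qed.

Lemma blk_blk (S : Type) (s : nat -> S) i r m :
  [seq blk s (i + k) r.+1 | k <- iota 0 m.+1] = [seq take r.+1 (drop k (blk s i (m + r).+1)) | k <- iota 0 m.+1].
Proof.
apply/eq_in_map => k; rewrite mem_iota add0n => /andP[_ km].
have -> : ((m + r).+1 = k + (r.+1 + (m - k)))%N by lia.
by rewrite blk_cat drop_size_cat ?size_blk // blk_cat take_size_cat ?size_blk.
Qed.

Lemma coded_trans (T U : eqType) S (u : nat -> U) (t : nat -> T) (s : nat -> S) :
  coded u t -> coded t s -> coded u s.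
Proof.
move=> ut ts e e0.
have e2 : 0 < e / 2 by rewrite divr_gt0.
have [r [phi hr]] := ut _ e2.
have m0 : 0 < r.*2.+1%:R :> R by rewrite ltr0n.
have e4 : 0 < e / 4%:R by rewrite divr_gt0.
(* The inner code is used at [2r + 1] positions of each window, so its error is [e / 4] divided by
   that number; the further halving in [e6] pays for [rare_shift]. *)
have e5 : 0 < e / 4%:R / r.*2.+1%:R by rewrite divr_gt0.
have e6 : 0 < e / 4%:R / r.*2.+1%:R / 2 by rewrite divr_gt0.
have [q [psi hq]] := ts _ e6.
pose chi w := phi [seq psi v | v <- [seq take q.*2.+1 (drop k w) | k <- iota 0 r.*2.+1]].
exists (r + q)%N, chi.
have h1 : rare (e / 4%:R * 3%:R) (fun i => u (i + q + r)%N != phi (blk t (i + q) r.*2.+1)).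
  by apply: rare_shift hr; lra.
have h2 : rare (e / 4%:R / r.*2.+1%:R *+ r.*2.+1) (fun i => has (fun k =>
   t (i + k + q)%N != psi (blk s (i + k) q.*2.+1)) (iota 0 r.*2.+1)).
  by apply: rare_has => k _; apply: rare_shift hq; rewrite ltr_pdivrMr // ltr_pMr // ltr1n.
apply: rare_sub (rare_or h1 h2).
  have -> : e / 4%:R / r.*2.+1%:R *+ r.*2.+1 = e / 4%:R by rewrite -[LHS]mulr_natr divfK // lt0r_neq0.
  lra.
move=> i ne; rewrite -implyNb negbK; apply/implyP => /eqP e1.
move: ne; have -> : (i + (r + q) = i + q + r)%N by lia.
rewrite e1 /chi; apply: contraNT => /hasPn h3; apply/eqP; congr phi.
have -> : ((r + q).*2.+1 = (r.*2 + q.*2).+1)%N by lia.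
rewrite -blk_blk -map_comp /blk.
have -> : iota (i + q) r.*2.+1 = [seq (i + k + q)%N | k <- iota 0 r.*2.+1].
  by rewrite -[X in iota X](addn0 (i + q)%N) iotaDl; apply: eq_map => k; lia.
rewrite -map_comp; apply/eq_in_map => k /h3 /=; rewrite negbK => /eqP -> //.
Qed.

Lemma coded_code (T : eqType) S (t : nat -> T) (s : nat -> S) r (phi : seq S -> T) :
  (forall i, t (i + r)%N = phi (blk s i r.*2.+1)) -> coded t s.
Proof.
move=> h e e0; exists r, phi; apply: rare_sub (lexx _) _ (rare_false e0) => i.
by rewrite h eqxx.
Qed.

(** The code comes from choice: a window is sent to the letter of [t] at some position where it
    occurs, and the hypothesis makes the position irrelevant. Windows that never occur receive
    [t 0]. This spares writing explicit block codes later. *)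
Lemma coded_local (T : eqType) S (t : nat -> T) (s : nat -> S) r :
  (forall i j, (r <= i)%N -> (r <= j)%N ->
     (forall k, (k <= r.*2)%N -> s (i - r + k)%N = s (j - r + k)%N) -> t i = t j) ->
  coded t s.
Proof.
move=> h.
pose phi (w : seq S) : T :=
  if pselect (exists i, blk s i r.*2.+1 = w) is left H then t (projT1 (cid H) + r)%N else t 0%N.
apply: (@coded_code _ _ _ _ r phi) => i; rewrite /phi.
case: pselect => [H|[]]; last by exists i.
case: cid => j /= ji; apply: h; rewrite ?leq_addl // !addnK => k kr.
by rewrite (blk_inj (k := k) ji).
Qed.

Lemma coded_refl (T : eqType) (t : nat -> T) : coded t t.
Proof.
apply: (@coded_local _ _ _ _ 0%N) => i j _ _ /(_ 0%N isT).
by rewrite !subn0 !addn0.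
Qed.

Lemma coded_map (T U : eqType) (h : T -> U) (t : nat -> T) : coded (fun i => h (t i)) t.
Proof.
apply: (@coded_local _ _ _ _ 0%N) => i j _ _ /(_ 0%N isT).
by rewrite !subn0 !addn0 => ->.
Qed.

Lemma coded_limit (T : eqType) S (t : nat -> T) (s : nat -> S) :
  (forall e : R, 0 < e -> exists2 t', coded t' s & rare e (fun i => t i != t' i)) -> coded t s.
Proof.
move=> h e e0.
have e4 : 0 < e / 4%:R by rewrite divr_gt0.
have [t' ts tt] := h _ e4; have [r [phi hr]] := ts _ e4.
exists r, phi.
have h1 : rare (e / 2) (fun i => t (i + r)%N != t' (i + r)%N) by apply: rare_shift tt; lra.
apply: rare_sub (rare_or h1 hr); first lra.
by move=> i; case: (t (i + r)%N =P t' (i + r)%N) => //= ->.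
Qed.

Lemma coded_ext (T : eqType) S (t t' : nat -> T) (s : nat -> S) N :
  (forall i, (N <= i)%N -> t i = t' i) -> coded t' s -> coded t s.
Proof.
move=> tt ts; apply: coded_limit => e e0; exists t' => //.
have [M hM] := @archi_le R e N%:R e0; exists M => n /hM; apply: le_trans.
rewrite ler_nat; elim: n => [|n IHn]; first by rewrite cnt0.
rewrite cntS; have [nN|/tt ->] := ltnP n N; last by rewrite eqxx addn0.
by rewrite (leq_trans _ nN) // -addn1 leq_add ?cnt_le //; case: (_ != _).
Qed.

Lemma coded_radius (T : eqType) S (t : nat -> T) (s : nat -> S) (e e' : R) r phi k : e < e' ->
  rare e (fun i => t (i + r)%N != phi (blk s i r.*2.+1)) ->
  exists psi, rare e' (fun i => t (i + (r + k))%N != psi (blk s i (r + k).*2.+1)).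
Proof.
move=> ee h; exists (fun w => phi (take r.*2.+1 (drop k w))).
apply: rare_sub (lexx _) _ (rare_shift k ee h) => i.
have -> : ((r + k).*2.+1 = k + (r.*2.+1 + k))%N by lia.
rewrite blk_cat drop_size_cat ?size_blk // blk_cat take_size_cat ?size_blk //.
by have -> : (i + (r + k) = i + k + r)%N by lia.
Qed.

Lemma coded_pair (T U : eqType) S (t : nat -> T) (u : nat -> U) (s : nat -> S) :
  coded t s -> coded u s -> coded (fun i => (t i, u i)) s.
Proof.
move=> ts us e e0.
have e4 : 0 < e / 4%:R by rewrite divr_gt0.
have [r [phi hr]] := ts _ e4; have [q [psi hq]] := us _ e4.
have [|phi' h1] := @coded_radius _ _ _ _ _ (e / 2) _ _ q _ hr; first lra.
have [|psi' h2] := @coded_radius _ _ _ _ _ (e / 2) _ _ r _ hq; first lra.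
exists (r + q)%N, (fun w => (phi' w, psi' w)).
apply: rare_sub (rare_or h1 h2); first lra.
by move=> i; rewrite xpair_eqE negb_and (addnC q).
Qed.

End Approximation.

(** * Generic points of ergodic measures *)

Section Tiling.
Variable R : realType.

(* Greedy tiling: from a good point one jumps over a stretch on which [f] has
   density at least [c], from a bad point one moves by one step. *)
Lemma tiling (f b : nat -> bool) (c : R) N : 0 <= c <= 1 ->
  (forall i, ~~ b i -> exists n, [/\ (0 < n)%N, (n <= N)%N & c * n%:R <= (cnt (fun j => f (i + j)%N) n)%:R]) ->
  forall M, c * (M%:R - N%:R) <= (cnt f M)%:R + (cnt b M)%:R.
Proof.
move=> /andP[c0 c1] h M.
suff H m i : c * (m%:R - N%:R) <= (cnt (fun j => f (i + j)%N) m)%:R + (cnt (fun j => b (i + j)%N) m)%:R.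
  exact: H M 0%N.
elim/ltn_ind: m i => m IHm i.
have [mN|Nm] := leqP m N.
  apply: (@le_trans _ _ 0); last by rewrite addr_ge0.
  by apply: mulr_ge0_le0 => //; rewrite subr_le0 ler_nat.
have [bi|nbi] := boolP (b i).
  case: m Nm IHm => // m Nm IHm; rewrite !cntSl addn0 bi.
  have := IHm m (leqnn _) i.+1.
  have e g : cnt (fun j => g (i.+1 + j)%N) m = cnt (fun j => g (i + j.+1)%N) m.
    by apply: eq_cnt => j _; rewrite addSnnS.
  rewrite !e !natrD -natr1; set u := (cnt _ _)%:R; set v := (cnt _ _)%:R.
  have : 0 <= (f i)%:R :> R by [].
  have -> : true%:R = 1 :> R by [].
  rewrite !mulrBr mulrDr mulr1; lra.
have [n [n0 nN cn]] := h i nbi.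
have nm : (n <= m)%N by lia.
rewrite -(subnKC nm) !cnt_cat !natrD.
have := IHm (m - n)%N (ltac:(lia)) (i + n)%N.
have e g : cnt (fun j => g (i + n + j)%N) (m - n) = cnt (fun j => g (i + (n + j))%N) (m - n).
  by apply: eq_cnt => j _; rewrite addnA.
rewrite !e; set u := (cnt _ (m - n))%:R; set v := (cnt _ (m - n))%:R.
have : 0 <= (cnt (fun j => b (i + j)%N) n)%:R :> R by [].
move: cn; rewrite !mulrBr mulrDr; lra.
Qed.

End Tiling.

(** * A mean ergodic theorem along a generic point *)

Section GenericErgodic.
Variables (K : finType) (R : realType) (p y : seq_space K) (mu : probability (borel p) R).
Hypotheses (emu : ergodic_measure (@seq_shift K) mu) (gmu : generic y mu).

Definition window_set (psi : seq K -> bool) r : set (seq_space K) :=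
  [set z | psi (blk z 0 r)].

Lemma window_setE psi r : window_set psi r =
  \bigcup_(w in [set w : r.-tuple K | psi w]) cyl w.
Proof.
apply/seteqP; split => z.
  move=> h; exists (Tuple (introT eqP (size_blk z 0 r))) => //.
  by rewrite /cyl /= size_blk.
by case=> w /= hw; rewrite /cyl /window_set /= size_tuple => ->.
Qed.

Lemma cyl_measurable_id w : measurable (cyl w : set (borel p)).
Proof. exact: (@cyl_measurable K _ id (@initial_id K)). Qed.

Lemma window_set_measurable psi r : measurable (window_set psi r : set (borel p)).
Proof.
rewrite window_setE; apply: fin_bigcup_measurable; first exact: finite_finset.
by move=> w _; exact: cyl_measurable_id.
Qed.

Lemma window_set_measure psi r :
  fine (mu (window_set psi r)) = \sum_(w : r.-tuple K | psi w) fine (mu (cyl w)).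
Proof.
rewrite window_setE measure_fin_bigcup //; first last.
- by move=> w _; exact: cyl_measurable_id.
- move=> w v _ _ [z []]; rewrite /cyl /= !size_tuple => zw zv.
  by apply: val_inj; rewrite /= -zw -zv.
- exact: finite_finset.
rewrite (fsbigE [seq w : r.-tuple K <- enum {: r.-tuple K} | psi w]); first last.
- by move=> w /= hw; rewrite mem_filter hw mem_enum.
- by move=> w /=; rewrite mem_filter => /andP[].
- by rewrite filter_uniq ?enum_uniq.
rewrite big_filter_cond /= big_enum_cond /= -sum_fine; last first.
  by move=> w _; rewrite fin_num_measure //; exact: cyl_measurable_id.
rewrite [RHS]big_mkcond [LHS]big_mkcond; apply: eq_bigr => w _.
have -> : (w \in [set w : r.-tuple K | psi w]) = psi w by apply/idP/idP; rewrite inE.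
by rewrite andbb.
Qed.

Lemma generic_cyl w : freq R y w @ \oo --> fine (mu (cyl w)).
Proof.
case: w => [|a w].
  have -> : cyl [::] = [set: seq_space K] by apply/seteqP.
  rewrite (_ : mu setT = 1%E) ?probability_setT //=.
  apply: cvg_near_cst; exists 1%N => // n /= n0.
  rewrite /freq (@eq_cnt _ (fun=> true)) //.
  have -> : cnt (fun=> true) n = n by elim: n {n0} => [|n IHn]; rewrite ?cnt0 // cntS IHn addn1.
  by rewrite divff // pnatr_eq0; lia.
have := @gmu _ (in_tuple (a :: w)) isT.
rewrite cylinderE -[X in _ --> X]fineK; last by rewrite fin_num_measure //; exact: cyl_measurable_id.
move=> /fine_cvgP[_].
rewrite (_ : fine \o _ = freq R y (a :: w)) //.
by apply/funext => n; rewrite /= occurrencesE.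
Qed.

Lemma generic_window psi r :
  (cnt (fun i => psi (blk y i r)) n)%:R / n%:R @[n --> \oo] --> fine (mu (window_set psi r)).
Proof.
rewrite window_set_measure.
rewrite (_ : (fun n => _) = fun n => \sum_(w : r.-tuple K | psi w) freq R y w n); last first.
  apply/funext => n; rewrite /freq -mulr_suml -natr_sum; congr (_%:R / _).
  rewrite /cnt exchange_big /=; apply: eq_bigr => i _.
  pose w0 := Tuple (introT eqP (size_blk y i r)).
  have e w : occurs y (w : r.-tuple K) i = (w == w0).
    by rewrite /occurs size_tuple eq_sym.
  under eq_bigr => w _ do rewrite e.
  have [h|h] := boolP (psi (blk y i r)).
    by rewrite (bigD1 w0) //= eqxx big1 // => w /andP[_ /negbTE ->].
  rewrite big1 // => w hw; case: eqP => // ww; exfalso; move: h; apply/negP; rewrite negbK.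
  by move: hw; rewrite ww.
by apply: cvg_big => [|w _]; [exact: add_continuous|exact: generic_cyl].
Qed.


Section Window.
Variables (phi : seq K -> bool) (r : nat).
Let D := window_set phi r.
Let rho : R := fine (mu D).
Let hits (z : nat -> K) i n := cnt (fun j => phi (blk z (i + j) r)) n.
Let whits (w : seq K) n := cnt (fun j => phi (take r (drop j w))) n.

Lemma whitsE z i n m : (n <= m)%N -> whits (blk z i (m + r)) n = hits z i n.
Proof.
move=> nm; apply: eq_cnt => j jn; congr phi.
have -> : (m + r = j + (r + (m - j)))%N by lia.
by rewrite blk_cat drop_size_cat ?size_blk // blk_cat take_size_cat ?size_blk.
Qed.

Lemma hits_shift (z : seq_space K) n :
  hits z 0 n.+1 = (phi (blk z 0 r) + hits (seq_shift z) 0 n)%N.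
Proof.
rewrite /hits cntSl addn0; congr (_ + _)%N; apply: eq_cnt => j _; congr phi.
by apply: eq_blk => k _.
Qed.

Definition dense_at (c : R) n : set (seq_space K) := [set z | c * n%:R <= (hits z 0 n)%:R].

Lemma dense_atE c n : dense_at c n =
  window_set (fun w => c * n%:R <= (whits w n)%:R) (n + r).
Proof. by apply/seteqP; split=> z; rewrite /dense_at /window_set /= whitsE. Qed.

Lemma dense_at_measurable c n : measurable (dense_at c n : set (borel p)).
Proof. by rewrite dense_atE; exact: window_set_measurable. Qed.

(** The set where the upper density of hits exceeds [c]. The fixed excess [1 / (k + 1)] leaves room
    for a shift by one step and makes the set exactly invariant, as [ergodic_measure] requires. *)
Definition often_dense (c : R) : set (seq_space K) :=
  \bigcup_k \bigcap_N \bigcup_(n in [set n | (N <= n)%N]) dense_at (c + k.+1%:R^-1) n.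

Lemma often_dense_measurable c : measurable (often_dense c : set (borel p)).
Proof.
apply: bigcup_measurable => k _; apply: bigcapT_measurable => N.
by apply: bigcup_measurable => n _; exact: dense_at_measurable.
Qed.

Lemma often_dense_perturb c (u z : seq_space K) (g : nat -> nat) : 0 <= c ->
  (forall n, (n <= g n + 1)%N && (g n <= n + 1)%N) ->
  (forall n, (0 < n)%N -> (hits u 0 n <= hits z 0 (g n) + 1)%N) ->
  often_dense c u -> often_dense c z.
Proof.
move=> c0 hg uz [k _ hk].
(* The new excess [1 / (2k + 2)] is half of the old one; the other half pays for changing the time
   and the count by one, once [n] is large. *)
exists k.*2.+1 => // N _.
set e := k.+1%:R^-1 : R; set e' := k.*2.+2%:R^-1 : R.
have e0 : 0 < e by rewrite invr_gt0 ltr0n.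
have ee : e = 2 * e' by rewrite /e /e' -doubleS -muln2 natrM invfM mulrCA mulfV // mulr1.
have [M hM] := @archi_le R e' (1 + c + e') (ltac:(lra)).
have [n /= Nn un] := hk (N + M + 1)%N I.
exists (g n); first by have := hg n; rewrite /=; lia.
have /andP[g1 g2] := hg n.
have {}uz := uz n (ltac:(lia)).
have nM := hM n (ltac:(lia)).
move: un; rewrite /dense_at /= -/e -/e' => un.
rewrite -(ler_nat R) natrD in uz; rewrite -(ler_nat R) natrD in g2.
have : (c + e') * (g n)%:R <= (c + e') * (n%:R + 1) by apply: ler_wpM2l => //; lra.
by move: un nM; rewrite ee !mulrDl !mulrDr !mulr1; lra.
Qed.

Lemma often_dense_invariant c : 0 <= c -> @seq_shift K @^-1` often_dense c = often_dense c.
Proof.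
move=> c0; apply/seteqP; split => z.
  apply: (often_dense_perturb (g := S)) => //; first by move=> n; lia.
  by move=> n _; rewrite hits_shift; lia.
apply: (often_dense_perturb (g := predn)) => //; first by move=> n; lia.
by case=> // n _; rewrite hits_shift /=; case: (phi _) => /=; lia.
Qed.

Lemma rho_01 : 0 <= rho <= 1.
Proof.
have mD := window_set_measurable phi r.
rewrite /rho fine_ge0 //= -lee_fin fineK ?fin_num_measure //.
exact: probability_le1.
Qed.

Definition dense_before (c : R) N : set (seq_space K) :=
  window_set (fun w => has (fun n => c * n%:R <= (whits w n)%:R) (iota 1 N)) (N + r).

Lemma dense_beforeP c N z : dense_before c N z <->
  exists n, [/\ (0 < n)%N, (n <= N)%N & c * n%:R <= (hits z 0 n)%:R].
Proof.
rewrite /dense_before /window_set /=; split => [/hasP[n]|[n [n0 nN h]]].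
  rewrite mem_iota => /andP[n0 nN]; rewrite whitsE; last by lia.
  by exists n; split => //; lia.
by apply/hasP; exists n; [rewrite mem_iota; lia|rewrite whitsE].
Qed.

(** A maximal inequality proved along [y]. From every position outside [b] there starts a stretch of
    length at most [N] with density of hits at least [c], so by [tiling] the frequency of hits is at
    least [c] minus that of [b], up to a vanishing term. Genericity turns both frequencies into
    measures. The alternative [1 < c] is there because [tiling] needs [c <= 1]. *)
Lemma dense_before_measure c N : rho < c -> fine (mu (dense_before c N)) <= 1 - (c - rho) \/ 1 < c.
Proof.
move=> rc; have [c1|] := leP c 1; [left|by right].
have /andP[r0 r1] := rho_01.
pose b i := ~~ has (fun n => c * n%:R <= (whits (blk y i (N + r)) n)%:R) (iota 1 N).
pose f i := phi (blk y i r).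
have T M : c * (M%:R - N%:R) <= (cnt f M)%:R + (cnt b M)%:R.
  apply: tiling; first by apply/andP; split => //; lra.
  move=> i; rewrite negbK => /hasP[n]; rewrite mem_iota => /andP[n0 nN].
  by rewrite whitsE; [exists n; split => //; lia|lia].
have cb M : (cnt b M)%:R = M%:R - (cnt (fun i => ~~ b i) M)%:R :> R.
  apply/eqP; rewrite eq_sym subr_eq -natrD; apply/eqP; congr (_%:R).
  by elim: M => [|M IHM]; rewrite ?cnt0 // !cntS addnACA -IHM; case: (b M); lia.
have h1 := @generic_window phi r.
have h2 := @generic_window (fun w => has (fun n => c * n%:R <= (whits w n)%:R) (iota 1 N)) (N + r).
have h3 : (fun n => (cnt f n)%:R / n%:R - (cnt (fun i => ~~ b i) n)%:R / n%:R : R) @ \oo -->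
   rho - fine (mu (dense_before c N)).
  apply: cvgB; first exact: h1.
  rewrite (_ : (fun n => _) = fun n => (cnt (fun i => has (fun n => c * n%:R <= (whits (blk y i (N + r)) n)%:R) (iota 1 N)) n)%:R / n%:R) //.
  by apply/funext => n; congr (_%:R / _); apply: eq_cnt => i _; rewrite negbK.
suff : c - 1 <= rho - fine (mu (dense_before c N)) by lra.
apply/ler_addgt0Pl => e e0.
apply: (cvgr_to_ge (cvgD (cvg_cst e) h3)).
have [M hM] := @archi_le R e (c * N%:R) e0.
exists (M + 1)%N => // n /= Mn.
have n0 : 0 < n%:R :> R by rewrite ltr0n; lia.
have := T n; rewrite cb => Tn; have := hM n (ltac:(lia)) => en.
rewrite -(ler_pM2r n0); move: Tn en n0.
set A := (cnt f n)%:R; set B := (cnt _ n)%:R; set m := n%:R => Tn en m0.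
have -> : (e + (A / m - B / m)) * m = e * m + A - B by field; rewrite lt0r_neq0.
by move: Tn; rewrite mulrBr; lra.
Qed.

(** By ergodicity the measure is 0 or 1. In the second case the sets [dense_before c N] increase to
    a set of measure 1, although their measures never exceed [1 - (c - rho)]; for [1 < c] the set is
    simply empty. *)
Lemma often_dense_null c : rho < c -> mu (often_dense c) = 0%E.
Proof.
move=> rc.
have /andP[r0 r1] := rho_01.
have c0 : 0 <= c by lra.
have mo := often_dense_measurable c.
have [//|o1] := emu.2 _ mo (often_dense_invariant c0).
exfalso.
have sub : often_dense c `<=` \bigcup_N dense_before c N.
  move=> z [k _ /(_ 1%N I)[n /= n1 zn]]; exists n => //; apply/dense_beforeP.
  exists n; split => //; move: zn; rewrite /dense_at /=; apply: le_trans.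
  by apply: ler_wpM2r => //; rewrite lerDl invr_ge0.
have [c1|c1] := ltP 1 c.
  have : often_dense c = set0.
    apply/seteqP; split => // z [k _ /(_ 1%N I)[n /= n1]]; rewrite /dense_at /= => h.
    have := cnt_le (fun j => phi (blk z (0 + j) r)) n; rewrite -(ler_nat R) => h'.
    have := le_trans h h'; rewrite -[leRHS]mul1r ler_pM2r ?ltr0n // => h2.
    have : c <= 1 by apply: le_trans h2; rewrite lerDl invr_ge0.
    by rewrite leNgt c1.
  by move=> e; move: o1; rewrite e measure0 => /esym/eqP; rewrite gt_eqF // lte01.
have mb N : measurable (dense_before c N : set (borel p)) by exact: window_set_measurable.
have mU : measurable (\bigcup_N dense_before c N : set (borel p)) by exact: bigcup_measurable.
have nd : {homo (fun N => dense_before c N) : n m / (n <= m)%N >-> (n <= m)%O}.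
  move=> n m nm; apply/subsetPset => z /dense_beforeP[k [k0 kn h]]; apply/dense_beforeP.
  by exists k; split => //; lia.
have cv := nondecreasing_cvg_mu (mu := mu) mb mU nd.
have U1 : mu (\bigcup_N dense_before c N) = 1%E.
  apply/eqP; rewrite eq_le probability_le1 //= -o1.
  by apply: le_measure => //; rewrite inE.
have : (1 <= (1 - (c - rho))%:E)%E.
  rewrite -U1; apply: (cvge_to_le cv); apply: nearW => N /=.
  rewrite -[leLHS]fineK ?fin_num_measure // lee_fin.
  by have [//|] := @dense_before_measure c N rc; lra.
by rewrite lee_fin; lra.
Qed.

(** Passage from almost everywhere to measure: the unions of [dense_at c n] over [n >= N] decrease
    to a subset of the null set [often_dense c'], where [c'] lies halfway between [rho] and [c] to
    provide the excess. *)
Lemma eventually_not_dense c e : rho < c -> 0 < e ->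
  exists N, forall n, (N <= n)%N -> fine (mu (dense_at c n)) < e.
Proof.
move=> rc e0.
pose c' := (rho + c) / 2.
have rc' : rho < c' by rewrite /c'; lra.
have cc' : 0 < c - c' by rewrite /c'; lra.
pose G N := \bigcup_(n in [set n | (N <= n)%N]) dense_at c n.
have mG N : measurable (G N : set (borel p)).
  by apply: bigcup_measurable => n _; exact: dense_at_measurable.
have mI : measurable (\bigcap_N G N : set (borel p)) by exact: bigcapT_measurable.
have ni : {homo G : n m / (n <= m)%N >-> (m <= n)%O}.
  move=> n m nm; apply/subsetPset => z [k /= mk h]; exists k => //=; lia.
have I0 : mu (\bigcap_N G N) = 0%E.
  apply: (subset_measure0 _ _ _ (often_dense_null rc')) => //; first exact: often_dense_measurable.
  have [M hM] := natinv_lt cc'.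
  move=> z hz; exists M => // N _.
  have [n /= Nn h] := hz (N + 1)%N I; exists n => /=; first lia.
  move: h; rewrite /dense_at /=; apply: le_trans; apply: ler_wpM2r => //.
  by rewrite -lerBrDl ltW // hM.
have fin0 : (mu (G 0%N) < +oo)%E by rewrite -ge0_fin_numE ?fin_num_measure.
have cv : mu \o G @ \oo --> 0%R%:E by rewrite -[X in _ --> X]I0; exact: nonincreasing_cvg_mu.
move/fine_cvgP : cv => [_ /cvgrPdist_lt /(_ e e0)[N _ hN]].
exists N => n Nn; have := hN N (leqnn N); rewrite /= sub0r normrN; apply: le_lt_trans.
apply: le_trans (ler_norm _).
rewrite fine_le ?fin_num_measure //; try exact: dense_at_measurable.
apply: le_measure; rewrite ?inE //; first exact: dense_at_measurable.
by move=> z h; exists n.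
Qed.

End Window.

Lemma rare_window (psi : seq K -> bool) r (e : R) :
  fine (mu (window_set psi r)) < e -> rare e (fun i => psi (blk y i r)).
Proof.
move=> he; have := cvgr_lt _ (@generic_window psi r) _ he => -[N _ hN].
exists N.+1 => n Nn; have n0 : 0 < n%:R :> R by rewrite ltr0n; lia.
by rewrite -ler_pdivrMr // ltW // (hN n) //=; lia.
Qed.

(** Upper bounds for [phi] and for its negation control window frequencies from both sides. Windows
    violating one of them have density at most [d / 4] and cost at most [L] each; the others cost at
    most [d / 4 * L]. *)
Lemma generic_erg_seq : erg_seq R (y : nat -> K).
Proof.
move=> r phi d d0.
set rho := fine (mu (window_set phi r)).
pose nphi w := ~~ phi w.
have /andP[r0 r1] := rho_01 phi r.
have d4 : 0 < d / 4%:R by rewrite divr_gt0.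
have d8 : 0 < d / 8%:R by rewrite divr_gt0.
have rhoN : fine (mu (window_set nphi r)) = 1 - rho.
  have -> : window_set nphi r = ~` window_set phi r.
    by apply/seteqP; split => z; rewrite /window_set /= => /negP.
  have mD := window_set_measurable phi r.
  by rewrite probability_setC // /rho -{1}(@fineK _ (mu (window_set phi r))) ?fin_num_measure.
have [N1 h1] := @eventually_not_dense phi r (rho + d / 4%:R) (d / 8%:R) (ltac:(rewrite -/rho; lra)) d8.
have [N2 h2] := @eventually_not_dense nphi r (1 - rho + d / 4%:R) (d / 8%:R) (ltac:(rewrite rhoN; lra)) d8.
pose L := (N1 + N2 + 1)%N.
have {}h1 := h1 L (ltac:(rewrite /L; lia)).
have {}h2 := h2 L (ltac:(rewrite /L; lia)).
rewrite dense_atE in h1; rewrite dense_atE in h2.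
have [N hN] := rare_or (rare_window h1) (rare_window h2).
exists rho, L, N; split; [by rewrite r0| by rewrite /L addn1|].
move=> n /hN; set b := fun i => _ => hb.
have L0 : 0 <= L%:R :> R by [].
have P i : `|(cnt (fun j => phi (blk y (i + j) r)) L)%:R - rho * L%:R| <=
    d / 4%:R * L%:R + (b i)%:R * L%:R.
  have e1 := @whitsE phi r y i L L (leqnn L).
  have e2 := @whitsE nphi r y i L L (leqnn L).
  have e3 : (cnt (fun j => nphi (blk y (i + j) r)) L)%:R = L%:R - (cnt (fun j => phi (blk y (i + j) r)) L)%:R :> R.
    apply/eqP; rewrite eq_sym subr_eq -natrD; apply/eqP; congr (_%:R).
    by rewrite (cnt_negb (fun j => phi (blk y (i + j) r))).
  have le1 := cnt_le (fun j => phi (blk y (i + j) r)) L; rewrite -(ler_nat R) in le1.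
  have ge0 : 0 <= (cnt (fun j => phi (blk y (i + j) r)) L)%:R :> R by [].
  have rL : 0 <= rho * L%:R by rewrite mulr_ge0.
  have rL1 : rho * L%:R <= L%:R by rewrite ler_piMl.
  have dL : 0 <= d / 4%:R * L%:R by rewrite mulr_ge0 // ltW.
  rewrite /b e1 e2 e3.
  move: le1 ge0; set u := (cnt _ _)%:R => le1 ge0.
  have [h|] := boolP ((_ <= u) || _).
    by rewrite mulr1n mul1r ler_norml; apply/andP; split; lra.
  rewrite negb_or -!ltNge => /andP[]; rewrite !mulrDl mulNr mul1r => h3 h4.
  by rewrite mulr0n mul0r addr0 ler_norml; apply/andP; split; lra.
apply: (@le_trans _ _ (\sum_(i < n) (d / 4%:R * L%:R + (b i)%:R * L%:R))).
  by apply: ler_sum => i _; exact: P.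
rewrite big_split /= sumr_const card_ord -mulr_suml -natr_sum.
rewrite -/(cnt b n) -mulr_natr.
have := ler_wpM2r L0 hb.
have : 0 <= d * L%:R * n%:R by rewrite !mulr_ge0 // ltW.
lra.
Qed.

End GenericErgodic.

(** * Markers *)

Section Windows.
Variable R : realType.
Implicit Types (f g : nat -> bool) (d e r : R).

Lemma cnt_shift_dist f j n : `|(cnt (fun i => f (j + i)%N) n)%:R - (cnt f n)%:R| <= j%:R :> R.
Proof.
have h1 := cnt_cat f j n; have h2 := cnt_cat f n j.
have c1 := cnt_le f j; have c2 := cnt_le (fun i => f (n + i)%N) j.
have a1 : (cnt (fun i => f (j + i)%N) n <= cnt f n + j)%N by rewrite addnC in h1; lia.
have a2 : (cnt f n <= cnt (fun i => f (j + i)%N) n + j)%N by rewrite addnC in h1; lia.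
rewrite -(ler_nat R) natrD in a1; rewrite -(ler_nat R) natrD in a2.
by rewrite ler_norml; apply/andP; split; lra.
Qed.

(** Every position lies in [L] windows except near the two ends, so the window counts add up to [L]
    times the total count, up to [L * L]. *)
Lemma window_freq_sum f L n r :
  L%:R * `|(cnt f n)%:R - r * n%:R| <= window_sum f L n r + L%:R * L%:R.
Proof.
rewrite -[X in X * _ <= _](ger0_norm (ler0n R L)) -normrM.
have e : \sum_(i < n) ((cnt (fun j => f (i + j)%N) L)%:R - r * L%:R) =
    \sum_(j < L) (cnt (fun i => f (j + i)%N) n)%:R - L%:R * r * n%:R.
  rewrite sumrB -natr_sum exchange_cnt natr_sum sumr_const card_ord -[X in _ - X]mulr_natr.
  by rewrite (mulrC r).
have h1 : `|\sum_(j < L) (cnt (fun i => f (j + i)%N) n)%:R - L%:R * r * n%:R| <= window_sum f L n r.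
  by rewrite -e; exact: ler_norm_sum.
have h2 : `|\sum_(j < L) (cnt (fun i => f (j + i)%N) n)%:R - L%:R * (cnt f n)%:R| <= L%:R * L%:R :> R.
  have -> : L%:R * (cnt f n)%:R = \sum_(j < L) (cnt f n)%:R :> R by rewrite sumr_const card_ord mulr_natl.
  rewrite -sumrB; apply: (le_trans (ler_norm_sum _ _ _)).
  rewrite [leRHS](_ : _ = \sum_(j < L) L%:R); last by rewrite sumr_const card_ord mulr_natl.
  apply: ler_sum => j _; apply: (le_trans (cnt_shift_dist f j n)).
  by rewrite ler_nat ltnW.
move: h1 h2; rewrite mulrBr mulrA !ler_norml => /andP[? ?] /andP[? ?].
by apply/andP; split; lra.
Qed.

Lemma window_freq f L n r d : (0 < L)%N -> window_sum f L n r <= d * L%:R * n%:R ->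
  `|(cnt f n)%:R - r * n%:R| <= d * n%:R + L%:R.
Proof.
move=> L0 h; have L0' : 0 < L%:R :> R by rewrite ltr0n.
rewrite -(ler_pM2l L0'); apply: (le_trans (window_freq_sum _ _ _ _)).
by rewrite mulrDr lerD2r mulrA (mulrC L%:R).
Qed.

Lemma window_sum_cat f L m n r :
  window_sum f L (m + n) r = window_sum f L m r + window_sum (fun i => f (m + i)%N) L n r.
Proof.
rewrite /window_sum big_split_ord /=; congr (_ + _); apply: eq_bigr => i _.
by congr (`|_%:R - _|); apply: eq_cnt => j _; rewrite addnA.
Qed.

Lemma window_sum_mult f L n r m :
  window_sum f (m * L) n r <= m%:R * window_sum f L (m * L + n) r.
Proof.
have P i : `|(cnt (fun j => f (i + j)%N) (m * L))%:R - r * (m * L)%:R| <=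
   \sum_(t < m) `|(cnt (fun j => f (t * L + i + j)%N) L)%:R - r * L%:R|.
  elim: m => [|m IHm]; first by rewrite mul0n cnt0 mulr0 subrr normr0 big_ord0.
  rewrite big_ord_recr /= mulSn addnC cnt_cat !natrD.
  have -> : cnt (fun j => f (i + (m * L + j))%N) L = cnt (fun j => f (m * L + i + j)%N) L.
    by apply: eq_cnt => j _; rewrite addnA (addnC i).
  set a := (cnt _ (m * L))%:R in IHm *; set b := (cnt _ L)%:R.
  have -> : a + b - r * ((m * L)%:R + L%:R) = (a - r * (m * L)%:R) + (b - r * L%:R) by ring.
  by apply: (le_trans (ler_normD _ _)); rewrite lerD2r.
apply: (@le_trans _ _ (\sum_(i < n) \sum_(t < m) `|(cnt (fun j => f (t * L + i + j)%N) L)%:R - r * L%:R|)).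
  by apply: ler_sum => i _; exact: P.
rewrite exchange_big /= [leRHS](_ : _ = \sum_(t < m) window_sum f L (m * L + n) r); last first.
  by rewrite sumr_const card_ord mulr_natl.
apply: ler_sum => t _.
have tm : (t * L <= m * L)%N by rewrite leq_mul2r ltnW ?orbT.
rewrite /window_sum.
pose F k := `|(cnt (fun j => f (k + j)%N) L)%:R - r * L%:R|.
rewrite -(big_mkord xpredT (fun i => F (t * L + i)%N)) -(big_mkord xpredT F).
rewrite [leRHS](@big_cat_nat _ _ _ (t * L)) ?leq0n //=; last by lia.
rewrite [X in _ + X](@big_cat_nat _ _ _ (t * L + n) (t * L)) /=; [|by lia..].
have -> : \sum_(0 <= i < n) F (t * L + i)%N = \sum_(t * L <= i < t * L + n) F i.
  by rewrite -{2}(add0n (t * L)%N) big_addn addKn; apply: eq_bigr => i _; rewrite addnC.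
rewrite addrCA lerDl addr_ge0 // sumr_ge0 // => i _; exact: normr_ge0.
Qed.

(** Window lengths can be made divisible by [m], in the applications a gap or a period. The halved
    [d] pays for the [m * L] additional starting positions once [n >= m * L]. *)
Lemma erg_avg_mult f d m : 0 < d -> (0 < m)%N -> erg_avg R f -> exists (r : R) L N,
  [/\ 0 <= r <= 1, (0 < L)%N &
      forall n, (N <= n)%N -> window_sum f (m * L) n r <= d * (m * L)%:R * n%:R].
Proof.
move=> d0 m0 ef.
have d2 : 0 < d / 2 by rewrite divr_gt0.
have [r [L [N [r01 L0 h]]]] := ef _ d2.
exists r, L, (N + m * L)%N; split => // n Nn.
apply: (le_trans (window_sum_mult _ _ _ _ _)).
apply: (@le_trans _ _ (m%:R * (d / 2 * L%:R * (m * L + n)%:R))).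
  by apply: ler_wpM2l => //; apply: h; lia.
rewrite natrM.
have : (m * L + n)%:R <= 2 * n%:R :> R by rewrite -natrM ler_nat; lia.
set x := (m * L + n)%:R => hx.
have : m%:R * (d / 2 * L%:R) * x <= m%:R * (d / 2 * L%:R) * (2 * n%:R).
  by apply: ler_wpM2l hx; rewrite !mulr_ge0 // ltW.
lra.
Qed.

Lemma rare_unshift e e' f k : e < e' -> rare e (fun i => f (i + k)%N) -> rare e' f.
Proof.
move=> ee [N h].
have [M hM] := @archi_le R (e' - e) (k%:R + `|e| * k%:R) (ltac:(lra)).
exists (N + M + k)%N => n Nn.
have kn : (k <= n)%N by lia.
have := h (n - k)%N (ltac:(lia)); have := hM n (ltac:(lia)).
rewrite -(subnKC kn) cnt_cat addKn !natrD.
have -> : cnt (fun i => f (k + i)%N) (n - k) = cnt (fun i => f (i + k)%N) (n - k).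
  by apply: eq_cnt => i _; rewrite addnC.
have : (cnt f k)%:R <= k%:R :> R by rewrite ler_nat cnt_le.
have : - (`|e| * k%:R) <= e * k%:R.
  by rewrite -mulNr; apply: ler_wpM2r => //; exact: lerNnormlW.
move=> *; lra.
Qed.

Definition null f := forall e, 0 < e -> rare e f.

(** Under [erg_avg] upper and lower densities nearly agree: one late time with frequency above [e]
    forces [r >= 3e/4], and at all late times the frequency is within [e/4] of [r]. *)
Lemma not_rare_lower f e : 0 < e -> erg_avg R f -> ~ rare e f ->
  exists N, forall n, (N <= n)%N -> e / 2 * n%:R <= (cnt f n)%:R.
Proof.
move=> e0 ef nr.
have e8 : 0 < e / 8%:R by rewrite divr_gt0.
have [r [L [N [r01 L0 h]]]] := ef _ e8.
have [M hM] := @archi_le R (e / 8%:R) L%:R e8.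
have D n : (N + M <= n)%N -> `|(cnt f n)%:R - r * n%:R| <= e / 4%:R * n%:R.
  move=> nn; apply: (le_trans (window_freq L0 (h n _))); first by lia.
  have := hM n (ltac:(lia)); lra.
have [n nn hn] : exists2 n, (N + M <= n)%N & e * n%:R < (cnt f n)%:R.
  apply: contrapT => H; apply: nr; exists (N + M)%N => n nn.
  by rewrite leNgt; apply/negP => hn; apply: H; exists n.
have n0 : 0 < n%:R :> R.
  by rewrite ltr0n lt0n; apply/eqP => z; move: hn; rewrite z cnt0 mulr0 ltxx.
have hr : e * (3%:R / 4%:R) <= r.
  rewrite -(ler_pM2r n0); have := D n nn; rewrite ler_norml => /andP[? ?]; lra.
exists (N + M)%N => k kk; have := D k kk; rewrite ler_norml => /andP[? ?].
have : e * (3%:R / 4%:R) * k%:R <= r * k%:R by rewrite ler_wpM2r.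
lra.
Qed.

End Windows.

Definition marker_set (l H : nat) (M : nat -> bool) :=
  [/\ M 0%N, forall i, exists j, [/\ (i < j)%N, (j <= i + H)%N & M j] &
      forall i j, M i -> M j -> (i < j)%N -> (i + l <= j)%N].

Lemma common_bound a b c d :
  exists n, [/\ (a <= n)%N, (b <= n)%N, (c <= n)%N, (d <= n)%N & (0 < n)%N].
Proof. by exists (a + b + c + d + 1)%N; split; lia. Qed.

Section Markers.
Variable R : realType.

Definition has_markers (S : Type) (z : nat -> S) :=
  forall l, exists H M, coded R M z /\ marker_set l H M.

Section Rare.
Variables (l : nat) (g : nat -> bool).
Hypothesis l0 : (0 < l)%N.

(* [starts] selects the occurrences of [g] that are preceded by a gap of length
   [l]; between two of them the markers are placed periodically. *)
Definition starts i := [&& (l <= i)%N, g i & ~~ has g (iota (i - l) l)].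

Fixpoint last_start i := if i is i'.+1 then (if starts i then i else last_start i') else 0%N.

Definition markers i :=
  ((i - last_start i) %% l == 0)%N && ~~ has starts (iota i.+1 l.-1).

Lemma last_start_le i : (last_start i <= i)%N.
Proof. by elim: i => //= i IHi; case: ifP => // _; exact: leqW. Qed.

Lemma startsN0 : starts 0 = false.
Proof. by rewrite /starts leqNgt l0. Qed.

Lemma last_start_self i : starts i -> last_start i = i.
Proof. by case: i => [|i] //= ->. Qed.

Lemma last_start_max i j : starts j -> (j <= i)%N -> (j <= last_start i)%N.
Proof.
elim: i => [|i IHi] sj; first by rewrite leqn0 => /eqP e; rewrite e startsN0 in sj.
rewrite leq_eqVlt => /orP[/eqP <-|]; first by rewrite last_start_self.
rewrite ltnS => /(IHi sj) h /=; case: ifP => // _; rewrite (leq_trans h) // leqW //.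
exact: last_start_le.
Qed.

Lemma last_startP i : last_start i = 0%N \/ starts (last_start i).
Proof. by elim: i => [|i IHi] /=; [left|case: ifP => // h; right]. Qed.

Lemma last_start_const i k : (forall j, (i < j)%N -> (j <= i + k)%N -> ~~ starts j) ->
  last_start (i + k) = last_start i.
Proof.
elim: k => [|k IHk] h; first by rewrite addn0.
rewrite addnS /= (negbTE (h _ _ _)) ?addnS ?ltnS ?leq_addr //.
by apply: IHk => j ij jk; apply: h => //; lia.
Qed.

Lemma starts_gap i j : starts i -> starts j -> (i < j)%N -> (i + l < j)%N.
Proof.
move=> /and3P[_ gi _] /and3P[lj _ /hasPn h] ij; rewrite ltnNge; apply/negP => ji.
by have := h i; rewrite mem_iota gi => /(_ _)/negP; apply; lia.
Qed.

Lemma markers_starts i : starts i -> markers i.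
Proof.
move=> si; rewrite /markers last_start_self // subnn mod0n eqxx /=.
apply/hasPn => j; rewrite mem_iota => /andP[ij jl]; apply/negP => sj.
by have := starts_gap si sj ij; lia.
Qed.

Lemma markers_marker_set : marker_set l (2 * l) markers.
Proof.
split.
- rewrite /markers /= mod0n /=; apply/hasPn => j; rewrite mem_iota => jl.
  by rewrite /starts; apply/negP => /and3P[h _ _]; lia.
- move=> i.
  pose s := last_start i; have si : (s <= i)%N := last_start_le i.
  (* The first point after [i] of the progression of step [l] issued from the last start. It is a
     marker unless a start occurs before it or less than [l] after it; such a start is itself a
     marker, at distance less than [2 * l] from [i]. *)
  pose j0 := (s + l * ((i - s) %/ l).+1)%N.
  have d := divn_eq (i - s) l; have m := ltn_pmod (i - s) l0.
  have j0i : (i < j0)%N && (j0 <= i + l)%N by rewrite /j0 mulnS mulnC; lia.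
  have [/hasP[x]|/hasPn h] := boolP (has starts (iota i.+1 (j0 + l.-1 - i))).
    rewrite mem_iota => hx sx; exists x; split; [lia|lia|exact: markers_starts].
  exists j0; split; [lia|lia|].
  have nos j : (i < j)%N -> (j <= j0 + l.-1)%N -> ~~ starts j.
    by move=> ij jj; apply: h; rewrite mem_iota; lia.
  have e : last_start j0 = s.
    have -> : j0 = (i + (j0 - i))%N by lia.
    by rewrite last_start_const // => j ij jj; apply: nos => //; lia.
  rewrite /markers e /j0 addKn modnMr eqxx /=.
  by apply/hasPn => j; rewrite mem_iota => hj; apply: nos; lia.
- move=> i j /andP[mi /hasPn ni] /andP[mj _] ij.
  have li := last_start_le i; have lj := last_start_le j.
  have [/eqP e|ne] := boolP (last_start j == last_start i).
    move: mi mj; rewrite e -/(dvdn l _) -/(dvdn l _) => mi mj.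
    have := dvdn_sub mj mi => /dvdnP[k hk].
    by case: k hk => [|k]; [lia|rewrite mulSn; lia].
  have mono : (last_start i <= last_start j)%N.
    have [->//|si] := last_startP i.
    by apply: last_start_max => //; exact: leq_trans li (ltnW ij).
  have ij' : (i < last_start j)%N.
    rewrite ltnNge; apply: contra ne => h; rewrite eqn_leq mono andbT.
    by have [->//|/last_start_max/(_ h)] := last_startP j.
  have [z|sj] := last_startP j; first by rewrite z in ij'.
  rewrite leqNgt; apply/negP => jl.
  by have := ni (last_start j); rewrite mem_iota sj => /(_ _)/negP; apply => //; lia.
Qed.

Lemma last_start_eq i s : starts s -> (s <= i)%N ->
  (forall k, (s < k)%N -> (k <= i)%N -> ~~ starts k) -> last_start i = s.
Proof.
move=> ss si h; have ls := last_start_le i.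
apply/eqP; rewrite eqn_leq (last_start_max ss si) andbT leqNgt; apply/negP => sl.
have [z|sl'] := last_startP i; first by rewrite z in sl.
by move/negP: (h _ sl ls).
Qed.

(** A marker depends on the last start, which may lie arbitrarily far back. Dropping the markers
    without a start in the last [r] steps leaves a local rule, and by hypothesis this affects few
    positions. *)
Lemma coded_markers :
  (forall e : R, 0 < e -> exists r, rare e (fun i => ~~ has starts (iota (i - r) r.+1))) ->
  coded R markers starts.
Proof.
move=> hr; apply: coded_limit => e e0; have [r rr] := hr e e0.
exists (fun i => has starts (iota (i - r) r.+1) && markers i); last first.
  by apply: rare_sub (lexx _) _ rr => i; case: (has _ _) => //=; rewrite eqxx.
apply: (@coded_local _ _ _ _ _ (r + l)%N) => i j ri rj h.
have up k : (k <= r + l)%N -> starts (i + k) = starts (j + k).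
  move=> kr; have := h (r + l + k)%N (ltac:(lia)).
  by have -> : (i - (r + l) + (r + l + k) = i + k)%N; [lia|];
     have -> : (j - (r + l) + (r + l + k) = j + k)%N; [lia|].
have down k : (k <= r + l)%N -> starts (i - k) = starts (j - k).
  move=> kr; have := h (r + l - k)%N (ltac:(lia)).
  by have -> : (i - (r + l) + (r + l - k) = i - k)%N; [lia|];
     have -> : (j - (r + l) + (r + l - k) = j - k)%N; [lia|].
have hasE a : (r + l <= a)%N -> has starts (iota (a - r) r.+1) = has (fun k => starts (a - k)) (iota 0 r.+1).
  move=> ra; apply/hasP/hasP => -[k]; rewrite mem_iota => hk sk.
    by exists (a - k)%N; [rewrite mem_iota; lia|have -> : (a - (a - k) = k)%N by lia].
  by exists (a - k)%N => //; rewrite mem_iota; lia.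
have hs : has starts (iota (i - r) r.+1) = has starts (iota (j - r) r.+1).
  by rewrite !hasE //; apply: eq_in_has => k; rewrite mem_iota => hk; apply: down; lia.
rewrite hs; have [|//] := boolP (has starts (iota (j - r) r.+1)).
move=> hj; have := hj; rewrite -hs => /hasP[x]; rewrite mem_iota => hx sx /=.
have l1 := last_start_max sx (_ : x <= i)%N; have l2 := last_start_le i.
have {}l1 := l1 (ltac:(lia)).
pose k := (i - last_start i)%N; have kr : (k <= r)%N by rewrite /k; lia.
have si : starts (i - k).
  have -> : (i - k = last_start i)%N by rewrite /k; lia.
  have [z|//] := last_startP i.
  by move: l1; rewrite z leqn0 => /eqP x0; rewrite x0 startsN0 in sx.
have ej : last_start j = (j - k)%N.
  apply: last_start_eq; [by rewrite -down //; lia|lia|] => q hq qj.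
  have -> : q = (j - (j - q))%N by lia.
  rewrite -down; last by lia.
  apply/negP => sq; have := last_start_max sq (_ : (i - (j - q)) <= i)%N; rewrite leq_subr => /(_ isT).
  by rewrite /k in hq; lia.
rewrite /markers ej; have -> : (j - (j - k) = i - last_start i)%N by rewrite /k; lia.
congr (_ && ~~ _); apply/hasP/hasP => -[q]; rewrite mem_iota => hq sq.
  exists (j + (q - i))%N; first by rewrite mem_iota; lia.
  by rewrite -up; [have -> : (i + (q - i) = q)%N by lia|lia].
exists (i + (q - j))%N; first by rewrite mem_iota; lia.
by rewrite up; [have -> : (j + (q - j) = q)%N by lia|lia].
Qed.

(* Going down from an occurrence of [g] without meeting a start, one never
   leaves a gap of length [l]. *)
Lemma no_starts_dense i b x : (l <= i)%N -> g b -> (i <= b)%N ->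
  (forall k, (i <= k)%N -> (k <= b)%N -> ~~ starts k) ->
  (i <= x)%N -> (x <= b)%N -> has g (iota (x - l) l).
Proof.
move=> li gb ib ns ix xb.
have step k : (i <= k)%N -> (k <= b)%N -> g k -> has g (iota (k - l) l).
  move=> ik kb gk; have := ns k ik kb; rewrite /starts gk (leq_trans li) //= negbK //.
elim/ltn_ind: {x}(b - x)%N {-2}x (erefl (b - x)%N) ix xb => n IHn x nx ix xb.
have [xb'|bx] := ltnP x b; last by have -> : x = b by [lia]; exact: step.
have /hasP[k] := IHn (b - x.+1)%N (ltac:(lia)) x.+1 erefl (ltac:(lia)) xb'.
rewrite mem_iota => hk gk.
have [kx|kx] := ltnP k x; first by apply/hasP; exists k => //; rewrite mem_iota; lia.
by have ek : k = x; [lia|rewrite ek in gk; exact: step].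
Qed.

Lemma dense_cnt i L : (forall x, (i <= x)%N -> (x <= i + l * L)%N -> (l <= x)%N -> has g (iota (x - l) l)) ->
  (L <= cnt (fun j => g (i + j)%N) (l * L))%N.
Proof.
elim: L => [//|L IHL] h; rewrite mulnS addnC cnt_cat -addn1 leq_add //.
  by apply: IHL => x ix xi; apply: h => //; rewrite mulnS; lia.
have /hasP[k] := h (i + l * L.+1)%N (leq_addr _ _) (leqnn _) (ltac:(rewrite mulnS; lia)).
rewrite mem_iota => hk gk.
have kl : (k - (i + l * L) < l)%N by rewrite mulnS in hk; lia.
rewrite cntE; apply/card_gt0P; exists (Ordinal kl); rewrite inE /=.
by have -> : (i + (l * L + (k - (i + l * L))) = k)%N by rewrite mulnS in hk; lia.
Qed.

(** Without a start in this range, one could descend from the occurrence in the second window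
    without meeting a gap of length [l], and the first window would hold [L] occurrences. *)
Lemma starts_syndetic i L : (l <= i)%N -> (cnt (fun j => g (i + j)%N) (l * L) < L)%N ->
  (0 < cnt (fun j => g (i + l * L + j)%N) (l * L))%N ->
  has starts (iota i (2 * (l * L))).
Proof.
move=> li few; rewrite cntE => /card_gt0P[k]; rewrite inE => gb.
apply: contraT => /hasPn ns; have kl := ltn_ord k.
suff : (L <= cnt (fun j => g (i + j)%N) (l * L))%N by rewrite leqNgt few.
apply: dense_cnt => x ix xi lx.
apply: (@no_starts_dense i (i + l * L + k)%N x li gb); [lia| |exact: ix|lia].
by move=> q iq qb; apply: ns; rewrite mem_iota; lia.
Qed.

(** A Markov argument. The density of [g] is so small that a window of length [l * L] should hold
    well under [L] occurrences, and it is bounded below because [g] is not null. Windows with at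
    least [L] occurrences, or with none, therefore deviate by at least [c * (l * L)], so their
    density is at most [d / c], hence at most [e / 8]. *)
Lemma starts_density (e0 : R) : e0 = (4 * l.+1)%:R^-1 ->
  erg_avg R g -> rare e0 g -> ~ null R g ->
  forall e : R, 0 < e -> exists r, rare e (fun i => ~~ has starts (iota (i - r) r.+1)).
Proof.
move=> e0E eg rg ng e ep.
have l4 : 0 < (4 * l.+1)%:R :> R by rewrite ltr0n.
have e0p : 0 < e0 by rewrite e0E invr_gt0.
have [eta etap neta] : exists2 eta : R, 0 < eta & ~ rare eta g.
  by apply: contrapT => h; apply: ng => eta eta0; apply: contrapT => h'; apply: h; exists eta.
have [N1 h1] := not_rare_lower etap eg neta; have [N2 h2] := rg.
pose c := Num.min (eta / 8%:R) (e0 / 4%:R).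
have c0 : 0 < c by rewrite lt_min !divr_gt0.
have c1 : c <= eta / 8%:R by rewrite ge_min lexx.
have c2 : c <= e0 / 4%:R by rewrite ge_min lexx orbT.
pose d := c * Num.min 1 (e / 8%:R).
have m0 : 0 < Num.min 1 (e / 8%:R) by rewrite lt_min ltr01 divr_gt0.
have d0 : 0 < d by rewrite mulr_gt0.
have dc : d <= c by apply: ler_piMr; [exact: ltW | rewrite ge_min lexx].
have de : d <= c * (e / 8%:R) by apply: ler_wpM2l; [exact: ltW|rewrite ge_min lexx orbT].
have [r [L [N [/andP[r0 r1] L0 h]]]] := erg_avg_mult d0 l0 eg.
have lL0 : (0 < l * L)%N by rewrite muln_gt0 l0.
have lL0' : 0 < (l * L)%:R :> R by rewrite ltr0n.
have [N3 h3] := @archi_le R c (l * L)%:R c0.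
have [rlo rhi] : eta / 4%:R <= r /\ r <= e0 * (3%:R / 2).
  have [n [nN nN1 nN2 nN3 n0']] := common_bound N N1 N2 N3.
  have n0 : 0 < n%:R :> R by rewrite ltr0n.
  have H1 := h1 n nN1; have H2 := h2 n nN2; have H3 := h3 n nN3.
  have := window_freq lL0 (h n nN).
  have dn : d * n%:R <= c * n%:R by rewrite ler_wpM2r.
  have c1n : c * n%:R <= eta / 8%:R * n%:R by rewrite ler_wpM2r.
  have c2n : c * n%:R <= e0 / 4%:R * n%:R by rewrite ler_wpM2r.
  rewrite ler_norml => /andP[? ?].
  by split; rewrite -(ler_pM2r n0); lra.
(* In spite of the name, [few] selects windows with too many occurrences; [none] selects windows
   without any. These are the two ways in which [starts_syndetic] can fail to apply. *)
pose few i := (L <= cnt (fun j => g (i + j)%N) (l * L))%N.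
pose none i := cnt (fun j => g (i + j)%N) (l * L) == 0%N.
pose D i := `|(cnt (fun j => g (i + j)%N) (l * L))%:R - r * (l * L)%:R|.
have eL : e0 * (4%:R * (l * L)%:R) <= L%:R.
  by rewrite -natrM e0E mulrC ler_pdivrMr // -natrM ler_nat mulnA (mulnC _ L) leq_mul2l leq_mul2l leqnSn !orbT.
have cD i : c * (l * L)%:R * (few i || none i)%:R <= D i.
  have [/orP fn|_] := boolP (few i || none i); last by rewrite mulr0n mulr0 normr_ge0.
  case: fn => [hL|/eqP hL].
    rewrite mulr1 /D; apply: le_trans (ler_norm _).
    rewrite /few -(ler_nat R) in hL.
    have : c * (l * L)%:R <= e0 / 4%:R * (l * L)%:R by rewrite ler_wpM2r.
    have : r * (l * L)%:R <= e0 * (3%:R / 2) * (l * L)%:R by rewrite ler_wpM2r.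
    have : 0 <= L%:R :> R by [].
    move: hL eL; set u := (cnt _ _)%:R; set v := (l * L)%:R; set w := L%:R; move=> *; lra.
  rewrite mulr1 /D hL sub0r normrN; apply: le_trans (ler_norm _).
  by rewrite ler_wpM2r //; apply: le_trans c1 (le_trans _ rlo); lra.
have rare1 : rare (e / 8%:R) (fun i => few i || none i).
  exists N => n /h hn.
  have : c * (l * L)%:R * (cnt (fun i => few i || none i) n)%:R <= d * (l * L)%:R * n%:R.
    apply: le_trans hn; rewrite /cnt natr_sum mulr_sumr; apply: ler_sum => i _; exact: cD.
  have : d * (l * L)%:R * n%:R <= c * (e / 8%:R) * (l * L)%:R * n%:R.
    by rewrite ler_wpM2r // ler_wpM2r.
  move=> h4 h5; rewrite -(ler_pM2l (mulr_gt0 c0 lL0')).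
  by apply: (le_trans h5); apply: (le_trans h4); rewrite le_eqVlt; apply/orP; left; apply/eqP; ring.
exists (2 * (l * L))%N.
apply: (@rare_unshift R (e / 4%:R * 2) _ _ (l + 2 * (l * L))%N); first lra.
have r1' : rare (e / 4%:R) (fun i => few (i + l)%N || none (i + l)%N).
  by apply: (rare_shift (f := fun i => few i || none i)) rare1; lra.
have r2' : rare (e / 4%:R) (fun i => few (i + (l + l * L))%N || none (i + (l + l * L))%N).
  by apply: (rare_shift (f := fun i => few i || none i)) rare1; lra.
apply: rare_sub (rare_or r1' r2'); first lra.
move=> i; apply: contraR; rewrite !negb_or => /andP[/andP[f1 _] /andP[_ n2]].
have /hasP[k] := @starts_syndetic (i + l)%N L (leq_addl _ _) (ltac:(rewrite ltnNge; exact: f1))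
   (ltac:(rewrite lt0n -addnA; exact: n2)).
rewrite mem_iota => hk sk; apply/hasP; exists k => //; rewrite mem_iota.
by move: hk; clear; move: (l * L)%N => q; lia.
Qed.

End Rare.

Lemma has_markers_rare (K : finType) (y : nat -> K) : erg_seq R y ->
  (forall e : R, 0 < e -> exists w, rare e (occurs y w) /\ ~ null R (occurs y w)) ->
  has_markers y.
Proof.
move=> ey hy l0.
pose l := l0.+1.
have e0 : 0 < (4 * l.+1)%:R^-1 :> R by rewrite invr_gt0 ltr0n.
have [w [rw nw]] := hy _ e0.
have ew : erg_avg R (occurs y w) := ey (size w) (fun v => v == w).
exists (2 * l)%N, (markers l (occurs y w)); split; last first.
  have [m0 m1 m2] := @markers_marker_set l (occurs y w) isT; split => // i j mi mj ij.
  by have := m2 i j mi mj ij; rewrite /l; lia.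
have st := starts_density (isT : (0 < l)%N) erefl ew rw nw.
apply: coded_trans (coded_markers (isT : (0 < l)%N) st) _.
apply: (@coded_local _ _ _ _ _ (l + size w)%N) => i j ri rj h.
have up k : (k <= size w)%N -> y (i + k)%N = y (j + k)%N.
  move=> kr; have := h (l + size w + k)%N (ltac:(lia)).
  by have -> : (i - (l + size w) + (l + size w + k) = i + k)%N; [lia|];
     have -> : (j - (l + size w) + (l + size w + k) = j + k)%N; [lia|].
have occ k : (k <= l)%N -> occurs y w (i - k)%N = occurs y w (j - k)%N.
  move=> kl; rewrite /occurs; congr (_ == w); apply: eq_blk => q qw.
  have := h (l + size w - k + q)%N (ltac:(lia)).
  by have -> : (i - (l + size w) + (l + size w - k + q) = i - k + q)%N; [lia|];
     have -> : (j - (l + size w) + (l + size w - k + q) = j - k + q)%N; [lia|].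
rewrite /starts; have -> : (l <= i)%N = (l <= j)%N by rewrite !(leq_trans (leq_addr (size w) l)).
have := occ 0%N isT; rewrite !subn0 => ->; congr [&& _, _ & ~~ _].
apply/hasP/hasP => -[k]; rewrite mem_iota => hk.
  have -> : (k = i - (i - k))%N by lia.
  by rewrite occ; [exists (j - (i - k))%N => //; rewrite mem_iota; lia|lia].
have -> : (k = j - (j - k))%N by lia.
by rewrite -occ; [exists (i - (j - k))%N => //; rewrite mem_iota; lia|lia].
Qed.

End Markers.

(** * Asymptotically periodic sequences and the odometer *)

Section Null.
Variable R : realType.
Implicit Types (f g : nat -> bool).

Lemma null_sub f g : (forall i, f i -> g i) -> null R g -> null R f.
Proof. by move=> fg ng e e0; apply: rare_sub (lexx _) fg (ng e e0). Qed.

Lemma null_shift f k : null R f -> null R (fun i => f (i + k)%N).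
Proof.
move=> nf e e0; apply: (@rare_shift R (e / 2)); first lra.
by apply: nf; rewrite divr_gt0.
Qed.

Lemma null_unshift f k : null R (fun i => f (i + k)%N) -> null R f.
Proof.
move=> nf e e0; apply: (@rare_unshift R (e / 2) _ _ k); first lra.
by apply: nf; rewrite divr_gt0.
Qed.

Lemma null_has (F : nat -> nat -> bool) m : (forall k, (k < m)%N -> null R (F k)) ->
  null R (fun i => has (fun k => F k i) (iota 0 m)).
Proof.
move=> nF e e0; case: m nF => [|m] nF; first by exists 0%N => n _; rewrite /cnt big1 // mulr_ge0 // ltW.
have m0 : 0 < m.+1%:R :> R by rewrite ltr0n.
have -> : e = e / m.+1%:R *+ m.+1 by rewrite -[RHS]mulr_natr divfK // lt0r_neq0.
by apply: rare_has => k km; apply: nF => //; rewrite divr_gt0.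
Qed.

Lemma null_false : null R (fun=> false).
Proof. by move=> e e0; exists 0%N => n _; rewrite /cnt big1 // mulr_ge0 // ltW. Qed.

Lemma null_exists (T : finType) (F : T -> nat -> bool) : (forall t, null R (F t)) ->
  null R (fun i => [exists t, F t i]).
Proof.
move=> nF.
apply: (@null_sub _ (fun i => has (fun k => if insub k is Some j then F (enum_val (j : 'I_#|T|)) i else false) (iota 0 #|T|))).
  move=> i /existsP[t ti]; apply/hasP; exists (val (enum_rank t)); first by rewrite mem_iota /= add0n ltn_ord.
  by rewrite valK enum_rankK.
apply: null_has => k kT; rewrite insubT; exact: nF.
Qed.

End Null.

Section Periodic.
Variables (R : realType) (K : finType) (y : nat -> K).
Hypothesis ey : erg_seq R y.

(** Words that are not null have lower density at least [e / 2], so at most [P] words of a given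
    length are of this kind, and two among [P + 1] successive windows coincide. The resulting local
    period [b - a] varies with the position, but it is at most [P] and so always divides the
    factorial of [P]. *)
Lemma periodic_of_lower_bound (e : R) : 0 < e ->
  (forall w, rare e (occurs y w) -> null R (occurs y w)) ->
  exists2 p, (0 < p)%N & null R (fun i => y i != y (i + p)%N).
Proof.
move=> e0 h.
have [P hP] : exists P, 2 < e * P.+1%:R.
  have [N hN] := @archi_le R e 3%:R e0; exists N; have := hN N.+1 (leqnSn N); lra.
(* Coinciding windows of length [m] are long enough to carry the local period from [i + P] to
   [i + P + D] in steps of [b - a]. *)
pose D := P`!; pose m := (D + P + 1)%N.
have D0 : (0 < D)%N by exact: fact_gt0.
exists D => //.
pose isnull (w : m.-tuple K) : bool := `[< null R (occurs y w) >].
pose bad i := [exists w : m.-tuple K, isnull w && occurs y w i].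
have nbad : null R bad.
  apply: null_exists => w; case: (boolP (isnull w)) => [/asboolP h'|_] /=; first by [].
  exact: null_false.
have nbads : null R (fun i => has (fun k => bad (i + k)%N) (iota 0 P.+1)).
  by apply: null_has => k _; exact: null_shift.
apply: (@null_unshift R _ P).
apply: null_sub nbads => i; apply: contraR => /hasPn good.
have good' k : (k <= P)%N -> ~ null R (occurs y (blk y (i + k) m)).
  have kI : k \in iota 0 P.+1 -> ~ bad (i + k)%N by move=> /good /negP.
  move=> kP nk; apply: kI; first by rewrite mem_iota; lia.
  apply/existsP; exists (Tuple (introT eqP (size_blk y (i + k) m))).
  by apply/andP; split; [exact/asboolP|rewrite /occurs /= size_blk].
have [a [b [ab bP eab]]] : exists a b, [/\ (a < b)%N, (b <= P)%N & blk y (i + a) m = blk y (i + b) m].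
  apply: contrapT => nab.
  have low k : exists N, (k <= P)%N -> forall n, (N <= n)%N ->
     e / 2 * n%:R <= (cnt (occurs y (blk y (i + k) m)) n)%:R.
    have [kP|] := leqP k P; last by exists 0%N.
    have [|N hN] := @not_rare_lower R (occurs y (blk y (i + k) m)) e e0 (ey (size (blk y (i + k) m)) (fun v => v == _)).
      by move=> /h; exact: good'.
    by exists N.
  have [N hN] := choice low.
  pose n := (\sum_(k < P.+1) N k + 1)%N.
  have Nn k : (k <= P)%N -> (N k <= n)%N.
    move=> kP; have kP' : (k < P.+1)%N by [].
    by rewrite /n (bigD1 (Ordinal kP')) //=; lia.
  have sle : (\sum_(k < P.+1) cnt (occurs y (blk y (i + k) m)) n <= n)%N.
    rewrite /cnt exchange_big /=.
    apply: (@leq_trans (\sum_(j < n) 1)%N); last by rewrite sum1_card card_ord.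
    apply: leq_sum => j _.
    have [k0 k0E|none] := pickP (fun k : 'I_P.+1 => occurs y (blk y (i + k) m) j); last first.
      by rewrite big1 // => k _; rewrite none.
    rewrite (bigD1 k0) //= k0E big1 // => k kk0; case: (boolP (occurs _ _ _)) => // kE; exfalso.
    move: k0E kE; rewrite /occurs !size_blk => /eqP e1 /eqP e2; apply: nab.
    move: kk0; rewrite -(inj_eq val_inj) neq_ltn => /orP[lt|lt].
      by exists k, k0; split => //; [rewrite -ltnS|rewrite -e1 -e2].
    by exists k0, k; split => //; [rewrite -ltnS|rewrite -e1 -e2].
  have : (P.+1)%:R * (e / 2 * n%:R) <= n%:R.
    rewrite -(ler_nat R) natr_sum in sle; apply: le_trans sle.
    rewrite mulr_natl -[X in _ *+ X]card_ord -sumr_const; apply: ler_sum => k _.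
    by apply: hN; [rewrite -ltnS|apply: Nn; rewrite -ltnS].
  have n0 : 0 < n%:R :> R by rewrite ltr0n /n addn1.
  rewrite mulrA -[leRHS]mul1r ler_pM2r //; lra.
have per k : (a <= k)%N -> (k < a + m)%N -> y (i + k)%N = y (i + k + (b - a))%N.
  move=> ak km; have := blk_inj (k := (k - a)%N) eab (ltac:(lia)).
  have -> : (i + a + (k - a) = i + k)%N by lia.
  by have -> : (i + b + (k - a) = i + k + (b - a))%N by lia.
have /dvdnP[q qE] : (b - a %| D)%N by apply: dvdn_fact; lia.
have it t : (t <= q)%N -> y (i + P)%N = y (i + P + t * (b - a))%N.
  elim: t => [|t IHt] tq; first by rewrite mul0n addn0.
  rewrite (IHt (ltnW tq)) mulSn -addnA per; [congr y; lia|lia|].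
  have : (t * (b - a) < D)%N by rewrite qE ltn_mul2r tq andbT; lia.
  by rewrite /m; lia.
by apply/eqP; have := it q (leqnn q); rewrite -qE.
Qed.


Variables (p : nat).
Hypotheses (p0 : (0 < p)%N) (yp : null R (fun i => y i != y (i + p)%N)).

Lemma periodic_window r : null R (fun i => has (fun k => y (i + k)%N != y (i + k + p)%N) (iota 0 r)).
Proof. by apply: null_has => k _; exact: (null_shift k yp). Qed.

Lemma periodic_blk i m r k : ~~ has (fun k => y (i + k)%N != y (i + k + p)%N) (iota 0 (m + r)) ->
  (k < m)%N -> blk y (i + k) r = blk y (i + k %% p) r.
Proof.
move=> /hasPn h; elim/ltn_ind: k => k IHk km.
have [kp|pk] := ltnP k p; first by rewrite modn_small.
rewrite -{2}(subnK pk) modnDr -IHk; [|lia|lia].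
apply: eq_blk => q qr; have := h (k - p + q)%N; rewrite mem_iota /= => /(_ (ltac:(lia))).
rewrite negbK => /eqP; rewrite !addnA => ->; congr y; lia.
Qed.

(* Chinese remainder: along [p * Q] steps the pair of residues takes every value once. *)
Lemma sum_coprime (Q : nat) (F : nat -> nat -> nat) i : coprime p Q -> (0 < Q)%N ->
  (\sum_(j < p * Q) F (j %% p) ((i + j) %% Q) = \sum_(b < Q) \sum_(a < p) F a b)%N.
Proof.
move=> cpQ Q0.
pose h (j : 'I_(p * Q)) : 'I_Q * 'I_p :=
  (Ordinal (ltn_pmod (i + j) Q0), Ordinal (ltn_pmod j p0)).
have hinj : injective h.
  move=> j k [/eqP jk1 /eqP jk2]; apply: val_inj.
  rewrite /= -(modn_small (ltn_ord j)) -(modn_small (ltn_ord k)); apply/eqP.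
  rewrite (chinese_remainder cpQ) jk2 /=.
  by move: jk1; rewrite eqn_modDl.
have hbij : bijective h.
  apply: inj_card_bij hinj _.
  by rewrite card_prod !card_ord mulnC.
rewrite pair_big /= (reindex h) //=.
exact: onW_bij.
Qed.

Lemma cnt_mod (f : nat -> bool) L :
  cnt (fun j => f (j %% p)%N) (p * L) = (L * cnt f p)%N.
Proof.
elim: L => [|L IHL]; first by rewrite muln0 cnt0.
rewrite mulnS cnt_cat mulSn; congr (_ + _)%N.
  by apply: eq_cnt => j jp; rewrite modn_small.
by rewrite -IHL; apply: eq_cnt => j _; rewrite modnDl.
Qed.

(** Pairing with residues modulo a coprime [Q] preserves the averaging property. Where the period
    [p] holds, a window of length [p * Q] meets every pair of residues once, so its count is the sum
    over [b] of the counts of [G _ b] in one period. Each of these is controlled by windows of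
    length [p * L b], and the final frequency is the mean of the [rb b]. *)
Lemma periodic_erg_avg (Q r : nat) (G : seq K -> nat -> bool) : coprime p Q -> (0 < Q)%N ->
  erg_avg R (fun i => G (blk y i r) (i %% Q)%N).
Proof.
move=> cpQ Q0 d d0.
have d2 : 0 < d / 2 by rewrite divr_gt0.
have hb (b : nat) : exists rL : R * nat * nat, let: (rb, L, N) := rL in
    [/\ 0 <= rb <= 1, (0 < L)%N & forall n, (N <= n)%N ->
      window_sum (fun i => G (blk y i r) b) (p * L) n rb <= d / 2 * (p * L)%:R * n%:R].
  have [rb [L [N H]]] := erg_avg_mult d2 p0 (ey r (fun w => G w b)).
  by exists (rb, L, N).
have [f hf] := choice hb.
pose rb b := (f b).1.1; pose L b := (f b).1.2; pose N b := (f b).2.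
have {}hf b : [/\ 0 <= rb b <= 1, (0 < L b)%N & forall n, (N b <= n)%N ->
      window_sum (fun i => G (blk y i r) b) (p * L b) n (rb b) <= d / 2 * (p * L b)%:R * n%:R].
  by have := hf b; rewrite /rb /L /N; case: (f b) => [[]].
pose m := (p * Q + \sum_(b < Q) p * L b)%N.
have mL b : (b < Q)%N -> (p * L b <= m)%N.
  by move=> bQ; rewrite /m (bigD1 (Ordinal bQ)) //=; apply: leq_trans (leq_addl _ _); exact: leq_addr.
pose bad i := has (fun k => y (i + k)%N != y (i + k + p)%N) (iota 0 (m + r)).
have [N0 hN0] := @periodic_window (m + r) _ d2.
pose rho := (\sum_(b < Q) rb b) / Q%:R.
have Q0' : 0 < Q%:R :> R by rewrite ltr0n.
pose n0 := (N0 + \sum_(b < Q) N b)%N.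
have nN b : (b < Q)%N -> (N b <= n0)%N.
  by move=> bQ; rewrite /n0 (bigD1 (Ordinal bQ)) //=; apply: leq_trans (leq_addl _ _); exact: leq_addr.
have rho01 : 0 <= rho <= 1.
  rewrite /rho divr_ge0 ?ler0n ?sumr_ge0 //=; last by move=> b _; have [/andP[]] := hf b.
  rewrite ler_pdivrMr // mul1r -[leRHS](_ : \sum_(b < Q) 1 = _); last by rewrite sumr_const card_ord.
  by apply: ler_sum => b _; have [/andP[]] := hf b.
exists rho, (p * Q)%N, n0; split => //; first by rewrite muln_gt0 p0.
move=> n nn.
pose D b i := `|(cnt (fun j => G (blk y (i + j) r) b) (p * L b))%:R - rb b * (p * L b)%:R|.
have P i : `|(cnt (fun j => G (blk y (i + j) r) ((i + j) %% Q)%N) (p * Q))%:R - rho * (p * Q)%:R|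
    <= \sum_(b < Q) (L b)%:R^-1 * D b i + (p * Q)%:R * (bad i)%:R.
  have s0 : 0 <= \sum_(b < Q) (L b)%:R^-1 * D b i.
    by apply: sumr_ge0 => b _; rewrite mulr_ge0 ?invr_ge0 ?ler0n ?normr_ge0.
  have [bi|nbi] := boolP (bad i).
    rewrite mulr1n mulr1 -[leLHS]add0r; apply: lerD => //.
    have := cnt_le (fun j => G (blk y (i + j) r) ((i + j) %% Q)%N) (p * Q).
    rewrite -(ler_nat R) => c1; case/andP: rho01 => r0 r1.
    have : 0 <= rho * (p * Q)%:R by rewrite mulr_ge0.
    have : rho * (p * Q)%:R <= (p * Q)%:R by rewrite ler_piMl.
    have : 0 <= (cnt (fun j => G (blk y (i + j) r) ((i + j) %% Q)%N) (p * Q))%:R :> R by [].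
    by rewrite ler_norml => *; apply/andP; split; lra.
  rewrite mulr0n mulr0 addr0.
  have per k : (k < m)%N -> blk y (i + k) r = blk y (i + k %% p) r.
    by apply: periodic_blk.
  pose s b := cnt (fun a => G (blk y (i + a) r) b) p.
  have -> : (cnt (fun j => G (blk y (i + j) r) ((i + j) %% Q)%N) (p * Q))%:R = \sum_(b < Q) (s b)%:R :> R.
    rewrite -natr_sum; congr (_%:R).
    rewrite -(@sum_coprime Q (fun a b => G (blk y (i + a) r) b : nat) i cpQ Q0).
    apply: eq_bigr => j _; rewrite per // (leq_trans (ltn_ord j)) //.
    exact: leq_addr.
  have De b : (b < Q)%N -> (L b)%:R^-1 * D b i = `|(s b)%:R - rb b * p%:R|.
    move=> bQ; have [_ Lb _] := hf b.
    have Lb' : 0 < (L b)%:R :> R by rewrite ltr0n.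
    rewrite /D (@eq_cnt _ (fun j => G (blk y (i + j %% p) r) b)); last first.
      by move=> j jp; rewrite per // (leq_trans jp) // mL.
    rewrite (cnt_mod (fun a => G (blk y (i + a) r) b)) -/(s b) !natrM.
    rewrite -[X in X * `|_|]ger0_norm ?invr_ge0 ?ler0n // -normrM; congr `|_|.
    by field; rewrite lt0r_neq0.
  have -> : \sum_(b < Q) (s b)%:R - rho * (p * Q)%:R = \sum_(b < Q) ((s b)%:R - rb b * p%:R).
    rewrite sumrB -mulr_suml /rho natrM; congr (_ - _); field; by rewrite lt0r_neq0.
  apply: (le_trans (ler_norm_sum _ _ _)); rewrite le_eqVlt; apply/orP; left; apply/eqP.
  by apply: eq_bigr => b _; rewrite De.
apply: (@le_trans _ _ (\sum_(i < n) (\sum_(b < Q) (L b)%:R^-1 * D b i + (p * Q)%:R * (bad i)%:R))).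
  by apply: ler_sum => i _; exact: P.
rewrite big_split /= exchange_big /= -mulr_sumr -natr_sum -/(cnt bad n).
have h1 : \sum_(b < Q) \sum_(i < n) (L b)%:R^-1 * D b i <= Q%:R * (d / 2 * p%:R * n%:R).
  rewrite [leRHS](_ : _ = \sum_(b < Q) (d / 2 * p%:R * n%:R)); last by rewrite sumr_const card_ord mulr_natl.
  apply: ler_sum => b _; have [_ Lb hLb] := hf b.
  have Lb' : 0 < (L b)%:R :> R by rewrite ltr0n.
  rewrite -mulr_sumr mulrC ler_pdivrMr //.
  have /hLb := leq_trans (nN b (ltn_ord b)) nn.
  move=> H; apply: (le_trans H); rewrite natrM le_eqVlt; apply/orP; left; apply/eqP; ring.
have h2 := hN0 n (ltac:(rewrite /n0 in nn; lia)).
have : (p * Q)%:R * (cnt bad n)%:R <= (p * Q)%:R * (d / 2 * n%:R) by rewrite ler_wpM2l.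
rewrite natrM; lra.
Qed.

End Periodic.

Section MarkedExtension.
Variables (R : realType) (K : finType) (y : nat -> K).
Hypothesis ey : erg_seq R y.

Lemma logn_modn q k i : prime q -> ~~ (q ^ k %| i)%N -> logn q (i %% q ^ k) = logn q i.
Proof.
move=> qp nd.
have i0 : (0 < i)%N by case: i nd => //; rewrite dvdn0.
have m0 : (0 < i %% q ^ k)%N by rewrite lt0n; apply: contra nd.
have lk j : (0 < j)%N -> ~~ (q ^ k %| j)%N -> (logn q j < k)%N.
  by move=> j0; rewrite pfactor_dvdn // -ltnNge.
have md : ~~ (q ^ k %| i %% q ^ k)%N by rewrite /dvdn modn_mod.
apply/eqP; rewrite eqn_leq; apply/andP; split.
  rewrite -pfactor_dvdn // [X in (_ %| X)%N](divn_eq i (q ^ k)).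
  apply: dvdn_add; last exact: pfactor_dvdnn.
  by apply: dvdn_mull; apply: dvdn_exp2l; rewrite ltnW // lk.
rewrite -pfactor_dvdn //.
have : (q ^ logn q i %| i %/ q ^ k * q ^ k)%N.
  by apply: dvdn_mull; apply: dvdn_exp2l; rewrite ltnW // lk.
by move=> /dvdn_addr <-; rewrite -divn_eq pfactor_dvdnn.
Qed.

Lemma rare_dvdn (e : R) Q : (0 < Q)%N -> Q%:R^-1 < e -> rare e (fun i => Q %| i)%N.
Proof.
move=> Q0 Qe; have Q0' : 0 < Q%:R :> R by rewrite ltr0n.
have cE n : cnt (fun i => Q %| i)%N n = ((n + Q.-1) %/ Q)%N.
  elim: n => [|n IHn]; first by rewrite cnt0 add0n divn_small // prednK.
  rewrite cntS IHn addSn divnS // addnC; congr (_ + _)%N.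
  by rewrite -addnS prednK // dvdn_addl.
have [N hN] := @archi_le R (e - Q%:R^-1) 1 (ltac:(lra)).
exists N => n /hN; rewrite cE mulrBl => h.
have : (((n + Q.-1) %/ Q) * Q <= n + Q)%N by apply: (leq_trans (leq_trunc_div _ _)); lia.
rewrite -(ler_nat R) natrM natrD => h2.
have : ((n + Q.-1) %/ Q)%:R <= Q%:R^-1 * n%:R + 1 :> R.
  by rewrite -(ler_pM2r Q0') mulrDl mul1r mulrAC mulVf ?mul1r // lt0r_neq0.
lra.
Qed.

(* If some words have arbitrarily small nonzero density, their occurrences give
   markers in [y] itself. Otherwise [y] is [p]-periodic up to density zero, and
   the markers are the multiples of the powers of a prime [q > p]. *)
Lemma marked_extension : exists (S : Type) (z : nat -> S),
  [/\ erg_seq R z, has_markers R z & coded R y z].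
Proof.
case: (pselect (forall e : R, 0 < e -> exists w, rare e (occurs y w) /\ ~ null R (occurs y w))).
  move=> h; exists K, y; split => //; [exact: has_markers_rare|exact: coded_refl].
move=> /existsNP[e /not_implyP[e0 /forallNP ne]].
have [p p0 yp] : exists2 p, (0 < p)%N & null R (fun i => y i != y (i + p)%N).
  apply: (periodic_of_lower_bound ey e0) => w rw; apply: contrapT => nw.
  by apply: (ne w).
have [q pq qp] := prime_above p.
(* The [q]-adic valuation encodes the multiples of all powers of [q] at once. Off the multiples of
   [q ^ k], a set of small density, it depends only on [i] modulo [q ^ k], which is coprime to
   [p]. *)
pose z i := (y i, logn q i).
exists (K * nat)%type, z; split.
- move=> r phi; apply: erg_avg_limit => d d0.
  have [k hk] : exists k, r.+1%:R < d / 2 * (q ^ k)%:R.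
    have [k hk] := @archi_le R (d / 2) (r.+1%:R + 1) (ltac:(lra)); exists k.
    have : k%:R <= (q ^ k)%:R :> R by rewrite ler_nat ltnW // ltn_expl // prime_gt1.
    have := hk k (leqnn k); have : 0 < d / 2 by rewrite divr_gt0.
    move: (k%:R) ((q ^ k)%:R) => a b d2 h1 h2.
    have : d / 2 * a <= d / 2 * b by rewrite ler_pM2l. lra.
  have Qp : (0 < q ^ k)%N by rewrite expn_gt0 prime_gt0.
  pose z' i := (y i, logn q (i %% q ^ k)).
  exists (fun i => phi (blk z' i r)).
    have cop : coprime p (q ^ k).
      rewrite coprime_sym coprimeXl // prime_coprime //; apply/negP => /(dvdn_leq p0); rewrite leqNgt pq //.
    pose G (w : seq K) (a : nat) := phi (zip w [seq logn q ((a + j) %% q ^ k) | j <- iota 0 r]).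
    suff -> : (fun i => phi (blk z' i r)) = (fun i => G (blk y i r) (i %% q ^ k)%N) by exact: (periodic_erg_avg ey p0 yp r G cop Qp).
    apply/funext => i; congr phi.
    have -> : [seq logn q ((i %% q ^ k + j) %% q ^ k) | j <- iota 0 r] = blk (fun i => logn q (i %% q ^ k)) i r.
      by rewrite /blk -{2}(addn0 i) iotaDl -map_comp; apply: eq_map => j /=; rewrite modnDml.
    by rewrite /blk zip_map.
  have r1 : 0 < r.+1%:R :> R by rewrite ltr0n.
  have Qp' : 0 < (q ^ k)%:R :> R by rewrite ltr0n.
  have rQ : rare (d / 2 / r.+1%:R) (fun i => q ^ k %| i)%N.
    by apply: rare_dvdn => //; rewrite ltr_pdivlMr // ltr_pdivrMl // mulrC.
  apply: (@rare_sub _ (d / r.+1%:R *+ r) _ _ (fun i => has (fun j => q ^ k %| i + j)%N (iota 0 r))).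
  - rewrite -mulr_natr mulrAC ler_pdivrMr // ler_wpM2l ?ler_nat //; exact: ltW.
  - move=> i; apply: contraR => /hasPn nd; apply/eqP; congr phi; apply/eq_in_map => j.
    rewrite mem_iota => hj; rewrite /z /z' logn_modn //.
    have -> : j = (i + (j - i))%N by lia.
    by apply: nd; rewrite mem_iota; lia.
  apply: rare_has => j _; apply: rare_shift rQ.
  by rewrite ltr_pM2r ?invr_gt0 //; lra.
- move=> l; exists (q ^ l)%N, (fun i => q ^ l %| i)%N; split.
    (* Since [logn q 0] is 0, the valuation misses the marker at 0; a single position does not
       affect coding. *)
    apply: (@coded_ext _ _ _ _ (fun i => l <= logn q i)%N _ 1%N) => [i i0|].
      by rewrite pfactor_dvdn.
    exact: (@coded_map R _ _ (fun x => l <= x.2)%N z).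
  have Q0 : (0 < q ^ l)%N by rewrite expn_gt0 prime_gt0.
  split => [|i|i j /dvdnP[a ->] /dvdnP[b ->]]; first exact: dvdn0.
    exists (q ^ l * (i %/ q ^ l).+1)%N; split; last exact: dvdn_mulr.
      by rewrite mulnC; exact: ltn_ceil.
    by rewrite mulnS addnC leq_add2r mulnC leq_trunc_div.
  rewrite ltn_pmul2r // => ab; have := leq_mul2r (q ^ l) a.+1 b; rewrite ab orbT => h.
  apply: leq_trans h; rewrite mulSn addnC leq_add2r ltnW // ltn_expl // prime_gt1 //.
exact: (@coded_map R _ _ fst z).
Qed.

End MarkedExtension.

(** * Concatenations of marked words *)

Section Words.
Variables (R : realType) (K : finType).
Implicit Types (B u v w g : seq K) (ws rs : seq (seq K)).

(** Near the end of [w] the [take] is too short to match, so only occurrences inside [w] count;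
    comparisons across a junction therefore carry an error [size B]. *)
Definition occin B w := cnt (fun i => take (size B) (drop i w) == B) (size w).

Lemma occin_le B w : (occin B w <= size w)%N.
Proof. exact: cnt_le. Qed.

Lemma occin_tail B u v : (cnt (fun i => take (size B) (drop i (u ++ v)) == B) (size u) <=
  occin B u + size B)%N /\
  (occin B u <= cnt (fun i => take (size B) (drop i (u ++ v)) == B) (size u) + size B)%N.
Proof.
pose a := (size u - size B)%N.
have e : cnt (fun i => take (size B) (drop i (u ++ v)) == B) a =
    cnt (fun i => take (size B) (drop i u) == B) a.
  apply: eq_cnt => i ia; congr (_ == B).
  have iu : (i + size B <= size u)%N by rewrite /a in ia; lia.
  rewrite drop_cat ifT; last by rewrite /a in ia; lia.
  by rewrite takel_cat // size_drop; lia.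
have c F : cnt F (size u) = (cnt F a + cnt (fun i => F (a + i)%N) (size u - a))%N.
  by rewrite -cnt_cat subnKC // /a leq_subr.
rewrite /occin !c e.
set c1 := cnt _ (size u - a); set c2 := cnt _ (size u - a).
have l1 : (c1 <= size u - a)%N := cnt_le _ _; have l2 : (c2 <= size u - a)%N := cnt_le _ _.
by rewrite /a in l1 l2 *; lia.
Qed.

Lemma occin_cat B u v : `|(occin B (u ++ v))%:R - ((occin B u)%:R + (occin B v)%:R)| <= (size B)%:R :> R.
Proof.
have [h1 h2] := occin_tail B u v.
have -> : occin B (u ++ v) = (cnt (fun i => take (size B) (drop i (u ++ v)) == B) (size u) + occin B v)%N.
  rewrite /occin size_cat cnt_cat; congr (_ + _)%N; apply: eq_cnt => i _.
  by rewrite drop_cat ltnNge leq_addr /= addKn.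
move: h1 h2; set c := cnt _ _; rewrite -(ler_nat R) -[(occin B u <= _)%N](ler_nat R) !natrD => h1 h2.
by rewrite ler_norml; apply/andP; split; lra.
Qed.

Lemma occin_blk B (y : nat -> K) p n :
  `|(occin B (blk y p n))%:R - (cnt (fun i => occurs y B (p + i)) n)%:R| <= (size B)%:R :> R.
Proof.
have [h1 h2] := occin_tail B (blk y p n) (blk y (p + n) (size B)).
rewrite -blk_cat size_blk in h1 h2.
have e : cnt (fun i => take (size B) (drop i (blk y p (n + size B))) == B) n = cnt (fun i => occurs y B (p + i)) n.
  apply: eq_cnt => i ni; rewrite /occurs.
  have -> : (n + size B = i + (size B + (n - i)))%N by lia.
  by rewrite blk_cat drop_size_cat ?size_blk // blk_cat take_size_cat ?size_blk.
rewrite e in h1 h2; move: h1 h2; rewrite -(ler_nat R) -[(occin _ _ <= _)%N](ler_nat R) !natrD => h1 h2.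
by rewrite ler_norml; apply/andP; split; lra.
Qed.

Definition dev B (r : R) w : R := `|(occin B w)%:R - r * (size w)%:R|.

Lemma dev_le B r w : 0 <= r <= 1 -> dev B r w <= (size w)%:R.
Proof.
move=> /andP[r0 r1]; have := occin_le B w; rewrite -(ler_nat R) => h.
have : 0 <= (occin B w)%:R :> R by [].
have : 0 <= r * (size w)%:R by rewrite mulr_ge0.
have : r * (size w)%:R <= (size w)%:R by rewrite ler_piMl.
by rewrite /dev ler_norml => *; apply/andP; split; lra.
Qed.

Lemma dev_cat B r u v : dev B r (u ++ v) <= dev B r u + dev B r v + (size B)%:R.
Proof.
have := occin_cat B u v; rewrite /dev size_cat natrD.
set a := (occin B (u ++ v))%:R; set b := (occin B u)%:R; set c := (occin B v)%:R => h.
have -> : a - r * ((size u)%:R + (size v)%:R) =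
   (b - r * (size u)%:R) + (c - r * (size v)%:R) + (a - (b + c)) by ring.
apply: (le_trans (ler_normD _ _)); apply: lerD h; exact: ler_normD.
Qed.

Lemma dev_suffix B r u v : dev B r v <= dev B r (u ++ v) + dev B r u + (size B)%:R.
Proof.
have := occin_cat B u v; rewrite /dev size_cat natrD distrC.
set a := (occin B (u ++ v))%:R; set b := (occin B u)%:R; set c := (occin B v)%:R => h.
have -> : c - r * (size v)%:R = (a - r * ((size u)%:R + (size v)%:R)) - (b - r * (size u)%:R)
   + ((b + c) - a) by ring.
apply: (le_trans (ler_normD _ _)); apply: lerD h; exact: ler_normB.
Qed.

Lemma dev_nseq B r g q : dev B r (flatten (nseq q g)) <= q%:R * (dev B r g + (size B)%:R).
Proof.
elim: q => [|q IHq]; first by rewrite /dev /occin /= cnt0 mulr0 mul0r subrr normr0.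
rewrite /=; apply: (le_trans (dev_cat _ _ _ _)); rewrite -natr1 mulrDl mul1r.
by move: IHq; set x := q%:R * _; lra.
Qed.

Definition star (W : set (seq K)) v := exists2 ws, forall w, w \in ws -> W w & v = flatten ws.

Lemma star_cat W u v : star W u -> star W v -> star W (u ++ v).
Proof.
move=> [us hu ->] [vs hv ->]; exists (us ++ vs); last by rewrite flatten_cat.
by move=> w; rewrite mem_cat => /orP[/hu|/hv].
Qed.

Lemma star1 (W : set (seq K)) w : W w -> star W w.
Proof. by move=> Ww; exists [:: w]; rewrite /= ?cats0 // => v; rewrite inE => /eqP ->. Qed.

Lemma star_nil W : star W [::].
Proof. by exists [::]. Qed.

Lemma star_flatten W ws : (forall w, w \in ws -> star W w) -> star W (flatten ws).
Proof.
elim: ws => [|w ws IHws] h /=; first exact: star_nil.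
apply: star_cat; first by apply: h; rewrite mem_head.
by apply: IHws => v vw; apply: h; rewrite inE vw orbT.
Qed.

Lemma star_sub (W W' : set (seq K)) : (forall w, W w -> star W' w) -> forall v, star W v -> star W' v.
Proof. by move=> h v [ws hw ->]; apply: star_flatten => w /hw /h. Qed.

Lemma star_nseq W g q : star W g -> star W (flatten (nseq q g)).
Proof. by move=> Wg; apply: star_flatten => w /nseqP[->]. Qed.

(* Pigeonhole on the lengths of the prefixes modulo [G]. *)
Lemma reduce_mod G ws : (0 < G)%N -> exists rs, [/\ {subset rs <= ws}, (size rs < G)%N &
  exists q, size (flatten ws) = (q * G + size (flatten rs))%N].
Proof.
move=> G0; elim/ltn_ind: {ws}(size ws) {-2}ws (erefl (size ws)) => n IHn ws wsn.
have [lt|ge] := ltnP (size ws) G.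
  by exists ws; split => //; exists 0%N.
pose f (i : 'I_G.+1) : 'I_G := Ordinal (ltn_pmod (size (flatten (take i ws))) G0).
have [i [j [ij fij]]] : exists i j : 'I_G.+1, (i < j)%N /\ f i = f j.
  have : ~ injective f by move=> /leq_card; rewrite !card_ord ltnn.
  move=> /existsNP[i /existsNP[j /not_implyP[fij ij]]].
  have : (i : nat) != j by apply/eqP => /val_inj.
  by rewrite neq_ltn => /orP[h|h]; [exists i, j|exists j, i].
have jw : (j <= size ws)%N by apply: leq_trans ge; rewrite -ltnS.
pose w1 := take i ws; pose w2 := drop i (take j ws); pose w3 := drop j ws.
have wE : ws = w1 ++ w2 ++ w3.
  rewrite catA -[w1](@take_takel _ i j ws) ?cat_take_drop // ltnW //.
have w12 : take j ws = w1 ++ w2 by rewrite -[w1](@take_takel _ i j ws) ?cat_take_drop // ltnW.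
have s2 : (G %| size (flatten w2))%N.
  have := congr1 val fij; rewrite /f /= w12 flatten_cat size_cat => /esym/eqP.
  by rewrite -{2}(addn0 (size (flatten (take i ws)))) eqn_modDl mod0n.
have lt : (size (w1 ++ w3) < n)%N.
  have := congr1 size wE; rewrite -wsn !size_cat => ->.
  have : (0 < size w2)%N by rewrite size_drop size_takel // subn_gt0.
  lia.
have [rs [sub rsG [q qE]]] := IHn _ lt _ erefl.
exists rs; split => // [w /sub|].
  by rewrite wE !mem_cat => /orP[->|->]; rewrite ?orbT.
case/dvdnP: s2 => q2 q2E; exists (q + q2)%N.
move: qE; rewrite wE !flatten_cat !size_cat q2E mulnDl; lia.
Qed.

Lemma size_flatten_le ws H : (forall w, w \in ws -> (size w <= H)%N) ->
  (size (flatten ws) <= size ws * H)%N.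
Proof.
elim: ws => [|w ws IHws] h //=; rewrite size_cat mulSn leq_add ?h ?mem_head //.
by apply: IHws => v vw; apply: h; rewrite inE vw orbT.
Qed.

Lemma split_head ws H X : (forall w, w \in ws -> (size w <= H)%N) -> (X <= size (flatten ws))%N ->
  exists us vs, [/\ ws = us ++ vs, (X <= size (flatten us))%N & (size (flatten us) <= X + H)%N].
Proof.
elim: ws X => [|w ws IHws] X h hX; first by exists [::], [::]; split => //; lia.
have [Xw|wX] := leqP X (size w).
  exists [:: w], ws; split => //=; rewrite cats0 //.
  by rewrite (leq_trans (h w (mem_head _ _))) ?leq_addl.
have [||us [vs [-> h1 h2]]] := IHws (X - size w)%N.
- by move=> v vw; apply: h; rewrite inE vw orbT.
- by move: hX; rewrite /= size_cat; lia.
by exists (w :: us), vs; split => //=; rewrite size_cat; lia.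
Qed.

Variables (W : set (seq K)) (H : nat) (g : seq K).
Hypotheses (WH : forall w, W w -> (size w <= H)%N) (Wg : star W g) (g0 : (0 < size g)%N).

(** Reduction modulo [size g] keeps fewer than [size g] words of [v], of total length in the right
    residue class; copies of [g] fill the rest. The length assumption guarantees at least one
    copy. *)
Lemma replace_word v : star W v -> (size g * H < size v)%N ->
  exists q r, [/\ star W (flatten (nseq q.+1 g) ++ r), size (flatten (nseq q.+1 g) ++ r) = size v &
     (size r <= size g * H)%N].
Proof.
move=> [ws hw ->] lv.
have [rs [sub rsG [q qE]]] := reduce_mod ws g0.
have rs_le : (size (flatten rs) <= size g * H)%N.
  apply: (leq_trans (@size_flatten_le rs H _)); first by move=> w /sub /hw /WH.
  by rewrite leq_mul2r ltnW ?orbT.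
case: q qE => [|q] qE; first by move: lv; rewrite qE mul0n add0n; lia.
exists q, (flatten rs); split => //.
  apply: star_cat; first exact: star_nseq.
  by exists rs => // w /sub /hw.
rewrite qE size_cat; congr (_ + _)%N.
by elim: q.+1 => //= k IHk; rewrite size_cat IHk mulSn.
Qed.

Lemma dev_replace B r q t (d : R) : 0 <= r <= 1 -> dev B r g + (size B)%:R <= d * (size g)%:R ->
  dev B r (flatten (nseq q g) ++ t) <=
  d * (size (flatten (nseq q g) ++ t))%:R + (size t)%:R + (size B)%:R.
Proof.
move=> r01 hg.
have d0 : 0 <= d.
  have := le_trans (addr_ge0 (normr_ge0 _) (ler0n R (size B))) hg.
  by rewrite pmulr_lge0 // ltr0n.
apply: (le_trans (dev_cat _ _ _ _)); rewrite lerD2r; apply: lerD; last exact: dev_le.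
apply: (le_trans (dev_nseq _ _ _ _)).
have -> : size (flatten (nseq q g) ++ t) = (q * size g + size t)%N.
  rewrite size_cat; congr (_ + _)%N.
  by elim: q => //= k IHk; rewrite size_cat IHk mulSn.
apply: (@le_trans _ _ (q%:R * (d * (size g)%:R))); first by rewrite ler_wpM2l.
rewrite natrD natrM mulrDr.
have : 0 <= d * (size t)%:R by rewrite mulr_ge0.
by rewrite mulrCA mulrA; lra.
Qed.

End Words.

Lemma find_iotaP (P : pred nat) n : (exists2 k, (k < n)%N & P k) ->
  [/\ (find P (iota 0 n) < n)%N, P (find P (iota 0 n)) &
      forall k, (k < find P (iota 0 n))%N -> ~~ P k].
Proof.
move=> [k kn Pk].
have hP : has P (iota 0 n) by apply/hasP; exists k => //; rewrite mem_iota.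
have fn : (find P (iota 0 n) < n)%N by rewrite -{2}(size_iota 0 n) -has_find.
split => // [|j jf].
  by have := nth_find 0%N hP; rewrite nth_iota.
by have := before_find 0%N jf; rewrite nth_iota ?(ltn_trans jf) // => ->.
Qed.

Definition bounded_marker H (M : nat -> bool) :=
  M 0%N /\ forall i, exists j, [/\ (i < j)%N, (j <= i + H)%N & M j].

Definition consecutive (M : nat -> bool) p p' :=
  [/\ M p, M p', (p < p')%N & forall k, (p < k)%N -> (k < p')%N -> ~~ M k].

Definition marked_words (K : Type) (y : nat -> K) (M : nat -> bool) : set (seq K) :=
  [set w | exists p p', consecutive M p p' /\ w = blk y p (p' - p)].

Section Cuts.
Variables (H : nat) (M : nat -> bool).
Hypothesis bM : bounded_marker H M.

(** The search has bounded range, so the cuts around [i] are functions of a window of radius [H] and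
    can be coded. *)
Definition prev_dist i := find (fun k => M (i - k)%N) (iota 0 H.+1).
Definition next_dist i := find (fun k => M (i + k.+1)%N) (iota 0 H).
Definition prev_cut i := (i - prev_dist i)%N.
Definition next_cut i := (i + (next_dist i).+1)%N.

Lemma prev_cutP i : [/\ M (prev_cut i), (prev_cut i <= i)%N, (i <= prev_cut i + H)%N &
  forall k, (prev_cut i < k)%N -> (k <= i)%N -> ~~ M k].
Proof.
have [M0 hM] := bM.
have [|fH Mf nM] := @find_iotaP (fun k => M (i - k)%N) H.+1.
  have [iH|Hi] := leqP i H; first by exists i; rewrite ?subnn //; lia.
  have [j [j1 j2 Mj]] := hM (i - H)%N.
  exists (i - j)%N; first lia.
  by have -> : (i - (i - j) = j)%N by lia.
rewrite /prev_cut /prev_dist; split => //; [lia|lia|] => k k1 k2.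
by have := nM (i - k)%N; have -> : (i - (i - k) = k)%N; [lia|apply; lia].
Qed.

Lemma next_cutP i : [/\ M (next_cut i), (i < next_cut i)%N, (next_cut i <= i + H)%N &
  forall k, (i < k)%N -> (k < next_cut i)%N -> ~~ M k].
Proof.
have [M0 hM] := bM.
have [|fH Mf nM] := @find_iotaP (fun k => M (i + k.+1)%N) H.
  have [j [j1 j2 Mj]] := hM i.
  exists (j - i).-1; first lia.
  by have -> : (i + (j - i).-1.+1 = j)%N by lia.
rewrite /next_cut /next_dist; split => //; [lia|lia|] => k k1 k2.
by have := nM (k - i).-1; have -> : (i + (k - i).-1.+1 = k)%N; [lia|apply; lia].
Qed.

Lemma cut_consecutive i : consecutive M (prev_cut i) (next_cut i).
Proof.
have [p1 p2 p3 p4] := prev_cutP i; have [n1 n2 n3 n4] := next_cutP i.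
split => // [|k k1 k2]; first lia.
by have [ki|ik] := leqP k i; [apply: p4|apply: n4].
Qed.

Lemma consecutive_cut p p' i : consecutive M p p' -> (p <= i)%N -> (i < p')%N ->
  prev_cut i = p /\ next_cut i = p'.
Proof.
move=> [Mp Mp' pp' nM] pi ip'.
have [p1 p2 p3 p4] := prev_cutP i; have [n1 n2 n3 n4] := next_cutP i.
split; apply/eqP; rewrite eqn_leq; apply/andP; split; rewrite leqNgt; apply/negP => h.
- by have /negP := nM _ h (leq_ltn_trans p2 ip').
- by have /negP := p4 _ h pi.
- by have /negP := n4 _ ip' h.
- by have /negP := nM _ (leq_ltn_trans pi n2) h.
Qed.

Lemma consecutive_le p p' : consecutive M p p' -> (p' <= p + H)%N.
Proof.
move=> [Mp Mp' pp' nM]; have [j [pj jH Mj]] := bM.2 p.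
rewrite leqNgt; apply/negP => h; have /negP := nM j pj (leq_ltn_trans jH h); exact.
Qed.

Lemma marked_words_size K (y : nat -> K) w : marked_words y M w -> (0 < size w <= H)%N.
Proof.
move=> [p [p' [c ->]]]; have := consecutive_le c; case: c => _ _ pp' _ h.
by rewrite size_blk; lia.
Qed.

Lemma star_segment (K : finType) (y : nat -> K) p q : M p -> M q -> (p <= q)%N ->
  star (marked_words y M) (blk y p (q - p)).
Proof.
move=> Mp Mq; elim/ltn_ind: {q}(q - p)%N {-2}q (erefl (q - p)%N) Mq => n IHn q nq Mq pq.
have [qp|qp] := leqP q p.
  have -> : (q - p = 0)%N by lia.
  exact: star_nil.
have [p1 p2 p3 p4] := prev_cutP q.-1.
pose s := prev_cut q.-1.
have c : consecutive M s q by split => // [|k k1 k2]; [rewrite /s; lia|apply: p4 => //; lia].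
have ps : (p <= s)%N by rewrite leqNgt; apply/negP => sp; have := p4 p sp (ltac:(lia)); rewrite Mp.
have -> : (q - p = s - p + (q - s))%N by case: c; lia.
rewrite blk_cat subnKC //; apply: star_cat.
  apply: (IHn (s - p)%N) => //; case: c => _ _; move: ps nq; move: (s) => s' *; lia.
by apply: star1; exists s, q.
Qed.

End Cuts.

Section Locality.
Variables (H : nat) (M : nat -> bool) (i j : nat).
Hypotheses (bM : bounded_marker H M) (Hi : (H <= i)%N) (Hj : (H <= j)%N)
  (Mij : forall k, (k <= H.*2)%N -> M (i - H + k)%N = M (j - H + k)%N).

Lemma prev_dist_local : prev_dist H M i = prev_dist H M j.
Proof.
apply: eq_in_find => k; rewrite mem_iota => hk.
have := Mij (k := H - k)%N (ltac:(lia)).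
by have -> : (i - H + (H - k) = i - k)%N; [lia|]; have -> : (j - H + (H - k) = j - k)%N; [lia|].
Qed.

Lemma next_dist_local : next_dist H M i = next_dist H M j.
Proof.
apply: eq_in_find => k; rewrite mem_iota => hk.
have := Mij (k := H + k.+1)%N (ltac:(lia)).
by have -> : (i - H + (H + k.+1) = i + k.+1)%N; [lia|]; have -> : (j - H + (H + k.+1) = j + k.+1)%N; [lia|].
Qed.

End Locality.

Section NextAfter.
Variables (H HQ l : nat) (M Q : nat -> bool).
Hypotheses (bM : bounded_marker H M) (sQ : marker_set (l + H) HQ Q).

(** Thinning inside [M] keeps the new words concatenations of the old ones. Each marker of [Q] is
    delayed to the next marker of [M], by at most [H]; this is why gaps [l + H] are asked of [Q]. *)
Definition next_after i :=
  M i && has (fun k => Q (i - k)%N && ~~ has M (iota (i - k) k)) (iota 0 H.+1).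

Lemma next_after_sub i : next_after i -> M i.
Proof. by case/andP. Qed.

Lemma next_after_bounded : bounded_marker (HQ + H) next_after.
Proof.
have [Q0 hQ _] := sQ; have [M0 hM] := bM.
split; first by rewrite /next_after M0 /= Q0.
move=> i; have [j [ij jH Qj]] := hQ i.
have [|fH Mf nM] := @find_iotaP (fun k => M (j + k)%N) H.
  have [x [x1 x2 Mx]] := hM j.-1.
  by exists (x - j)%N; [lia|have -> : (j + (x - j) = x)%N by lia].
set f := find _ _ in fH Mf nM; exists (j + f)%N; split; [lia|lia|].
rewrite /next_after Mf andTb; apply/hasP; exists f; first by rewrite mem_iota; lia.
rewrite addnK Qj /=; apply/hasPn => x; rewrite mem_iota => hx.
by have := nM (x - j)%N; have -> : (j + (x - j) = x)%N; [lia|apply; lia].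
Qed.

Lemma next_after_gap i j : next_after i -> next_after j -> (i < j)%N -> (i + l <= j)%N.
Proof.
have [_ _ gQ] := sQ.
move=> /andP[Mi /hasP[k]]; rewrite mem_iota => hk /andP[Qk nk].
move=> /andP[Mj /hasP[k']]; rewrite mem_iota => hk' /andP[Qk' /hasPn nk'] ij.
have jk : (i < j - k')%N.
  rewrite ltnNge; apply/negP => h; have := nk' i; rewrite mem_iota Mi; move=> /(_ _)/negP; apply => //; lia.
have := gQ _ _ Qk Qk'; lia.
Qed.

Lemma next_after_coded (R : realType) : coded R next_after (fun i => (M i, Q i)).
Proof.
apply: (@coded_local _ _ _ _ _ H) => i j Hi Hj h.
have e k : (k <= H)%N -> (M (i - k)%N, Q (i - k)%N) = (M (j - k)%N, Q (j - k)%N).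
  move=> kH; have := h (H - k)%N (ltac:(lia)).
  by have -> : (i - H + (H - k) = i - k)%N; [lia|]; have -> : (j - H + (H - k) = j - k)%N; [lia|].
have eM k : (k <= H)%N -> M (i - k)%N = M (j - k)%N by move=> /e[].
have eQ k : (k <= H)%N -> Q (i - k)%N = Q (j - k)%N by move=> /e[].
rewrite /next_after; have := eM 0%N isT; rewrite !subn0 => ->; congr (_ && _).
apply: eq_in_has => k; rewrite mem_iota => hk; rewrite eQ; last lia.
congr (_ && ~~ _); apply/hasP/hasP => -[x]; rewrite mem_iota => hx Mx.
  exists (j - (i - x))%N; first by rewrite mem_iota; lia.
  by rewrite -eM; [have -> : (i - (i - x) = x)%N by lia|lia].
exists (i - (j - x))%N; first by rewrite mem_iota; lia.
by rewrite eM; [have -> : (j - (j - x) = x)%N by lia|lia].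
Qed.

End NextAfter.

Section BadWords.
Variables (R : realType) (K : finType) (y : nat -> K) (H l : nat) (M : nat -> bool).
Hypotheses (bM : bounded_marker H M)
  (gM : forall i j, M i -> M j -> (i < j)%N -> (i + l <= j)%N).

Definition word_at i := blk y (prev_cut H M i) (next_cut H M i - prev_cut H M i).

Lemma word_atE p p' i : consecutive M p p' -> (p <= i)%N -> (i < p')%N ->
  word_at i = blk y p (p' - p).
Proof. by move=> c pi ip; rewrite /word_at; have [-> ->] := consecutive_cut bM c pi ip. Qed.

(** A bad word of length [k >= l] contributes at least [k * (e / 2) * L] to the window sum: half of
    its deviation [e * k] covers the boundary cost [L + size B]. Summing over the words before a cut
    gives density [2 * d / e]; the doubling covers the passage from an arbitrary time to the next
    cut. *)
Lemma rare_bad_word B (r d e : R) L N : 0 <= r <= 1 -> (0 < L)%N -> 0 < d -> 0 < e ->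
  (forall n, (N <= n)%N -> window_sum (occurs y B) L n r <= d * L%:R * n%:R) ->
  (L + size B)%:R <= e / 2 * l%:R ->
  rare (4%:R * d / e) (fun i => e * (size (word_at i))%:R < dev B r (word_at i)).
Proof.
move=> r01 L0 d0 e0 hw hl.
have L0' : 0 < L%:R :> R by rewrite ltr0n.
set bad := fun i => _.
have main n : M n -> (cnt bad n)%:R * (e / 2 * L%:R) <= window_sum (occurs y B) L n r.
  elim/ltn_ind: n => -[|n] IHn Mn; first by rewrite cnt0 mul0r; apply: sumr_ge0.
  have [p1 p2 p3 p4] := prev_cutP bM n.
  pose p := prev_cut H M n.
  have c : consecutive M p n.+1 by split => // k k1 k2; apply: p4.
  pose k := (n.+1 - p)%N.
  have nE : n.+1 = (p + k)%N by rewrite /k; lia.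
  rewrite nE cnt_cat window_sum_cat natrD mulrDl; apply: lerD; first by apply: IHn => //; rewrite ltnS.
  have w i : (i < k)%N -> word_at (p + i) = blk y p k.
    by move=> ik; rewrite (word_atE c) //; [exact: leq_addr|lia].
  have -> : cnt (fun i => bad (p + i)%N) k = (if e * k%:R < dev B r (blk y p k) then k else 0%N).
    rewrite (@eq_cnt _ (fun=> e * k%:R < dev B r (blk y p k))); last first.
      by move=> i ik; rewrite /bad w // size_blk.
    case: ifP => _; last by rewrite /cnt big1.
    by elim: (k) => [|q IHq]; rewrite ?cnt0 // cntS IHq addn1.
  case: ifP => bd; last by rewrite mul0r; apply: sumr_ge0.
  have s1 := window_freq_sum (fun i => occurs y B (p + i)%N) L k r.
  have s2 := occin_blk R B y p k.
  have s3 : dev B r (blk y p k) <= `|(cnt (fun i => occurs y B (p + i)%N) k)%:R - r * k%:R| + (size B)%:R.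
    rewrite /dev size_blk; move: s2; set a := (occin _ _)%:R; set b := (cnt _ _)%:R => s2.
    have -> : a - r * k%:R = (b - r * k%:R) + (a - b) by ring.
    by apply: (le_trans (ler_normD _ _)); rewrite lerD2l.
  have lk : (l <= k)%N by case: c => Mp Mn' pn _; rewrite /k leq_subRL ?gM // ltnW.
  have lk' : e / 2 * l%:R <= e / 2 * k%:R by rewrite ler_wpM2l ?ler_nat // ltW // divr_gt0.
  move: s1 s3 bd hl; rewrite natrD; set x := `|_| => s1 s3 bd hl.
  have s4 : L%:R * (e / 2 * k%:R + L%:R) <= L%:R * x by apply: ler_wpM2l; lra.
  move: s1 s4; rewrite mulrDr; set u := L%:R * L%:R => s1 s4.
  have -> : k%:R * (e / 2 * L%:R) = L%:R * (e / 2 * k%:R) by ring.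
  lra.
have de : 0 < 2 * d / e by rewrite divr_gt0 // mulr_gt0.
have [N2 hN2] := @archi_le R (2 * d / e) (2 * d / e * H%:R) de.
exists (N + N2)%N => n nn.
have [m1 m2 m3 _] := next_cutP bM n; set m := next_cut H M n in m1 m2 m3.
apply: (@le_trans _ _ (cnt bad m)%:R).
  by rewrite ler_nat -(subnKC (ltnW m2)) cnt_cat leq_addr.
have mn : m%:R <= n%:R + H%:R :> R by rewrite -natrD ler_nat.
have [Nm N2n] : (N <= m)%N /\ (N2 <= n)%N by clear -nn m2; lia.
have h1 := main m m1; have h2 := hw m Nm; have h3 := hN2 n N2n.
have h4 : (cnt bad m)%:R <= 2 * d / e * m%:R.
  have eL : 0 < e / 2 * L%:R by rewrite mulr_gt0 // divr_gt0.
  rewrite -(ler_pM2r eL); apply: (le_trans (le_trans h1 h2)).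
  rewrite le_eqVlt; apply/orP; left; apply/eqP; field.
  by rewrite lt0r_neq0.
apply: (le_trans h4).
have : 2 * d / e * m%:R <= 2 * d / e * (n%:R + H%:R) by rewrite ler_wpM2l // ltW.
have -> : 4%:R * d / e = 2 * d / e + 2 * d / e by field; rewrite lt0r_neq0.
rewrite mulrDr mulrDl; lra.
Qed.

(** Gaps of at least [l] allow at most [n / l + 1] cuts before [n], and each of them spoils [C]
    positions. *)
Lemma rare_near_cut C (e : R) : (0 < l)%N -> 2 * C%:R < e * l%:R ->
  rare e (fun i => (i - prev_cut H M i < C)%N).
Proof.
move=> l0 hC.
have l0' : 0 < l%:R :> R by rewrite ltr0n.
have e0 : 0 < e.
  have : 0 < e * l%:R by apply: le_lt_trans hC; rewrite mulr_ge0.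
  by rewrite pmulr_lgt0.
have cM n : (cnt M n * l <= n + l)%N.
  suff H0 : (0 < n)%N -> (cnt M n * l <= prev_cut H M n.-1 + l)%N.
    case: n H0 => [|n] H0; first by rewrite cnt0.
    have [_ h _ _] := prev_cutP bM n.
    by apply: (leq_trans (H0 isT)); rewrite /= leq_add2r; lia.
  case: n => // n _ /=; elim: n => [|n IHn].
    by rewrite cntS cnt0 add0n; case: (M 0%N); rewrite ?mul1n ?mul0n // leq_addl.
  rewrite cntS; have [Mn|nMn] := boolP (M n.+1); last first.
    rewrite addn0; apply: (leq_trans IHn); rewrite leq_add2r.
    have [p1 p2 p3 p4] := prev_cutP bM n; have [q1 q2 q3 q4] := prev_cutP bM n.+1.
    rewrite leqNgt; apply/negP => h; have /negP := q4 _ h (leq_trans p2 (leqnSn n)); exact.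
  rewrite addn1 mulSn addnC leq_add2r; apply: (leq_trans IHn).
  have [p1 p2 p3 p4] := prev_cutP bM n; have [q1 q2 q3 q4] := prev_cutP bM n.+1.
  apply: (leq_trans (gM p1 Mn _)); first by rewrite ltnS.
  rewrite leqNgt; apply/negP => h; have /negP := q4 _ h (leqnn _); exact.
have near n : (cnt (fun i => (i - prev_cut H M i < C)%N) n <= C * cnt M n)%N.
  apply: (@leq_trans (cnt (fun i => has (fun k => (k <= i)%N && M (i - k)%N) (iota 0 C)) n)).
    apply: leq_cnt => i _ iC; have [p1 p2 p3 p4] := prev_cutP bM i.
    apply/hasP; exists (i - prev_cut H M i)%N; first by rewrite mem_iota.
    by rewrite leq_subr /=; have -> : (i - (i - prev_cut H M i) = prev_cut H M i)%N by lia.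
  elim: (C) => [|c IHc]; first by rewrite /cnt big1.
  rewrite mulSn addnC; apply: (leq_trans _ (leq_add IHc (leqnn _))).
  apply: (@leq_trans (cnt (fun i => has (fun k => (k <= i)%N && M (i - k)%N) (iota 0 c)) n +
     cnt (fun i => (c <= i)%N && M (i - c)%N) n)).
    apply: leq_trans (cnt_or _ _ n); apply: leq_cnt => i _.
    by rewrite -addn1 iotaD has_cat /= orbF.
  rewrite leq_add2l; have [nc|cn] := leqP n c.
    by rewrite /cnt big1 // => i _; rewrite leqNgt (leq_trans (ltn_ord i)).
  rewrite -(subnKC (ltnW cn)) cnt_cat {1}/cnt big1 => [|i _]; last by rewrite leqNgt ltn_ord.
  rewrite add0n; apply: (@leq_trans (cnt M (n - c))).
    by apply: leq_cnt => i _; rewrite leq_addr addKn.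
  by rewrite addnC cnt_cat leq_addr.
have [N hN] := @archi_le R (e / 2) C%:R (ltac:(lra)).
exists N => n /hN hn.
have h1 := near n; have h2 := cM n.
have : (cnt (fun i => (i - prev_cut H M i < C)%N) n * l <= C * (n + l))%N.
  by apply: (@leq_trans (C * cnt M n * l)); [rewrite leq_mul2r h1 orbT|rewrite -mulnA leq_mul2l h2 orbT].
rewrite -(ler_nat R) !natrM natrD; set x := (cnt _ n)%:R => h3.
rewrite -(ler_pM2r l0'); apply: (le_trans h3).
have : C%:R * l%:R <= e / 2 * n%:R * l%:R by rewrite ler_wpM2r.
have : 2 * C%:R * n%:R <= e * l%:R * n%:R by rewrite ler_wpM2r // ltW.
rewrite mulrDr; lra.
Qed.

End BadWords.

Definition short_words (K : finType) m : seq (seq K) :=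
  flatten [seq [seq val w | w <- enum {: k.-tuple K}] | k <- iota 0 m.+1].

Lemma mem_short_words (K : finType) m (B : seq K) : (size B <= m)%N -> B \in short_words K m.
Proof.
move=> Bm; apply/flattenP; exists [seq val w | w <- enum {: (size B).-tuple K}].
  by apply/mapP; exists (size B) => //; rewrite mem_iota.
by apply/mapP; exists (in_tuple B); rewrite ?mem_enum.
Qed.

Lemma short_words_size (K : finType) m (B : seq K) : B \in short_words K m -> (size B <= m)%N.
Proof.
move=> /flattenP[s /mapP[k]]; rewrite mem_iota => hk -> /mapP[w _ ->].
by rewrite size_tuple; lia.
Qed.

Lemma leq_sum_mem (T : eqType) (F : T -> nat) (s : seq T) x : x \in s -> (F x <= \sum_(t <- s) F t)%N.
Proof. by move=> xs; rewrite (big_rem x) //= leq_addr. Qed.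

Lemma rare_has_seq (R : realType) (T : eqType) (e : R) (F : T -> nat -> bool) (s : seq T) :
  (forall x, x \in s -> rare e (F x)) -> rare (e *+ size s) (fun i => has (fun x => F x i) s).
Proof.
elim: s => [|x s IHs] h; first by exists 0%N => n _; rewrite mulr0n mul0r /cnt big1.
rewrite /= mulrS; apply: rare_or; first by apply: h; rewrite mem_head.
by apply: IHs => t ts; apply: h; rewrite inE ts orbT.
Qed.

Section Replacement.
Variables (R : realType) (K : finType) (y : nat -> K) (M : nat -> bool) (H m n0 G : nat) (e : R) (r : seq K -> R).
Hypotheses (bM : bounded_marker H M) (MG : M G) (nG : (n0 <= G)%N) (G0 : (0 < G)%N) (e0 : 0 < e)
  (r01 : forall B, 0 <= r B <= 1)
  (hg : forall B, (size B <= m)%N -> dev B (r B) (blk y 0 G) + (size B)%:R <= e / 4%:R * G%:R).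

Let W := marked_words y M.
(** A head longer than [G * H], as [replace_word] demands, can be cut off at a word boundary within
    this length. *)
Let C := (G * H + 1 + H)%N.

(** The last clause keeps the change small: a word already good at level [e / 2] only has its head
    rewritten, and the other half of [e] pays for that head. *)
Definition replacement_spec v v' := [/\ star W v', size v' = size v,
  (forall B, (size B <= m)%N -> dev B (r B) v' <= e * (size v)%:R),
  (exists u t, v' = u ++ blk y 0 n0 ++ t) &
  ((forall B, (size B <= m)%N -> dev B (r B) v <= e / 2 * (size v)%:R) -> drop C v' = drop C v)].

(* A bad word is rebuilt from copies of the prefix of length [G], a good one only
   has its first [C] letters rebuilt; the pigeonhole on lengths modulo [G] keeps
   the size. *)
Lemma replacement_exists l v : (C <= l)%N -> (4 * C + 4 * m)%:R <= e * l%:R ->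
  star W v -> (l <= size v)%N -> exists v', replacement_spec v v'.
Proof.
move=> Cl hl Wv lv.
have WH w : W w -> (size w <= H)%N by move=> /(marked_words_size bM) /andP[].
have sg : size (blk y 0 G) = G by rewrite size_blk.
have Wg : star W (blk y 0 G).
  by have := star_segment bM y bM.1 MG (leq0n G); rewrite subn0.
have hlv : (4 * C + 4 * m)%:R <= e * (size v)%:R.
  by apply: (le_trans hl); rewrite ler_wpM2l ?ler_nat // ltW.
have prefix q t : exists u t', flatten (nseq q.+1 (blk y 0 G)) ++ t = u ++ blk y 0 n0 ++ t'.
  exists [::], (blk y n0 (G - n0) ++ flatten (nseq q (blk y 0 G)) ++ t).
  by rewrite /= !catA -blk_cat subnKC.
have [good|bad] := pselect (forall B, (size B <= m)%N -> dev B (r B) v <= e / 2 * (size v)%:R); last first.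
  have [q [t [Wv' sv' st]]] := @replace_word K W H (blk y 0 G) WH Wg (ltac:(rewrite sg; exact: G0)) v Wv
    (ltac:(rewrite sg; rewrite /C in Cl; lia)).
  exists (flatten (nseq q.+1 (blk y 0 G)) ++ t); split => //.
  move=> B Bm.
  have := @dev_replace R K (blk y 0 G) (ltac:(rewrite sg; exact: G0)) B (r B) q.+1 t (e / 4%:R) (r01 B)
    (ltac:(rewrite sg; exact: hg)).
  rewrite sv'.
  have : (size t)%:R <= C%:R :> R by rewrite ler_nat; rewrite sg in st; rewrite /C; lia.
  have : (size B)%:R <= m%:R :> R by rewrite ler_nat.
  move: hlv; rewrite natrD !natrM; have : 0 <= m%:R :> R by []. have : 0 <= C%:R :> R by [].
  set x := (size v)%:R; set a := dev _ _ _; set b := (size t)%:R; set c := (size B)%:R.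
  have : 0 <= e * x by rewrite mulr_ge0 // ltW.
  move=> *; lra.
have [ws hws vE] := Wv.
have [us [vs [wsE u1 u2]]] := @split_head K ws H (G * H + 1) (fun w h => WH w (hws w h))
  (ltac:(rewrite -vE; rewrite /C in Cl; lia)).
have Wus : star W (flatten us).
  by exists us => [w wu|//]; apply: hws; rewrite wsE mem_cat wu.
have Wvs : star W (flatten vs).
  by exists vs => [w wu|//]; apply: hws; rewrite wsE mem_cat wu orbT.
have [q [t [Wv' sv' st]]] := @replace_word K W H (blk y 0 G) WH Wg (ltac:(rewrite sg; exact: G0)) _ Wus
    (ltac:(rewrite sg; lia)).
set v1 := flatten us in u1 u2 Wus sv' *; set v2 := flatten vs in Wvs.
have {}vE : v = v1 ++ v2 by rewrite vE wsE flatten_cat.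
have s1C : (size v1 <= C)%N by [].
exists ((flatten (nseq q.+1 (blk y 0 G)) ++ t) ++ v2); split.
- exact: star_cat.
- by rewrite vE size_cat sv' size_cat.
- move=> B Bm.
  have h1 := @dev_cat R K B (r B) (flatten (nseq q.+1 (blk y 0 G)) ++ t) v2.
  have h2 := @dev_le R K B (r B) (flatten (nseq q.+1 (blk y 0 G)) ++ t) (r01 B).
  have h3 := @dev_suffix R K B (r B) v1 v2; rewrite -vE in h3.
  have h4 := @dev_le R K B (r B) v1 (r01 B).
  have h5 := good B Bm; rewrite sv' in h2.
  have h6 : (size v1)%:R <= C%:R :> R by rewrite ler_nat.
  have h7 : (size B)%:R <= m%:R :> R by rewrite ler_nat.
  move: h1 h2 h3 h4 h5 h6 h7 hlv; rewrite natrD !natrM.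
  set x := (size v)%:R; move: (dev _ _ _) (dev _ _ _) (dev _ _ _) (dev _ _ _) (dev _ _ _) => a1 a2 a3 a4 a5.
  have : 0 <= m%:R :> R by []. have : 0 <= C%:R :> R by [].
  move=> *; lra.
- have [u [t' ->]] := prefix q t; exists u, (t' ++ v2); by rewrite !catA.
move=> _; rewrite vE !drop_cat sv'.
by rewrite ltnNge s1C.
Qed.

End Replacement.

Section Substitution.
Variables (R : realType) (K : finType) (y : nat -> K) (H : nat) (M : nat -> bool) (F : seq K -> seq K).
Hypotheses (bM : bounded_marker H M) (sF : forall w, marked_words y M w -> size (F w) = size w).

Definition subst_words i := nth (y i) (F (word_at y H M i)) (i - prev_cut H M i).

Lemma subst_words_blk p p' : consecutive M p p' -> blk subst_words p (p' - p) = F (blk y p (p' - p)).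
Proof.
move=> c; have sFw : size (F (blk y p (p' - p))) = (p' - p)%N.
  by rewrite sF ?size_blk //; exists p, p'.
apply: (@eq_from_nth _ (y 0%N)); first by rewrite size_blk sFw.
move=> i; rewrite size_blk => ip; have pp' : (p < p')%N by case: c.
have [e1 e2] := consecutive_cut bM c (leq_addr i p) (ltac:(lia)).
rewrite nth_blk // /subst_words (word_atE y bM c) ?leq_addr //; last lia.
rewrite e1 addKn; apply: set_nth_default; by rewrite sFw.
Qed.

Lemma subst_words_coded : coded R subst_words (fun i => (y i, M i)).
Proof.
apply: (@coded_local _ _ _ _ _ H) => i j Hi Hj h.
have hM k : (k <= H.*2)%N -> M (i - H + k)%N = M (j - H + k)%N by move=> /h[].
have hy k : (k <= H.*2)%N -> y (i - H + k)%N = y (j - H + k)%N by move=> /h[].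
have ed := prev_dist_local Hi Hj hM; have en := next_dist_local Hi Hj hM.
have [p1 p2 p3 _] := prev_cutP bM i; have [q1 q2 q3 _] := prev_cutP bM j.
have [n1 n2 n3 _] := next_cutP bM i; have [m1 m2 m3 _] := next_cutP bM j.
have eyi : y i = y j by have := hy H (ltac:(lia)); rewrite !subnK.
have ep : (i - prev_cut H M i = j - prev_cut H M j)%N.
  by move: p2 p3 q2 q3; rewrite /prev_cut ed; lia.
have en' : (next_cut H M i - i = next_cut H M j - j)%N by rewrite /next_cut en; lia.
rewrite /subst_words eyi ep; congr (nth _ (F _) _); rewrite /word_at.
move: ep en' p2 p3 q2 q3 n2 n3 m2 m3; move: (prev_cut _ _ _) (prev_cut _ _ _) (next_cut _ _ _) (next_cut _ _ _) => q p m n *.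
have -> : (n - p = m - q)%N by lia.
apply: eq_blk => k hk; have kH : (H - (i - p) + k <= H.*2)%N.
  lia.
have := hy _ kH.
have -> : (i - H + (H - (i - p) + k) = p + k)%N by lia.
by have -> : (j - H + (H - (i - p) + k) = q + k)%N by lia.
Qed.

Variable N : nat.
Hypotheses (N0 : (0 < N)%N) (MN : M N).

(** The substitution is known to change few positions only from some time on. Keeping the first [N]
    letters, as one word, extends the bound to every initial segment. *)
Definition splice i := if (i < N)%N then y i else subst_words i.
Definition splice_marker i := (i == 0%N) || (N <= i)%N && M i.

Lemma splice_bounded : bounded_marker (N + H) splice_marker.
Proof.
split => // i; have [iN|Ni] := ltnP i N.
  by exists N; rewrite /splice_marker MN leqnn orbT; split => //; lia.
have [j [ij jH Mj]] := bM.2 i.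
exists j; rewrite /splice_marker Mj (leq_trans Ni (ltnW ij)) orbT; split => //; lia.
Qed.

Lemma splice_words w : marked_words splice splice_marker w ->
  w = blk y 0 N \/ exists2 v, marked_words y M v & w = F v.
Proof.
move=> [p [p' [[Mp Mp' pp' nM] ->]]].
have {Mp'} [Np' Mp'] : (N <= p')%N /\ M p'.
  by case/orP: Mp' => [/eqP p0|/andP[-> ->]]; [rewrite p0 ltn0 in pp'|].
have [/eqP p0|/andP[Np Mp1]] := orP Mp.
  left; have -> : p' = N.
    apply/eqP; rewrite eqn_leq Np' andbT leqNgt; apply/negP => Np.
    by have := nM N (ltac:(lia)) Np; rewrite /splice_marker leqnn MN orbT.
  rewrite p0 subn0; apply: eq_blk => k kN.
  by rewrite /splice add0n kN.
have c : consecutive M p p'.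
  split => // k pk kp'; apply/negP => Mk.
  by have := nM k pk kp'; rewrite /splice_marker Mk (leq_trans Np (ltnW pk)) orbT.
right; exists (blk y p (p' - p)); first by exists p, p'.
rewrite -subst_words_blk //; apply: eq_blk => k kp.
by rewrite /splice ltnNge (leq_trans Np (leq_addr _ _)).
Qed.

Lemma splice_coded : coded R splice (fun i => (y i, M i)).
Proof.
apply: (@coded_ext _ _ _ _ subst_words _ N) => [i Ni|]; last exact: subst_words_coded.
by rewrite /splice ltnNge Ni.
Qed.

Lemma splice_marker_coded : coded R splice_marker M.
Proof.
apply: (@coded_ext _ _ _ _ M _ N.+1) => [i Ni|]; last exact: coded_refl.
by rewrite /splice_marker (ltnW Ni) /=; case: i Ni.
Qed.

End Substitution.

(** * One stage of the construction *)

Section Refinement.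
Variables (R : realType) (K : finType) (S : Type) (z : nat -> S).
Hypotheses (ez : erg_seq R z).

Lemma word_frequencies (y : nat -> K) m (d : R) : coded R y z -> 0 < d ->
  exists (r : seq K -> R) L N, (forall B, 0 <= r B <= 1) /\
  forall B, (size B <= m)%N -> exists L', [/\ (0 < L')%N, (L' <= L)%N &
    forall n, (N <= n)%N -> window_sum (occurs y B) L' n (r B) <= d * L'%:R * n%:R].
Proof.
move=> yz d0.
have h B : exists t : R * nat * nat, [/\ 0 <= t.1.1 <= 1, (0 < t.1.2)%N &
    forall n, (t.2 <= n)%N -> window_sum (occurs y B) t.1.2 n t.1.1 <= d * t.1.2%:R * n%:R].
  have c : coded R (occurs y B) y.
    apply: (@coded_local _ _ _ _ _ (size B)) => i j Bi Bj hij.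
    rewrite /occurs; congr (_ == B); apply: eq_blk => k kB.
    have := hij (size B + k)%N (ltac:(lia)).
    have -> : (i - size B + (size B + k) = i + k)%N by lia.
    by have -> : (j - size B + (size B + k) = j + k)%N by lia.
  by have [r [L [N ?]]] := coded_erg ez (coded_trans c yz) d0; exists (r, L, N).
have {h}[t ht] := choice h.
exists (fun B => (t B).1.1), (\sum_(B <- short_words K m) (t B).1.2)%N, (\sum_(B <- short_words K m) (t B).2)%N.
split => [B|B Bm]; first by case: (ht B).
have [h1 h2 h3] := ht B; exists (t B).1.2; split => // [|n hn].
  exact: (leq_sum_mem (fun B => (t B).1.2) (mem_short_words Bm)).
by apply: h3; apply: leq_trans hn; exact: (leq_sum_mem (fun B => (t B).2) (mem_short_words Bm)).
Qed.

Lemma prefix_dev (y : nat -> K) (B : seq K) (r d : R) L n : (0 < L)%N ->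
  window_sum (occurs y B) L n r <= d * L%:R * n%:R ->
  dev B r (blk y 0 n) <= d * n%:R + L%:R + (size B)%:R.
Proof.
move=> L0 h; have h1 := window_freq L0 h; have := occin_blk R B y 0 n.
rewrite (@eq_cnt _ (occurs y B)) => [|i _]; last by rewrite add0n.
rewrite /dev size_blk; set a := (occin _ _)%:R; set b := (cnt _ _)%:R in h1 * => h2.
have -> : a - r * n%:R = (a - b) + (b - r * n%:R) by ring.
by apply: (le_trans (ler_normD _ _)); rewrite addrC lerD.
Qed.

(** The constants are chosen in the order [d], [L], [G], [C], [l], [N]. The repeated prefix, of
    length [G], must be fixed before the minimal word length [l], which makes the rewritten heads of
    length [C] negligible. The frequencies [r] come from the averaging property of [z]. *)
Lemma refine_step (y : nat -> K) M H (e : R) m n0 : has_markers R z ->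
  coded R y z -> coded R M z -> bounded_marker H M -> 0 < e ->
  exists y' M' H', [/\ coded R y' z, coded R M' z, bounded_marker H' M' &
  [/\ forall n, (cnt (fun i => y i != y' i) n)%:R <= e * n%:R,
      forall i, (i < n0)%N -> y' i = y i,
      forall w, marked_words y' M' w -> star (marked_words y M) w,
      forall w, marked_words y' M' w -> m%:R <= e * (size w)%:R /\ exists u t, w = u ++ blk y 0 n0 ++ t &
      exists2 rho : seq K -> R, forall B, 0 <= rho B <= 1 &
        forall w, marked_words y' M' w -> forall B, (size B <= m)%N -> dev B (rho B) w <= e * (size w)%:R]].
Proof.
move=> mz yz Mz bM e0.
pose b := (size (short_words K m)).+1.
have b0 : 0 < b%:R :> R by rewrite ltr0n.
(* There are fewer than [b] short blocks, and each may spoil positions of density [8 * d / e]; the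
   last bound keeps their total below [e / 2]. *)
have [d [d0 d8 db]] : exists d : R, [/\ 0 < d, d <= e / 8%:R & 8%:R * d / e * b%:R <= e / 2].
  have h1 : 0 < e * e / (16%:R * b%:R) by rewrite divr_gt0 ?mulr_gt0.
  exists (Num.min (e / 8%:R) (e * e / (16%:R * b%:R))); split; first by rewrite lt_min h1 divr_gt0.
    by rewrite ge_min lexx.
  apply: (@le_trans _ _ (8%:R * (e * e / (16%:R * b%:R)) / e * b%:R)).
    rewrite ler_pM2r // ler_pM2r ?invr_gt0 // ler_pM2l //.
    by rewrite ge_min lexx orbT.
  rewrite le_eqVlt; apply/orP; left; apply/eqP; field.
  by rewrite !lt0r_neq0.
have [r [L [N1 [r01 hr]]]] := word_frequencies m yz d0.
have [G [MG G0 n0G N1G hG]] : exists G, [/\ M G, (0 < G)%N, (n0 <= G)%N, (N1 <= G)%N & (L + 2 * m)%:R <= e / 8%:R * G%:R].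
  have [N2 hN2] := @archi_le R (e / 8%:R) (L + 2 * m)%:R (ltac:(lra)).
  have [g1 g2 g3 _] := next_cutP bM (N1 + N2 + n0).
  by exists (next_cut H M (N1 + N2 + n0)); split => //; [lia|lia|lia|apply: hN2; lia].
have devG n B : (G <= n)%N -> (size B <= m)%N -> dev B (r B) (blk y 0 n) + (size B)%:R <= e / 4%:R * n%:R.
  move=> Gn Bm; have [L' [L0 LL hw]] := hr B Bm.
  have := prefix_dev L0 (hw n (leq_trans N1G Gn)).
  have : (L' + 2 * size B)%:R <= (L + 2 * m)%:R :> R by rewrite ler_nat; lia.
  rewrite natrD natrM.
  have : e / 8%:R * G%:R <= e / 8%:R * n%:R by rewrite ler_wpM2l ?ler_nat // divr_ge0 // ltW.
  have : d * n%:R <= e / 8%:R * n%:R by rewrite ler_wpM2r.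
  move: hG; set a := d * n%:R; set c := dev _ _ _; set g := G%:R; set x := n%:R => *; lra.
pose C := (G * H + 1 + H)%N.
have [l [Cl hl]] : exists l, (C <= l)%N /\ (16 * C + 4 * m + 4 * L + 1)%:R <= e * l%:R.
  have [N2 hN2] := @archi_le R e (16 * C + 4 * m + 4 * L + 1)%:R e0.
  by exists (C + N2)%N; rewrite leq_addr hN2 ?leq_addl.
have [HQ [Q [Qz sQ]]] := mz (l + H)%N.
pose M1 := next_after H M Q; pose H1 := (HQ + H)%N.
have bM1 : bounded_marker H1 M1 := next_after_bounded bM sQ.
have gM1 : forall i j, M1 i -> M1 j -> (i < j)%N -> (i + l <= j)%N := next_after_gap sQ.
have M1z : coded R M1 z := coded_trans (@next_after_coded H M Q R) (coded_pair Mz Qz).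
have word1 w : marked_words y M1 w -> star (marked_words y M) w /\ (l <= size w)%N.
  move=> [p [p' [[Mp Mp' pp' _] ->]]]; split.
    by apply: (star_segment bM); [exact: next_after_sub Mp|exact: next_after_sub Mp'|exact: ltnW].
  by rewrite size_blk leq_subRL ?gM1 // ltnW.
have /choice[F hF] : forall w, exists v, marked_words y M1 w -> replacement_spec y M H m n0 G e r w v.
  move=> w; have [hw|nw] := pselect (marked_words y M1 w); last by exists [::].
  have [w1 w2] := word1 w hw.
  have [|v hv] := @replacement_exists R K y M H m n0 G e r bM MG n0G G0 e0 r01 (devG G ^~ (leqnn G)) l w Cl _ w1 w2.
    by apply: le_trans hl; rewrite ler_nat /C; lia.
  by exists v.
have sF w : marked_words y M1 w -> size (F w) = size w by case/hF.
(* Outside [bad] the word is good at level [e / 2] and the position lies beyond the rewritten head,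
   so the letter is unchanged. *)
pose bad i := has (fun B => e / 2 * (size (word_at y H1 M1 i))%:R < dev B (r B) (word_at y H1 M1 i)) (short_words K m)
   || (i - prev_cut H1 M1 i < C)%N.
have rbad : rare e bad.
  have hC : C%:R * 16%:R + 1 <= e * l%:R.
    by apply: le_trans hl; rewrite -natrM natr1 ler_nat; lia.
  have C0 : 0 <= C%:R :> R by [].
  apply: (@rare_sub _ (8%:R * d / e *+ size (short_words K m) + e / 4%:R)) (fun i => id) _.
    rewrite -mulr_natr.
    have : 8%:R * d / e * (size (short_words K m))%:R <= 8%:R * d / e * b%:R.
      by rewrite ler_wpM2l ?ler_nat // divr_ge0 ?mulr_ge0 // ltW.
    lra.
  apply: rare_or; last by apply: (rare_near_cut bM1 gM1); [apply: leq_trans Cl; rewrite /C; clear; lia|clear -hC C0; lra].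
  apply: rare_has_seq => B /short_words_size Bm; have [L' [L0 LL hw]] := hr B Bm.
  have -> : 8%:R * d / e = 4%:R * d / (e / 2) by field; rewrite lt0r_neq0.
  apply: (rare_bad_word bM1 gM1 (r01 B) L0 d0 _ hw); first by rewrite divr_gt0.
  have : (4 * (L' + size B))%:R <= (16 * C + 4 * m + 4 * L + 1)%:R :> R by rewrite ler_nat; clear -LL Bm; move: (size B) Bm => s *; lia.
  rewrite natrM; move: hl; set x := (L' + _)%:R; set c := (_ + 1)%:R; set a := l%:R => h1 h2; lra.
have [N2 hN2] := rbad.
(* Past [N2] the bad positions number at most [e * n] among the first [n], and past [G] the prefix
   has good frequencies, so it qualifies as a word. *)
pose N := next_cut H1 M1 (N2 + G).
have [MN Ngt _ _] := next_cutP bM1 (N2 + G); rewrite -/N in MN Ngt.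
have N0 : (0 < N)%N := leq_ltn_trans (leq0n _) Ngt.
have [N2N GN] : (N2 <= N)%N /\ (G <= N)%N by split; apply: leq_trans (ltnW Ngt); rewrite ?leq_addr ?leq_addl.
have n0N := leq_trans n0G GN.
pose y' := splice y H1 M1 F N; pose M' := splice_marker M1 N.
have words w : marked_words y' M' w -> w = blk y 0 N \/ exists2 v, marked_words y M1 v & w = F v.
  exact: (splice_words bM1 sF N0 MN).
exists y', M', (N + H1)%N; split.
- exact: coded_trans (@splice_coded R K y H1 M1 F bM1 N) (coded_pair yz M1z).
- exact: coded_trans (@splice_marker_coded R M1 N) M1z.
- exact: splice_bounded.
split.
- move=> n; have [nN|Nn] := leqP n N.
    rewrite /cnt big1 ?mulr_ge0 // ?ltW // => i _.
    by rewrite /y' /splice (leq_trans (ltn_ord i) nN) eqxx.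
  apply: (@le_trans _ _ (cnt bad n)%:R); last exact: hN2 (leq_trans N2N (ltnW Nn)).
  rewrite ler_nat; apply: leq_cnt => i _; apply: contraNT; rewrite negb_or -leqNgt => /andP[/hasPn hB Ci].
  rewrite /y' /splice; case: ifP => // _; apply/eqP.
  set p := prev_cut H1 M1 i in Ci *; set p' := next_cut H1 M1 i.
  have c : consecutive M1 p p' := cut_consecutive bM1 i.
  have [_ pi _ _] := prev_cutP bM1 i; have [_ ip' _ _] := next_cutP bM1 i.
  have hw : marked_words y M1 (word_at y H1 M1 i) by exists p, p'.
  have [_ sv _ _ hdrop] := hF _ hw.
  have {}hdrop : drop C (F (word_at y H1 M1 i)) = drop C (word_at y H1 M1 i).
    by apply: hdrop => B Bm; rewrite leNgt; apply: hB; exact: mem_short_words.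
  rewrite /subst_words -/p -(subnKC Ci) -nth_drop hdrop nth_drop subnKC // /word_at -/p -/p' nth_blk.
    by rewrite subnKC.
  by rewrite ltn_sub2r // (leq_ltn_trans pi).
- by move=> i i0; rewrite /y' /splice (leq_trans i0 n0N).
- move=> w /words[->|[v hv ->]]; last by case: (hF v hv).
  have := star_segment bM y bM.1 (next_after_sub MN) (leq0n N); by rewrite subn0.
- move=> w /words[->|[v hv ->]].
    rewrite size_blk; split.
      have : m%:R <= (L + 2 * m)%:R :> R by rewrite ler_nat; clear; lia.
      have : G%:R <= N%:R :> R by rewrite ler_nat.
      move=> /(ler_wpM2l (ltW e0)).
      have : 0 <= e * G%:R by rewrite mulr_ge0 // ltW.
      move: hG; set x := _%:R; lra.
    by exists [::], (blk y n0 (N - n0)); rewrite /= -blk_cat subnKC.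
  have [_ sv _ hpre _] := hF v hv; split => //; rewrite sv.
  have [_ lv] := word1 v hv.
  have : m%:R <= (16 * C + 4 * m + 4 * L + 1)%:R :> R by rewrite ler_nat; clear; lia.
  move=> h; apply: (le_trans h); apply: (le_trans hl).
  by rewrite ler_wpM2l ?ler_nat // ltW.
- exists r => // w /words[->|[v hv ->]] B Bm; last by case: (hF v hv) => _ -> h _ _; exact: h.
  have := devG N B GN Bm; rewrite size_blk.
  have : 0 <= (size B)%:R :> R by [].
  have : 0 <= e * N%:R by rewrite mulr_ge0 // ltW.
  lra.
Qed.

End Refinement.

(** * The limit sequence *)

Section Infix.
Variables (R : realType) (K : finType).
Implicit Types (ws us : seq (seq K)) (s t v a b : seq K).

Lemma flatten_suffix ws h s v : (forall w, w \in ws -> (size w <= h)%N) -> flatten ws = s ++ v ->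
  exists a us, [/\ v = a ++ flatten us, {subset us <= ws} & (size a <= h)%N].
Proof.
elim: ws s => [|w ws IHws] s hw /=; first by case: s v => // -[] // _; exists [::], [::].
have hws u : u \in ws -> (size u <= h)%N by move=> uw; apply: hw; rewrite inE uw orbT.
have [ws_s|s_w] := leqP (size w) (size s) => e.
  have e1 : drop (size w) s ++ v = flatten ws.
    have := congr1 (drop (size w)) e; rewrite drop_size_cat // drop_cat => ->.
    by case: ltngtP ws_s => // -> _; rewrite subnn drop0 drop_size.
  have [a [us [-> sub ah]]] := IHws _ hws (esym e1).
  by exists a, us; split => // u /sub uw; rewrite inE uw orbT.
exists (drop (size s) w), ws; split => [|u uw|].
- by have := congr1 (drop (size s)) e; rewrite drop_cat s_w drop_size_cat.
- by rewrite inE uw orbT.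
- by rewrite size_drop (leq_trans (leq_subr _ _)) // hw ?mem_head.
Qed.

Lemma flatten_prefix ws h v t : (forall w, w \in ws -> (size w <= h)%N) -> flatten ws = v ++ t ->
  exists us b, [/\ v = flatten us ++ b, {subset us <= ws} & (size b <= h)%N].
Proof.
elim: ws v => [|w ws IHws] v hw /=; first by case: v => //= _; exists [::], [::].
have hws u : u \in ws -> (size u <= h)%N by move=> uw; apply: hw; rewrite inE uw orbT.
have [wv|vw] := leqP (size w) (size v) => e.
  have e0 : v = w ++ drop (size w) v.
    by rewrite -{1}(cat_take_drop (size w) v); congr (_ ++ _);
       have := congr1 (take (size w)) e; rewrite take_size_cat // takel_cat.
  have e1 : flatten ws = drop (size w) v ++ t.
    by move: e; rewrite {1}e0 -catA => /(congr1 (drop (size w))); rewrite !drop_size_cat.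
  have [us [b [e2 sub bh]]] := IHws _ hws e1.
  exists (w :: us), b; split => // [|u]; first by rewrite /= -catA -e2.
  by rewrite !inE => /orP[->//|/sub ->]; rewrite orbT.
exists [::], v; split => //.
by rewrite (leq_trans (ltnW vw)) // hw ?mem_head.
Qed.

Lemma flatten_infix ws h s v t : (forall w, w \in ws -> (size w <= h)%N) -> flatten ws = s ++ v ++ t ->
  exists a us b, [/\ v = a ++ flatten us ++ b, {subset us <= ws}, (size a <= h)%N & (size b <= h)%N].
Proof.
move=> hw /(flatten_suffix hw)[a [us [e sub ah]]].
have [va|av] := leqP (size v) (size a).
  by exists v, [::], [::]; rewrite /= cats0; split => //; apply: leq_trans ah.
have e0 : v = a ++ drop (size a) v.
  by rewrite -{1}(cat_take_drop (size a) v); congr (_ ++ _);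
     have := congr1 (take (size a)) e; rewrite takel_cat ?(ltnW av) // take_size_cat.
have e1 : flatten us = drop (size a) v ++ t.
  by move: e; rewrite {1}e0 -catA => /(congr1 (drop (size a))); rewrite !drop_size_cat.
have [vs [b [e2 sub2 bh]]] := flatten_prefix (fun w h => hw w (sub w h)) e1.
by exists a, vs, b; split => // [|w /sub2 /sub //]; rewrite -e2.
Qed.

Lemma dev_flatten B (r e : R) us : (forall w, w \in us -> dev B r w + (size B)%:R <= e * (size w)%:R) ->
  dev B r (flatten us) <= e * (size (flatten us))%:R.
Proof.
elim: us => [|w us IHus] h /=; first by rewrite /dev /occin /= cnt0 !mulr0 subrr normr0.
apply: (le_trans (dev_cat _ _ _ _)); rewrite size_cat natrD mulrDr.
have h1 := h w (mem_head _ _).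
have h2 : dev B r (flatten us) <= e * (size (flatten us))%:R.
  by apply: IHus => u uu; apply: h; rewrite inE uu orbT.
lra.
Qed.

(** A factor of a concatenation consists of whole words between two fragments of length at most [h];
    the fragments and their two junctions give the additive error. *)
Lemma dev_infix ws h s v t B (r e : R) : 0 <= r <= 1 -> 0 <= e -> (forall w, w \in ws -> (size w <= h)%N) ->
  flatten ws = s ++ v ++ t ->
  (forall w, w \in ws -> dev B r w + (size B)%:R <= e * (size w)%:R) ->
  dev B r v <= e * (size v)%:R + (2 * h + 2 * size B)%:R.
Proof.
move=> r01 e0 hw fE hd; have [a [us [b [-> sub ah bh]]]] := flatten_infix hw fE.
apply: (le_trans (dev_cat _ _ _ _)).
have h1 := dev_cat B r (flatten us) b.
have h2 := dev_flatten (fun w h => hd w (sub w h)).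
have h3 := dev_le B a r01; have h4 := dev_le B b r01.
have h5 : (size a)%:R <= h%:R :> R by rewrite ler_nat.
have h6 : (size b)%:R <= h%:R :> R by rewrite ler_nat.
rewrite [(2 * h + _)%:R]natrD !natrM !size_cat !natrD !mulrDr.
have : 0 <= e * (size a)%:R by rewrite mulr_ge0.
have : 0 <= e * (size b)%:R by rewrite mulr_ge0.
lra.
Qed.

End Infix.

Section Limit.
Variables (R : realType) (K : finType) (Y : nat -> nat -> K) (M : nat -> nat -> bool) (H : nat -> nat) (e : R).
Hypothesis e0 : 0 < e.
Let eps k := e / (2 ^ k.+1)%:R.
Let words k := marked_words (Y k) (M k).
Hypotheses (bM : forall k, bounded_marker (H k) (M k))
  (hcnt : forall k n, (cnt (fun i => Y k i != Y k.+1 i) n)%:R <= eps k * n%:R)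
  (hpre : forall k i, (i < k.+1)%N -> Y k.+1 i = Y k i)
  (hstar : forall k w, words k.+1 w -> star (words k) w)
  (hword : forall k w, words k.+1 w -> k%:R <= eps k * (size w)%:R /\ exists u t, w = u ++ blk (Y k) 0 k.+1 ++ t)
  (hdev : forall k, exists2 rho : seq K -> R, forall B, 0 <= rho B <= 1 &
     forall w, words k.+1 w -> forall B, (size B <= k)%N -> dev B (rho B) w <= eps k * (size w)%:R).

Let eps0 k : 0 < eps k.
Proof. by rewrite divr_gt0 // ltr0n expn_gt0. Qed.

Let y i := Y i i.

Lemma limit_prefix k i : (i <= k)%N -> Y k i = y i.
Proof.
move=> ik; rewrite -(subnKC ik); elim: (k - i)%N => [|j IHj]; first by rewrite addn0.
by rewrite addnS hpre // ltnS leq_addr.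
Qed.

(** On the first [n] letters the limit already equals [Y n], so only finitely many stages are added,
    with [eps k] summing to less than [e]. This uses [hcnt] at the given [n], however small. *)
Lemma limit_cnt n : (cnt (fun i => Y 0 i != y i) n)%:R <= e * n%:R.
Proof.
have h k : (cnt (fun i => Y 0 i != Y k i) n)%:R <= (e - e / (2 ^ k)%:R) * n%:R.
  elim: k => [|k IHk]; first by rewrite expn0 divr1 subrr mul0r /cnt big1 // => i _; rewrite eqxx.
  apply: (@le_trans _ _ ((cnt (fun i => Y 0 i != Y k i) n)%:R + (cnt (fun i => Y k i != Y k.+1 i) n)%:R)).
    rewrite -natrD ler_nat; apply: leq_trans (cnt_or _ _ n); apply: leq_cnt => i _.
    by apply: contraNT; rewrite negb_or !negbK => /andP[/eqP -> /eqP ->].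
  apply: (le_trans (lerD IHk (hcnt k n))); rewrite -mulrDl.
  have -> : e / (2 ^ k)%:R = 2 * eps k.
    by rewrite /eps expnS natrM; field; rewrite pnatr_eq0 -lt0n expn_gt0.
  by rewrite /eps; apply: ler_wpM2r => //; set x := e / _; lra.
rewrite (@eq_cnt _ (fun i => Y 0 i != Y n i)) => [|i /ltnW ni]; last by rewrite (limit_prefix ni).
apply: (le_trans (h n)); apply: ler_wpM2r => //.
by rewrite lerBlDr lerDl divr_ge0 // ltW.
Qed.

Lemma star_mono k k' w : (k <= k')%N -> star (words k') w -> star (words k) w.
Proof.
move=> kk; rewrite -(subnKC kk); elim: (k' - k)%N w => [|j IHj] w; first by rewrite addn0.
by rewrite addnS => /(star_sub (@hstar _)); exact: IHj.
Qed.

(** A block of the limit is a block of a late [Y k']. Extended to 0 on the left and to a cut on the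
    right, it becomes a concatenation of words of stage [k'], hence of stage [k]. *)
Lemma limit_star k i n : exists s t, star (words k) (s ++ blk y i n ++ t).
Proof.
pose k' := (k + (i + n))%N.
have [m1 m2 _ _] := next_cutP (bM k') (i + n); set m := next_cut _ _ _ in m1 m2.
exists (blk y 0 i), (blk (Y k') (i + n) (m - (i + n))).
apply: (@star_mono k k'); first exact: leq_addr.
rewrite catA -[X in blk y X n](add0n i) -blk_cat.
have -> : blk y 0 (i + n) = blk (Y k') 0 (i + n).
  by apply: eq_blk => j jn; rewrite limit_prefix // /k'; lia.
rewrite -blk_cat subnKC ?(ltnW m2) //.
by have := star_segment (bM k') (Y k') (bM k').1 m1 (leq0n m); rewrite subn0.
Qed.

Lemma limit_recurrent : uniformly_recurrent y.
Proof.
move=> n; pose h := H n.+1.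
exists (h.*2.+1) => i.
have [s [t [ws hws fE]]] := limit_star n.+1 i h.*2.+1.
have hsize w : w \in ws -> (size w <= h)%N by move=> /hws /(marked_words_size (bM _)) /andP[].
have [a [us [b [vE sub ah bh]]]] := flatten_infix hsize (esym fE).
(* The end fragments have length at most [h], so a window of length [2h + 1] contains a whole word,
   and with it the prefix of [y]. *)
case: us vE sub => [|w us] vE sub.
  by have := congr1 size vE; rewrite size_blk /= size_cat; lia.
have wws := sub w (mem_head _ _); have wh := hsize w wws.
have [_ [u [v wE]]] := hword (hws w wws).
have uw : (size u <= size w)%N by rewrite wE size_cat leq_addr.
exists (size (a ++ u)); first by rewrite size_cat; lia.
have := congr1 (fun s => take n (drop (size (a ++ u)) s)) vE => /=.
have -> : a ++ (w ++ flatten us) ++ b = (a ++ u) ++ blk (Y n) 0 n.+1 ++ v ++ flatten us ++ b.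
  by rewrite wE !catA.
rewrite drop_size_cat //.
have -> : (h.*2.+1 = size (a ++ u) + (h.*2.+1 - size (a ++ u)))%N by rewrite size_cat; lia.
rewrite blk_cat drop_size_cat ?size_blk // takel_cat ?size_blk //.
have le : (n <= h.*2.+1 - size (a ++ u))%N.
  have := congr1 size vE; rewrite size_blk /= !size_cat wE !size_cat size_blk; lia.
have take_blk (x : nat -> K) j m : (n <= m)%N -> take n (blk x j m) = blk x j n.
  by move=> nm; rewrite -(subnKC nm) blk_cat take_size_cat ?size_blk.
rewrite !take_blk // => ->.
by apply: eq_blk => k kn; rewrite limit_prefix // ltnW.
Qed.

(** Since [size B <= k <= eps k * size w], the junction cost at most doubles the relative deviation
    [eps k] of a word; the boundary term of a window is absorbed by its length. The frequency
    [rho B] may vary with [d], as [uniform_frequencies] allows. *)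
Lemma limit_frequencies : uniform_frequencies R y.
Proof.
move=> B d d0.
have [k [Bk kd]] : exists k, (size B <= k)%N /\ eps k <= d / 4%:R.
  have [N hN] := @archi_le R (d / 4%:R) e (ltac:(lra)).
  exists (N + size B)%N; rewrite leq_addl; split => //.
  rewrite ler_pdivrMr ?ltr0n ?expn_gt0 //; apply: hN.
  have := ltn_expl (N + size B).+1 (leqnn 2); lia.
have [rho r01 hrho] := hdev k.
pose h := H k.+1; pose ee := eps k; have ee0 : 0 < ee := eps0 k.
have [L hL] := @archi_le R ee (2 * h + 3 * size B)%:R ee0.
exists (rho B), L.+1; split => // i.
have [s [t [ws hws fE]]] := limit_star k.+1 i L.+1.
have hsize w : w \in ws -> (size w <= h)%N by move=> /hws /(marked_words_size (bM _)) /andP[].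
have ee2 : 0 <= 2 * ee by lra.
have := @dev_infix R K ws h s _ t B (rho B) (2 * ee) (r01 B) ee2 hsize (esym fE).
rewrite size_blk => h1.
have h2 : dev B (rho B) (blk y i L.+1) <= 2 * ee * L.+1%:R + (2 * h + 2 * size B)%:R.
  apply: h1 => w /hws ww; have [hk _] := hword ww; have := hrho w ww B Bk.
  have : (size B)%:R <= k%:R :> R by rewrite ler_nat.
  by move: hk; rewrite -/ee; set x := ee * _; rewrite -mulrA -/x; lra.
have h3 := occin_blk R B y i L.+1; rewrite distrC in h3; have h4 := hL L.+1 (leqnSn L).
move: h2 h3; rewrite /dev size_blk; set a := (occin _ _)%:R; set b := (cnt _ _)%:R => h2 h3.
have -> : b - rho B * L.+1%:R = (b - a) + (a - rho B * L.+1%:R) by ring.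
apply: (le_trans (ler_normD _ _)); apply: (le_trans (lerD h3 h2)).
have : ee * L.+1%:R <= d / 4%:R * L.+1%:R by rewrite ler_wpM2r.
have E : (2 * h + 3 * size B)%:R = (size B)%:R + (2 * h + 2 * size B)%:R :> R by rewrite -natrD; congr _%:R; lia.
have : 0 <= d * L.+1%:R by rewrite mulr_ge0 // ltW.
by move: h4; rewrite E; set u := (2 * h + 2 * _)%:R; lra.
Qed.

End Limit.

Section Approximation.
Variables (R : realType) (K : finType).

Theorem strictly_ergodic_approximation (y : seq_space K) (e : R) : generic_for_ergodic R y -> 0 < e ->
  exists y' : seq_space K, strictly_ergodic_point R y' /\
    forall n, (cnt (fun i => y i != y' i) n)%:R <= e * n%:R.
Proof.
move=> [nu [nu_erg y_gen]] e0.
have [S [z [ez mz yz]]] := marked_extension (generic_erg_seq nu_erg y_gen).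
(* Coding and boundedness are packed with the data, so that the refinement can be iterated by
   choice. *)
pose state := {t : (nat -> K) * (nat -> bool) * nat |
  [/\ coded R t.1.1 z, coded R t.1.2 z & bounded_marker t.2 t.1.2]}.
pose next k (t t' : state) := let: (y1, M1, _) := sval t in let: (y2, M2, _) := sval t' in
  let eps := e / (2 ^ k.+1)%:R in
  [/\ forall n, (cnt (fun i => y1 i != y2 i) n)%:R <= eps * n%:R,
      forall i, (i < k.+1)%N -> y2 i = y1 i,
      forall w, marked_words y2 M2 w -> star (marked_words y1 M1) w,
      forall w, marked_words y2 M2 w -> k%:R <= eps * (size w)%:R /\ exists u t, w = u ++ blk y1 0 k.+1 ++ t &
      exists2 rho : seq K -> R, forall B, 0 <= rho B <= 1 &
        forall w, marked_words y2 M2 w -> forall B, (size B <= k)%N -> dev B (rho B) w <= eps * (size w)%:R].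
have step (kt : nat * state) : exists t', next kt.1 kt.2 t'.
  case: kt => k [[[y1 M1] H1] [/= c1 c2 c3]].
  have eps0 : 0 < e / (2 ^ k.+1)%:R by rewrite divr_gt0 // ltr0n expn_gt0.
  have [y2 [M2 [H2 [d1 d2 d3 hn]]]] := refine_step ez k k.+1 mz c1 c2 c3 eps0.
  by exists (exist _ (y2, M2, H2) (And3 d1 d2 d3)).
have [f hf] := choice step.
(* Stage 0 cuts everywhere: its words are single letters. *)
have init : [/\ coded R (y : nat -> K) z, coded R (fun=> true) z & bounded_marker 1 (fun=> true)].
  split => //; last by split => // i; exists i.+1; split => //; lia.
  apply: (@coded_local _ _ _ _ _ 0%N) => //.
pose st := nat_rect (fun=> state) (exist _ (y : nat -> K, fun=> true, 1%N) init) (fun k t => f (k, t)).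
pose Y k := (sval (st k)).1.1; pose M k := (sval (st k)).1.2; pose H k := (sval (st k)).2.
have hst k : next k (st k) (st k.+1) by exact: (hf (k, st k)).
have bM k : bounded_marker (H k) (M k) by case: (svalP (st k)).
have {}hst k : let eps := e / (2 ^ k.+1)%:R in
  [/\ forall n, (cnt (fun i => Y k i != Y k.+1 i) n)%:R <= eps * n%:R,
      forall i, (i < k.+1)%N -> Y k.+1 i = Y k i,
      forall w, marked_words (Y k.+1) (M k.+1) w -> star (marked_words (Y k) (M k)) w,
      forall w, marked_words (Y k.+1) (M k.+1) w -> k%:R <= eps * (size w)%:R /\ exists u t, w = u ++ blk (Y k) 0 k.+1 ++ t &
      exists2 rho : seq K -> R, forall B, 0 <= rho B <= 1 &
        forall w, marked_words (Y k.+1) (M k.+1) w -> forall B, (size B <= k)%N -> dev B (rho B) w <= eps * (size w)%:R].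
  have := hst k; rewrite /next /Y /M.
  by case: (sval (st k)) => [[y1 M1] H1]; case: (sval (st k.+1)) => [[y2 M2] H2].
have h1 k := let: And5 a _ _ _ _ := hst k in a.
have h2 k := let: And5 _ a _ _ _ := hst k in a.
have h3 k := let: And5 _ _ a _ _ := hst k in a.
have h4 k := let: And5 _ _ _ a _ := hst k in a.
have h5 k := let: And5 _ _ _ _ a := hst k in a.
exists (fun i => Y i i); split.
  apply: uniform_strictly_ergodic.
    exact: (limit_frequencies e0 bM h2 h3 h4 h5).
  exact: (limit_recurrent e0 bM h2 h3 h4).
exact: (limit_cnt e0 h1 h2).
Qed.

End Approximation.

(** * Correlation *)

Section Positivity.
Variables (R : realType) (f : nat -> R).

Lemma limn_esup_gt0 : (0 < limn_esup (fun n => (f n)%:E))%E <->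
  exists2 c : R, 0 < c & forall N, exists2 n, (N <= n)%N & c <= f n.
Proof.
rewrite /limn_esup limf_esupE; split => [h|[c c0 hc]].
  have [c c0 hc] : exists2 c : R, 0 < c & (c%:E < ereal_inf [set ereal_sup ((fun n => (f n)%:E) @` V) | V in \oo])%E.
    move: h; case: (ereal_inf _) => [r| |] // h; last by exists 1; rewrite // ltry.
    by rewrite lte_fin in h; exists (r / 2); rewrite ?lte_fin; lra.
  exists c => // N.
  have : (c%:E < ereal_sup ((fun n => (f n)%:E) @` [set n | (N <= n)%N]))%E.
    by apply: (lt_le_trans hc); apply: ereal_inf_lbound; exists [set n | (N <= n)%N] => //; exact: nbhs_infty_ge.
  by move=> /ereal_sup_gt[_ [n /= Nn <-]]; rewrite lte_fin => /ltW ?; exists n.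
apply: (@lt_le_trans _ _ c%:E); first by rewrite lte_fin.
apply: le_ereal_inf_tmp => _ [V [N _ NV] <-]; have [n Nn cn] := hc N.
apply: (@le_trans _ _ (f n)%:E); first by rewrite lee_fin.
by apply: ereal_sup_ubound; exists n => //; exact: NV.
Qed.

Lemma limn_einf_gt0 : (0 < limn_einf (fun n => (f n)%:E))%E <->
  exists2 c : R, 0 < c & exists N, forall n, (N <= n)%N -> c <= f n.
Proof.
rewrite /limn_einf oppe_gt0 /limn_esup limf_esupE; split => [h|[c c0 [N hc]]].
  have [_ [V [N _ NV] <-] hV] := ereal_inf_lt h.
  have [c c0 hc] : exists2 c : R, 0 < c & (ereal_sup ((\- (fun n => (f n)%:E))%E @` V) <= (- c)%:E)%E.
    move: hV; case: (ereal_sup _) => [r| |] //= h'; last by exists 1; rewrite // leNye.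
    by rewrite lte_fin in h'; exists (- r); rewrite ?lee_fin; lra.
  exists c => //; exists N => n Nn.
  rewrite -lerN2 -lee_fin; apply: le_trans hc; apply: ereal_sup_ubound.
  by exists n; [exact: NV|].
apply: (@le_lt_trans _ _ (- c)%:E); last by rewrite lte_fin oppr_lt0.
apply: (@le_trans _ _ (ereal_sup ((\- (fun n => (f n)%:E))%E @` [set n | (N <= n)%N]))).
  by apply: ereal_inf_lbound; exists [set n | (N <= n)%N] => //; exact: nbhs_infty_ge.
by apply: ge_ereal_sup => _ [n Nn <-]; rewrite lee_fin lerN2 hc.
Qed.

End Positivity.

Section CorrelationStability.
Variable R : realType.
Local Notation C := R[i].
Local Notation "x %:C" := (real_complex R x) : ring_scope.

Lemma corr_initial_block (a b : nat -> C) n : corr (initial_block a n) (initial_block b n) =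
  n%:R^-1 * (\sum_(i < n) a i * (b i)^* ) -
  (n%:R^-1 * \sum_(i < n) a i) * (n%:R^-1 * \sum_(i < n) (b i)^* ).
Proof.
by rewrite /corr; congr (_ * _ - _ * _ * (_ * _)); apply: eq_bigr => i _; rewrite !tnth_mktuple.
Qed.

(** For fixed [a] the correlation is conjugate linear in its second argument. Each of its two terms
    is bounded by the mean distance between [b] and [b'], since both the values and the mean of [a]
    have modulus at most 1. *)
Lemma corr_dist (a b b' : nat -> C) n : (forall i, `|a i| <= 1) ->
  `|corr (initial_block a n) (initial_block b n) - corr (initial_block a n) (initial_block b' n)| <=
  2 * (n%:R^-1 * \sum_(i < n) `|b i - b' i|).
Proof.
move=> a1; rewrite !corr_initial_block.
set A := n%:R^-1 * \sum_(i < n) a i.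
have A1 : `|A| <= 1.
  case: n @A => [|n] A; first by rewrite /A big_ord0 mulr0 normr0.
  have n0 : 0 < n.+1%:R :> C by rewrite ltr0n.
  rewrite /A normrM normfV (gtr0_norm n0) mulrC ler_pdivrMr // mul1r.
  apply: (le_trans (ler_norm_sum _ _ _)).
  apply: (@le_trans _ _ (\sum_(i < n.+1) 1)); first by apply: ler_sum => i _.
  by rewrite sumr_const card_ord.
have -> : n%:R^-1 * (\sum_(i < n) a i * (b i)^*) - A * (n%:R^-1 * \sum_(i < n) (b i)^*) -
    (n%:R^-1 * (\sum_(i < n) a i * (b' i)^*) - A * (n%:R^-1 * \sum_(i < n) (b' i)^*)) =
    n%:R^-1 * (\sum_(i < n) a i * (b i - b' i)^*) - A * (n%:R^-1 * \sum_(i < n) (b i - b' i)^*).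
  rewrite [X in _ = _ * X - _](eq_bigr (fun i : 'I_n => a i * (b i)^* - a i * (b' i)^*)) => [|i _]; last by rewrite rmorphB mulrBr.
  rewrite [X in _ = _ - A * (_ * X)](eq_bigr (fun i : 'I_n => (b i)^* - (b' i)^*)) => [|i _]; last by rewrite rmorphB.
  rewrite !sumrB; ring.
rewrite mulr2n mulrDl mul1r; apply: (le_trans (ler_normB _ _)).
have n0 : 0 <= n%:R^-1 :> C by rewrite invr_ge0.
have h (c : nat -> C) : (forall i, `|c i| <= 1) ->
    `|n%:R^-1 * (\sum_(i < n) c i * (b i - b' i)^*)| <= n%:R^-1 * \sum_(i < n) `|b i - b' i|.
  move=> c1; rewrite normrM (ger0_norm n0); apply: ler_wpM2l => //.
  apply: (le_trans (ler_norm_sum _ _ _)); apply: ler_sum => i _.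
  by rewrite normrM norm_conjC ler_piMl.
apply: lerD; first exact: h.
rewrite normrM; apply: le_trans (ler_piMl (normr_ge0 _) A1) _.
by have := h (fun=> 1) (fun=> ltac:(by rewrite normr1)); under eq_bigr do rewrite mul1r.
Qed.

(** Points of the disc are at distance at most 2 and [corr_dist] doubles the mean distance, hence
    the factor 4. *)
Lemma abs_corr_near (K : {fset C}) (x y y' : nat -> K) (e : R) n :
  (forall z : C, z \in K -> `|z| <= 1) -> 0 <= e ->
  (cnt (fun i => y i != y' i) n)%:R <= e * n%:R ->
  Normc.normc (corr (initial_block (val \o x) n) (initial_block (val \o y) n)) <=
  Normc.normc (corr (initial_block (val \o x) n) (initial_block (val \o y') n)) + 4%:R * e.
Proof.
move=> K1 e0 hn.
have v1 (z : K) : `|val z| <= 1 by apply: K1; exact: valP.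
set u := corr _ _; set v := corr _ _.
have d : `|u - v| <= (4%:R * e)%:C.
  apply: (le_trans (corr_dist (val \o y) (val \o y') n (fun i => v1 (x i)))).
  have s : \sum_(i < n) `|(val \o y) i - (val \o y') i| <= 2 * (cnt (fun i => y i != y' i) n)%:R.
    rewrite /cnt natr_sum mulr_sumr; apply: ler_sum => i _ /=.
    have [->|_] := eqVneq (y i) (y' i); first by rewrite subrr normr0 mulr0.
    by rewrite mulr1; apply: (le_trans (ler_normB _ _)); rewrite [leRHS](_ : _ = 1 + 1) // lerD ?v1.
  have s2 : (cnt (fun i => y i != y' i) n)%:R <= e%:C * n%:R :> C.
    have -> : e%:C * n%:R = (e * n%:R)%:C by rewrite rmorphM rmorph_nat.
    by rewrite -(rmorph_nat (real_complex R)) lecR.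
  have s3 : n%:R^-1 * \sum_(i < n) `|(val \o y) i - (val \o y') i| <= 2 * e%:C.
    case: (n) s s2 => [|m] s s2; first by rewrite big_ord0 mulr0 mulr_ge0 // lecR.
    rewrite ler_pdivrMl ?ltr0n //; apply: (le_trans s).
    by rewrite mulrCA [X in _ <= _ * X]mulrC ler_wpM2l.
  have -> : (4%:R * e)%:C = 2 * (2 * e%:C) by rewrite mulrA -natrM rmorphM rmorph_nat.
  by rewrite ler_wpM2l.
rewrite -lecR rmorphD /=.
have -> (z : C) : (Normc.normc z)%:C = `|z| by [].
rewrite -{1}(subrK v u) addrC; apply: (le_trans (ler_normD _ _)).
by rewrite lerD2l.
Qed.

End CorrelationStability.

Theorem theorem1p7 (R : realType) (K : {fset R[i]})
    (K_disc : forall z : R[i], z \in K -> `|z| <= 1) (x : nat -> K) :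
  ((exists y : nat -> K,
      strictly_ergodic_point R y /\ weakly_correlated (val \o x) (val \o y)) <->
   (exists y : nat -> K,
      generic_for_ergodic R y /\ weakly_correlated (val \o x) (val \o y))) /\
  ((exists y : nat -> K,
      strictly_ergodic_point R y /\ strongly_correlated (val \o x) (val \o y)) <->
   (exists y : nat -> K,
      generic_for_ergodic R y /\ strongly_correlated (val \o x) (val \o y))).
Proof.
have near (y : nat -> K) (c : R) : generic_for_ergodic R y -> 0 < c -> exists2 y' : nat -> K,
    strictly_ergodic_point R y' & forall n,
    c <= Normc.normc (corr (initial_block (val \o x) n) (initial_block (val \o y) n)) ->
    c / 2 <= Normc.normc (corr (initial_block (val \o x) n) (initial_block (val \o y') n)).
  (* A change of density [c / 8] moves each correlation by at most [c / 2]. The same [y'] serves at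
     every time [n], which settles the upper and the lower limit alike. *)
  move=> gy c0; have c8 : 0 < c / 8%:R by rewrite divr_gt0.
  have [y' [sy hy]] := strictly_ergodic_approximation gy c8.
  exists y' => // n cn; have := abs_corr_near x K_disc (ltW c8) (hy n).
  by move: cn; set u := Normc.normc _; set v := Normc.normc _; lra.
split; split=> -[y [hy cy]].
- by exists y; split => //; exact: strictly_ergodic_generic.
- have [c c0 hc] := (limn_esup_gt0 _).1 cy.
  have [y' sy hy'] := near y c hy c0; exists y'; split => //.
  apply/limn_esup_gt0; exists (c / 2) => [|N]; first by rewrite divr_gt0.
  by have [n Nn cn] := hc N; exists n => //; exact: hy'.
- by exists y; split => //; exact: strictly_ergodic_generic.
- have [c c0 [N hc]] := (limn_einf_gt0 _).1 cy.
  have [y' sy hy'] := near y c hy c0; exists y'; split => //.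
  apply/limn_einf_gt0; exists (c / 2); first by rewrite divr_gt0.
  by exists N => n Nn; apply: hy'; exact: hc.
Qed.
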